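(* Let solutions $\psi_n$ of the KG equation concentrate at the trajectory $\hat{\mathbf r}$, let $t_0$ be the time in condition (iv), and suppose $\bar\rho_n(t_0)\to\bar\rho_\infty$. Then the restricted energy converges uniformly: $\bar{\mathcal E}_n(t)\to\bar{\mathcal E}_\infty(t)$ uniformly on $[T_-,T_+]$, where $$\bar{\mathcal E}_\infty(t)=\bar{\mathcal E}_\infty(t_0)-\bar\rho_\infty\int_{t_0}^t\partial_t\hat{\mathbf r}(t')\cdot\nabla\varphi_\infty(t')\,dt'.$$
   Context: Fix constants $c>0$, $m>0$ and a real charge $q$. For parameters $\chi>0$, $a>0$ and a real electric potential $\varphi(t,\mathbf x)$, $\mathbf x\in\mathbb R^3$, the KG equation for complex $\psi$ is $-c^{-2}\tilde\partial_t^2\psi+\Delta\psi-G_a'(|\psi|^2)\psi-\kappa_0^2\psi=0$, where $\tilde\partial_t=\partial_t+\mathrm i q\varphi/\chi$, $\kappa_0=mc/\chi$. Here $G_a(s)=a^{-5}G_1(a^3s)$, where $G_1(0)=0$, $G_1'\in C^1((0,\infty))$, the map $\psi\mapsto G_1'(|\psi|^2)\psi$ extends to a $C^\alpha(\mathbb C)$ function and $\psi\mapsto G_1(|\psi|^2)$ is $C^{1+\alpha}(\mathbb C)$ for every $\alpha\in(0,1)$, and for every $C_1$ there is $C$ with $|G_1(|\psi|^2)|\le C|\psi|^{1+\alpha}$, $|G_1'(|\psi|^2)||\psi|\le C|\psi|^\alpha$ for $|\psi|\le C_1$. Put $a_C=\chi/(mc)$. Charge density: $\rho=-\frac{\chi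 q}{mc^2}\operatorname{Im}(\psi^*\tilde\partial_t\psi)$. Energy density: $\mathcal E=\frac{\chi^2}{2m}\big[c^{-2}|\tilde\partial_t\psi|^2+|\nabla\psi|^2+G_a(|\psi|^2)+\kappa_0^2|\psi|^2\big]$. Write $\nabla_{0,\mathbf x}=(c^{-1}\partial_t,\partial_1,\partial_2,\partial_3)$. Trajectory: $\hat{\mathbf r}\in C^2([T_-,T_+];\mathbb R^3)$ with $|\partial_t\hat{\mathbf r}|,|\partial_t^2\hat{\mathbf r}|\le C$. For $R_n>0$, $R_n\to0$, let $\Omega_n(t)=\{\mathbf x:|\mathbf x-\hat{\mathbf r}(t)|\le R_n\}$ and $\hat\Omega_n=\{(t,\mathbf x):T_-\le t\le T_+,\ \mathbf x\in\Omega_n(t)\}$. Localized KG equations: sequences $a_n\to0$, $\chi_n\to0$ with $a_{C,n}/a_n\le C$ and $R_n/a_n\to\infty$, and potentials $\varphi_n\in C^2(\hat\Omega_n)$ with $\sup_{\hat\Omega_n}(|\varphi_n|+|\nabla_{0,\mathbf x}\varphi_n|)\le C$ uniformly in $n$, and a limit potential $\varphi_\infty(t,\mathbf x)=\varphi_\infty(t,\hat{\mathbf r}(t))+(\mathbf x-\hat{\mathbf r}(t))\cdot\nabla\varphi_\infty(t)$ such that $\sup_{\hat\Omega_n}(|\varphi_n-\varphi_\infty|+|\nabla_{0,\mathbf x}\varphi_n-\nabla_{0,\mathbf x}\varphi_\infty|)\to0$ and $|\varphi_\infty(t,\hat{\mathbf r}(t))|,|\nabla\varphi_\infty(t)|,|\partial_t\nabla\varphi_\infty(t)|\le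 C$. Concentrating solutions: for such a localized sequence, functions $\psi_n\in C^2(\hat\Omega_n)$ solving the KG equation with parameters $(\chi_n,a_n,\varphi_n)$ in $\hat\Omega_n$ such that: (i) $\max_t\int_{\Omega_n(t)}[a_C^2|\nabla_{0,\mathbf x}\psi_n|^2+a_C^2|G_a(|\psi_n|^2)|+|\psi_n|^2]\,d^3x\le C$; (ii) $\max_t\int_{\partial\Omega_n(t)}[a_C^2|\nabla_{0,\mathbf x}\psi_n|^2+a_C^2|G_a(|\psi_n|^2)|+|\psi_n|^2]\,d^2\sigma\to0$; (iii) the restricted energy $\bar{\mathcal E}_n(t)=\int_{\Omega_n(t)}\mathcal E_n\,d^3x$ satisfies $\bar{\mathcal E}_n(t)\ge c_0>0$ for $n\ge n_0$, $t\in[T_-,T_+]$; (iv) there is $t_0\in[T_-,T_+]$ with $\bar{\mathcal E}_n(t_0)\to\bar{\mathcal E}_\infty(t_0)$. Restricted charge: $\bar\rho_n(t)=\int_{\Omega_n(t)}\rho_n\,d^3x$. *)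

(* Defs.v *)
From Stdlib Require Import Reals.
From Coquelicot Require Import Coquelicot.
Open Scope R_scope.

Definition CC : Type := Complex.C.

Definition R3 : Type := (R * R * R)%type.
Definition c1 (x : R3) : R := fst (fst x).
Definition c2 (x : R3) : R := snd (fst x).
Definition c3 (x : R3) : R := snd x.
Definition add3 (x y : R3) : R3 := (c1 x + c1 y, c2 x + c2 y, c3 x + c3 y).
Definition sub3 (x y : R3) : R3 := (c1 x - c1 y, c2 x - c2 y, c3 x - c3 y).
Definition scal3 (s : R) (x : R3) : R3 := (s * c1 x, s * c2 x, s * c3 x).
Definition dot3 (x y : R3) : R := c1 x * c1 y + c2 x * c2 y + c3 x * c3 y.
Definition norm3 (x : R3) : R := sqrt (dot3 x x).
Definition e3 (k : nat) : R3 :=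
  match k with 1%nat => (1, 0, 0) | 2%nat => (0, 1, 0) | _ => (0, 0, 1) end.

Definition ex_derC (f : R -> CC) (s : R) : Prop :=
  ex_derive (fun u => fst (f u)) s /\ ex_derive (fun u => snd (f u)) s.
Definition DerC (f : R -> CC) (s : R) : CC :=
  (Derive (fun u => fst (f u)) s, Derive (fun u => snd (f u)) s).

(* partial derivatives: index 0 = d/dt, indices 1,2,3 = d/dx_k *)
Definition line (i : nat) (f : R -> R3 -> CC) (t : R) (x : R3) : R -> CC :=
  match i with
  | O => fun s => f s x
  | S _ => fun s => f t (add3 x (scal3 (s - 0) (e3 i)))
  end.
Definition at_pt (i : nat) (t : R) : R := match i with O => t | S _ => 0 end.
Definition ex_partial (i : nat) (f : R -> R3 -> CC) (t : R) (x : R3) : Prop :=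
  ex_derC (line i f t x) (at_pt i t).
Definition partial (i : nat) (f : R -> R3 -> CC) (t : R) (x : R3) : CC :=
  DerC (line i f t x) (at_pt i t).

Definition contST (f : R -> R3 -> CC) (t : R) (x : R3) : Prop :=
  forall eps, 0 < eps -> exists del, 0 < del /\
    forall s y, Rabs (s - t) < del -> norm3 (sub3 y x) < del ->
      Cmod (Cminus (f s y) (f t x)) < eps.
Definition openST (U : R -> R3 -> Prop) : Prop :=
  forall t x, U t x -> exists del, 0 < del /\
    forall s y, Rabs (s - t) < del -> norm3 (sub3 y x) < del -> U s y.

Definition C2_on (S : R -> R3 -> Prop) (f : R -> R3 -> CC) : Prop :=
  exists U, openST U /\ (forall t x, S t x -> U t x) /\
    forall t x, U t x ->
      contST f t x /\
      forall i, (i < 4)%nat ->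
        ex_partial i f t x /\ contST (partial i f) t x /\
        forall j, (j < 4)%nat ->
          ex_partial j (partial i f) t x /\ contST (partial j (partial i f)) t x.

Definition realF (phi : R -> R3 -> R) : R -> R3 -> CC := fun t x => RtoC (phi t x).

Definition grad0_sq (c : R) (f : R -> R3 -> CC) (t : R) (x : R3) : R :=
  (Cmod (partial 0 f t x))^2 / c^2 + (Cmod (partial 1 f t x))^2
  + (Cmod (partial 2 f t x))^2 + (Cmod (partial 3 f t x))^2.
Definition grad0_norm (c : R) (phi : R -> R3 -> R) (t : R) (x : R3) : R :=
  sqrt (grad0_sq c (realF phi) t x).
Definition grad0_dist (c : R) (phi phi' : R -> R3 -> R) (t : R) (x : R3) : R :=
  sqrt (grad0_sq c (fun s y => Cminus (realF phi s y) (realF phi' s y)) t x).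
Definition gradx_sq (f : R -> R3 -> CC) (t : R) (x : R3) : R :=
  (Cmod (partial 1 f t x))^2 + (Cmod (partial 2 f t x))^2 + (Cmod (partial 3 f t x))^2.
Definition Lap (f : R -> R3 -> CC) (t : R) (x : R3) : CC :=
  Cplus (Cplus (partial 1 (partial 1 f) t x) (partial 2 (partial 2 f) t x))
        (partial 3 (partial 3 f) t x).

Definition rpow (x a : R) : R := if Rle_dec x 0 then 0 else Rpower x a.

Definition loc_holder_C (F : CC -> CC) (al : R) : Prop :=
  forall K, 0 < K -> exists L, forall z w, Cmod z <= K -> Cmod w <= K ->
    Cmod (Cminus (F z) (F w)) <= L * rpow (Cmod (Cminus z w)) al.
Definition loc_holder_R (F : CC -> R) (al : R) : Prop :=
  forall K, 0 < K -> exists L, forall z w, Cmod z <= K -> Cmod w <= K ->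
    Rabs (F z - F w) <= L * rpow (Cmod (Cminus z w)) al.
Definition dRe (h : CC -> R) (z : CC) : R := Derive (fun s => h (Cplus z (RtoC s))) 0.
Definition dIm (h : CC -> R) (z : CC) : R := Derive (fun s => h (Cplus z (Cmult Ci (RtoC s)))) 0.
Definition C1holder (h : CC -> R) (al : R) : Prop :=
  (forall z, ex_derive (fun s => h (Cplus z (RtoC s))) 0 /\
             ex_derive (fun s => h (Cplus z (Cmult Ci (RtoC s)))) 0) /\
  loc_holder_R (dRe h) al /\ loc_holder_R (dIm h) al.

Definition G1_hyp (G1 G1p G1pp : R -> R) : Prop :=
  G1 0 = 0 /\
  (forall s, 0 < s -> is_derive G1 s (G1p s)) /\
  (forall s, 0 < s -> is_derive G1p s (G1pp s) /\ continuous G1pp s) /\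
  (forall al, 0 < al < 1 ->
     (exists F : CC -> CC, loc_holder_C F al /\
        forall z, z <> RtoC 0 -> F z = Cmult (RtoC (G1p ((Cmod z)^2))) z) /\
     C1holder (fun z => G1 ((Cmod z)^2)) al /\
     (forall C1, exists Cb, forall z, Cmod z <= C1 ->
        Rabs (G1 ((Cmod z)^2)) <= Cb * rpow (Cmod z) (1 + al) /\
        (z <> RtoC 0 -> Rabs (G1p ((Cmod z)^2)) * Cmod z <= Cb * rpow (Cmod z) al))).

(* G_a(s) = a^-5 G_1(a^3 s);  G_a'(|psi|^2) psi = a^-2 G_1'(a^3 |psi|^2) psi,
   extended by its continuous value 0 at psi = 0 *)
Definition Ga (G1 : R -> R) (a s : R) : R := / a ^ 5 * G1 (a ^ 3 * s).
Definition GapPsi (G1p : R -> R) (a : R) (z : CC) : CC :=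
  match Req_EM_T (Cmod z) 0 with
  | left _ => RtoC 0
  | right _ => Cmult (RtoC (/ a ^ 2 * G1p (a ^ 3 * (Cmod z)^2))) z
  end.

Definition covt (q chi : R) (phi : R -> R3 -> R) (f : R -> R3 -> CC) : R -> R3 -> CC :=
  fun t x => Cplus (partial 0 f t x) (Cmult (Cmult Ci (RtoC (q * phi t x / chi))) (f t x)).

Definition KG_at (c m q : R) (G1p : R -> R) (chi a : R) (phi : R -> R3 -> R)
  (psi : R -> R3 -> CC) (t : R) (x : R3) : Prop :=
  let kappa0 := m * c / chi in
  Cplus (Cplus (Cplus (Cmult (RtoC (- / c ^ 2)) (covt q chi phi (covt q chi phi psi) t x))
                      (Lap psi t x))
               (Copp (GapPsi G1p a (psi t x))))
        (Copp (Cmult (RtoC (kappa0 ^ 2)) (psi t x))) = RtoC 0.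

Definition rho (c m q chi : R) (phi : R -> R3 -> R) (psi : R -> R3 -> CC) t x : R :=
  - (chi * q / (m * c ^ 2)) * Im (Cmult (Cconj (psi t x)) (covt q chi phi psi t x)).
Definition energy (c m q : R) (G1 : R -> R) (chi a : R) (phi : R -> R3 -> R)
  (psi : R -> R3 -> CC) t x : R :=
  let kappa0 := m * c / chi in
  chi ^ 2 / (2 * m) *
   ((Cmod (covt q chi phi psi t x)) ^ 2 / c ^ 2 + gradx_sq psi t x
    + Ga G1 a ((Cmod (psi t x)) ^ 2) + kappa0 ^ 2 * (Cmod (psi t x)) ^ 2).

Definition sph (th ph : R) : R3 := (sin th * cos ph, sin th * sin ph, cos th).
Definition ball_int (f : R3 -> R) (c0 : R3) (rad : R) : R :=
  RInt (fun r => RInt (fun th => RInt (fun ph =>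
     f (add3 c0 (scal3 r (sph th ph))) * (r ^ 2 * sin th)) 0 (2 * PI)) 0 PI) 0 rad.
Definition sphere_int (f : R3 -> R) (c0 : R3) (rad : R) : R :=
  RInt (fun th => RInt (fun ph =>
     f (add3 c0 (scal3 rad (sph th ph))) * (rad ^ 2 * sin th)) 0 (2 * PI)) 0 PI.

Definition vel (rh : R -> R3) (t : R) : R3 :=
  (Derive (fun s => c1 (rh s)) t, Derive (fun s => c2 (rh s)) t, Derive (fun s => c3 (rh s)) t).
Definition acc (rh : R -> R3) (t : R) : R3 :=
  (Derive (Derive (fun s => c1 (rh s))) t, Derive (Derive (fun s => c2 (rh s))) t,
   Derive (Derive (fun s => c3 (rh s))) t).
(* rh is C^2 (on R, i.e. a C^2 extension of the trajectory on [T-,T+]) *)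
Definition C2_real (f : R -> R) : Prop :=
  forall t, ex_derive f t /\ ex_derive (Derive f) t /\ continuous (Derive (Derive f)) t.
Definition C2_traj (rh : R -> R3) : Prop :=
  C2_real (fun s => c1 (rh s)) /\ C2_real (fun s => c2 (rh s)) /\ C2_real (fun s => c3 (rh s)).

Definition tube (Tm Tp : R) (rh : R -> R3) (Rn : R) : R -> R3 -> Prop :=
  fun t x => Tm <= t <= Tp /\ norm3 (sub3 x (rh t)) <= Rn.

(* phi_inf(t,x) = phi_inf(t, rh(t)) + (x - rh(t)) . grad phi_inf(t),
   with p0 t = phi_inf(t, rh t) and g t = grad phi_inf(t) *)
Definition phi_inf (rh : R -> R3) (p0 : R -> R) (g : R -> R3) : R -> R3 -> R :=
  fun t x => p0 t + dot3 (sub3 x (rh t)) (g t).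
Definition dg (g : R -> R3) (t : R) : R3 :=
  (Derive (fun s => c1 (g s)) t, Derive (fun s => c2 (g s)) t, Derive (fun s => c3 (g s)) t).

Definition trajectory (Tm Tp : R) (rh : R -> R3) (Cst : R) : Prop :=
  C2_traj rh /\
  forall t, Tm <= t <= Tp -> norm3 (vel rh t) <= Cst /\ norm3 (acc rh t) <= Cst.

Definition localized (c m Tm Tp : R) (rh : R -> R3) (Cst : R)
  (a chi Rn : nat -> R) (phi : nat -> R -> R3 -> R) (p0 : R -> R) (g : R -> R3) : Prop :=
  (forall n, 0 < a n /\ 0 < chi n /\ 0 < Rn n) /\
  is_lim_seq a 0 /\ is_lim_seq chi 0 /\ is_lim_seq Rn 0 /\
  (forall n, (chi n / (m * c)) / a n <= Cst) /\
  is_lim_seq (fun n => Rn n / a n) p_infty /\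
  (forall n, C2_on (tube Tm Tp rh (Rn n)) (realF (phi n))) /\
  (forall n t x, tube Tm Tp rh (Rn n) t x ->
      Rabs (phi n t x) + grad0_norm c (phi n) t x <= Cst) /\
  (forall t, ex_derive p0 t /\ ex_derive (fun s => c1 (g s)) t /\
             ex_derive (fun s => c2 (g s)) t /\ ex_derive (fun s => c3 (g s)) t) /\
  (forall eps, 0 < eps -> exists N, forall n, (N <= n)%nat -> forall t x,
      tube Tm Tp rh (Rn n) t x ->
      Rabs (phi n t x - phi_inf rh p0 g t x)
      + grad0_dist c (phi n) (phi_inf rh p0 g) t x <= eps) /\
  (forall t, Tm <= t <= Tp ->
      Rabs (p0 t) <= Cst /\ norm3 (g t) <= Cst /\ norm3 (dg g t) <= Cst).

Definition Ebar (c m q : R) (G1 : R -> R) (rh : R -> R3) (a chi Rn : nat -> R)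
  (phi : nat -> R -> R3 -> R) (psi : nat -> R -> R3 -> CC) (n : nat) (t : R) : R :=
  ball_int (fun x => energy c m q G1 (chi n) (a n) (phi n) (psi n) t x) (rh t) (Rn n).
Definition rhobar (c m q : R) (rh : R -> R3) (chi Rn : nat -> R)
  (phi : nat -> R -> R3 -> R) (psi : nat -> R -> R3 -> CC) (n : nat) (t : R) : R :=
  ball_int (fun x => rho c m q (chi n) (phi n) (psi n) t x) (rh t) (Rn n).

Definition dens (c m : R) (G1 : R -> R) (chi a : R) (psi : R -> R3 -> CC) t x : R :=
  let aC := chi / (m * c) in
  aC ^ 2 * grad0_sq c psi t x + aC ^ 2 * Rabs (Ga G1 a ((Cmod (psi t x)) ^ 2))
  + (Cmod (psi t x)) ^ 2.

Definition concentrating (c m q : R) (G1 G1p : R -> R) (Tm Tp : R) (rh : R -> R3)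
  (Cst : R) (a chi Rn : nat -> R) (phi : nat -> R -> R3 -> R)
  (psi : nat -> R -> R3 -> CC) (t0 E0 : R) : Prop :=
  (forall n, C2_on (tube Tm Tp rh (Rn n)) (psi n)) /\
  (forall n t x, tube Tm Tp rh (Rn n) t x ->
      KG_at c m q G1p (chi n) (a n) (phi n) (psi n) t x) /\
  (forall n t, Tm <= t <= Tp ->
      ball_int (dens c m G1 (chi n) (a n) (psi n) t) (rh t) (Rn n) <= Cst) /\
  (forall eps, 0 < eps -> exists N, forall n, (N <= n)%nat -> forall t, Tm <= t <= Tp ->
      sphere_int (dens c m G1 (chi n) (a n) (psi n) t) (rh t) (Rn n) <= eps) /\
  (exists c0 n0, 0 < c0 /\ forall n t, (n0 <= n)%nat -> Tm <= t <= Tp ->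
      c0 <= Ebar c m q G1 rh a chi Rn phi psi n t) /\
  (Tm <= t0 <= Tp /\ is_lim_seq (fun n => Ebar c m q G1 rh a chi Rn phi psi n t0) E0).

(* Main.v *)
(** Let [Ebar], [rhobar] be the energy and charge in the moving ball, [J] the current and
    [D = int (x - rh) rho] the dipole moment.  The local conservation laws
    [d_t E = div S - grad phi . J] and [d_t rho = - div J], integrated over the ball, give
    [Ebar' = - int grad phi . J], [rhobar' = 0] and [D' = int J - rhobar v], up to boundary
    terms, which tend to zero uniformly because [|E|, |S|, |J|, |rho|] are dominated by the
    concentration density.  Since [D = O(R_n)] and [grad phi_n -> g], the function
    [Ebar + g . D + rho_inf int v . g] has a uniformly small derivative, and the mean value
    theorem finishes the proof.  Using the derivative of [g . D], rather than integrating by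
    parts in time, matters because [g'] is only bounded and need not be Riemann integrable. *)

From Stdlib Require Import Reals Lra Lia Classical ClassicalEpsilon.
From Coquelicot Require Import Coquelicot.
(* Last, since the Stdlib has its own [c1]. *)
Require Import Defs.
Open Scope R_scope.

(** * Parametric integrals *)

(** Ball and sphere integrals are iterated one-variable integrals in spherical coordinates about the
    moving centre. In these coordinates the moving ball is a fixed box, and a time derivative of an
    integral is differentiation under the integral sign. The divergence theorem is proved in the
    same coordinates, by integrating one exact derivative per variable, so the order of integration
    is never exchanged.

    Two obstacles shape the rest. First, [G1p] may blow up at 0 while [psi] may vanish; that [Ga] of
    |psi|^2 is nevertheless C^1 has to be drawn from the growth bounds near 0, for which the single
    exponent 1/2 suffices. Second, the constants must be independent of [n] although [chi] tends to
    0: the covariant derivative contains 1/[chi], but each density carries enough powers of [chi] to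
    cancel it, so that a bound on [phi] is enough.

    Since [psi] and [phi] are regular only on some open neighbourhood of the tube, all rules of
    calculus are stated on an open set. *)

Lemma locally_segment {X : UniformSpace} (P : X * R -> Prop) (a b : R) (x : X) :
  (forall y, a <= y <= b -> locally (x, y) P) ->
  locally x (fun x' => forall y, a <= y <= b -> P (x', y)).
Proof.
  intros H.
  assert (H1 : forall y, exists d : posreal, a <= y <= b ->
             forall x' y', ball x d x' -> ball y d y' -> P (x', y')).
  { intros y. destruct (classic (a <= y <= b)) as [Hy|Hy].
    - destruct (H y Hy) as [d Hd]. exists d. intros _ x' y' Hx' Hy'.
      apply Hd. split; assumption.
    - exists (mkposreal 1 Rlt_0_1). intros Hy'; contradiction. }
  set (delta := fun y => proj1_sig (constructive_indefinite_description _ (H1 y))).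
  (* Tube lemma: compactness of [a, b] gives one radius [d] that works for every [y] through some
     nearby centre [s]. The centre comes doubly negated, hence [NNPP]. *)
  destruct (compactness_value_1d a b delta) as [d Hd].
  exists d. intros x' Hx' y Hy.
  destruct (NNPP _ (Hd y Hy)) as [s [Hs [Hys Hds]]].
  unfold delta in *.
  destruct (constructive_indefinite_description _ (H1 s)) as [ds Hds']; simpl in *.
  apply Hds'; [exact Hs| |].
  - apply ball_le with d; assumption.
  - exact Hys.
Qed.

Definition cont_on {X : UniformSpace} (D : X -> Prop) (f : X -> R) : Prop :=
  forall p, D p -> continuous f p.
(** [X] is left arbitrary so that a multiple integral is an iterated [pint] and its domain an
    iterated [pall]; the lemmas below are then proved once for all nesting levels. *)
Definition pall {X : Type} (a b : R) (D : X * R -> Prop) : X -> Prop :=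
  fun x => forall y, a <= y <= b -> D (x, y).
Definition pint {X : Type} (a b : R) (f : X * R -> R) : X -> R :=
  fun x => RInt (fun y => f (x, y)) a b.

Lemma open_pall {X : UniformSpace} (a b : R) (D : X * R -> Prop) :
  open D -> open (pall a b D).
Proof. intros HD x Hx. apply locally_segment. intros y Hy. apply HD, Hx, Hy. Qed.

Lemma continuous_pair {X Y Z : UniformSpace} (f : X -> Y) (g : X -> Z) (x : X) :
  continuous f x -> continuous g x -> continuous (fun u => (f u, g u)) x.
Proof.
  intros Hf Hg. unfold continuous in *.
  intros P [d Hd].
  assert (H1 := Hf _ (locally_ball (f x) d)).
  assert (H2 := Hg _ (locally_ball (g x) d)).
  unfold filtermap in *.
  generalize (filter_and _ _ H1 H2). apply filter_imp.
  intros u [Hu1 Hu2]. apply Hd. split; assumption.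
Qed.

Lemma continuous_section {X : UniformSpace} (f : X * R -> R) x y :
  continuous f (x, y) -> continuous (fun u => f (x, u)) y.
Proof.
  intros H. apply (continuous_comp (fun u : R => (x, u)) f).
  - apply continuous_pair; [apply continuous_const | apply continuous_id].
  - exact H.
Qed.

Lemma ex_RInt_section {X : UniformSpace} (a b : R) (D : X * R -> Prop) f x :
  a <= b -> cont_on D f -> pall a b D x -> ex_RInt (fun y => f (x, y)) a b.
Proof.
  intros Hab Hf Hx. apply (ex_RInt_continuous (V := R_CompleteNormedModule)).
  intros z. rewrite Rmin_left, Rmax_right by lra. intros Hz.
  apply continuous_section, Hf, Hx, Hz.
Qed.

(** By the tube lemma [f (x', y)] is close to [f (x, y)] uniformly in [y], and the fibre over [x']
    still lies in [D], so that both integrals exist. *)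
Lemma cont_on_pint {X : UniformSpace} (a b : R) (D : X * R -> Prop) f :
  a <= b -> open D -> cont_on D f -> cont_on (pall a b D) (pint a b f).
Proof.
  intros Hab HD Hf x Hx. unfold continuous.
  apply filterlim_locally. intros eps.
  (* Half of the tolerance, since both values are compared with [f (x, y0)]; the [+ 1] keeps the
     denominator positive when [a = b]. *)
  assert (He : 0 < eps / (2 * (b - a + 1))).
  { apply Rdiv_lt_0_compat; [apply cond_pos | lra]. }
  assert (HL : locally x (fun x' => forall y, a <= y <= b ->
     Rabs (f (x', y) - f (x, y)) < eps / (b - a + 1))).
  { apply (locally_segment (fun p => Rabs (f p - f (x, snd p)) < eps / (b - a + 1))).
    intros y0 Hy0. assert (Hc := Hf _ (Hx y0 Hy0)).
    assert (Hc2 : locally (x, y0) (fun p => Rabs (f p - f (x, y0)) < eps / (2 * (b - a + 1)))).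
    { apply (Hc (fun v => Rabs (v - f (x, y0)) < eps / (2 * (b - a + 1)))).
      exists (mkposreal _ He). intros v Hv. exact Hv. }
    destruct Hc2 as [d Hd]. exists d. intros [x' y] [H1 H2]; simpl in *.
    assert (E1 := Hd (x', y) (conj H1 H2)).
    assert (E2 := Hd (x, y) (conj (ball_center x d) H2)).
    simpl in *.
    replace (f (x', y) - f (x, y)) with ((f (x', y) - f (x, y0)) - (f (x, y) - f (x, y0))) by ring.
    eapply Rle_lt_trans; [apply Rabs_triang|]. rewrite Rabs_Ropp.
    replace (eps / (b - a + 1)) with (eps / (2 * (b - a + 1)) + eps / (2 * (b - a + 1))) by (field; lra).
    lra. }
  generalize (filter_and _ _ HL (open_pall a b D HD x Hx)). apply filter_imp.
  intros x' [H1 H2]. unfold pint.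
  assert (I1 := ex_RInt_section a b D f x' Hab Hf H2).
  assert (I2 := ex_RInt_section a b D f x Hab Hf Hx).
  change (Rabs (RInt (fun y => f (x', y)) a b - RInt (fun y => f (x, y)) a b) < eps).
  change (Rabs (minus (RInt (fun y => f (x', y)) a b) (RInt (fun y => f (x, y)) a b)) < eps).
  rewrite <- (RInt_minus (V := R_CompleteNormedModule)) by assumption.
  eapply Rle_lt_trans.
  - apply abs_RInt_le_const with (M := eps / (b - a + 1)); [exact Hab| |].
    + apply (ex_RInt_minus (V := R_NormedModule)); assumption.
    + intros y Hy. apply Rlt_le, (H1 y Hy).
  - assert (0 < eps) by apply cond_pos.
    apply Rmult_lt_reg_r with (b - a + 1); [lra|].
    field_simplify; [nra|lra].
Qed.

Lemma open_preimage {X Y : UniformSpace} (h : X -> Y) (D : Y -> Prop) :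
  (forall x, continuous h x) -> open D -> open (fun x => D (h x)).
Proof. intros Hh HD. apply open_comp; [intros x _; apply Hh | exact HD]. Qed.

(** The curve [l] selects the coordinate that varies (time, radius or polar angle) while the others
    are frozen. [Derive] agrees with [df] only on [D]; this is enough because nearby fibres stay in
    the open set [D]. *)
Lemma is_derive_pint {X : UniformSpace} (a b : R) (D : X * R -> Prop) (f df : X * R -> R)
  (l : R -> X) :
  a <= b -> open D -> cont_on D f -> cont_on D df -> (forall s, continuous l s) ->
  (forall s y, D (l s, y) -> is_derive (fun s => f (l s, y)) s (df (l s, y))) ->
  forall s, pall a b D (l s) -> is_derive (fun s => pint a b f (l s)) s (pint a b df (l s)).
Proof.
  intros Hab HD Hf Hdf Hl Hder s Hs.
  assert (Hlp : forall p : R * R, continuous (fun p : R * R => (l (fst p), snd p)) p).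
  { intros [u v]. apply continuous_pair.
    - apply (continuous_comp fst l); [apply continuous_fst | apply Hl].
    - apply continuous_snd. }
  assert (HD' : open (fun p : R * R => D (l (fst p), snd p))).
  { apply (open_preimage (fun p : R * R => (l (fst p), snd p)) D Hlp HD). }
  assert (Hloc : locally s (fun s' => forall y, a <= y <= b -> D (l s', y))).
  { apply (open_pall a b _ HD' s). exact Hs. }
  unfold pint.
  replace (RInt (fun y => df (l s, y)) a b)
    with (RInt (fun y => Derive (fun u => f (l u, y)) s) a b).
  2:{ apply RInt_ext. rewrite Rmin_left, Rmax_right by lra. intros y Hy.
      apply is_derive_unique, Hder, Hs. lra. }
  apply (is_derive_RInt_param (fun s y => f (l s, y)) a b s);
    rewrite ?Rmin_left, ?Rmax_right by lra.
  - revert Hloc. apply filter_imp. intros s' Hs' y Hy. exists (df (l s', y)).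
    apply Hder, Hs', Hy.
  - intros y Hy. apply continuity_2d_pt_ext_loc with (f := fun u v => df (l u, v)).
    + apply locally_2d_locally. generalize (HD' (s, y) (Hs y Hy)). apply filter_imp.
      intros [u v] Huv. simpl in *. symmetry. apply is_derive_unique, Hder, Huv.
    + apply continuity_2d_pt_filterlim.
      apply (continuous_comp (fun p : R * R => (l (fst p), snd p)) df (s, y) (Hlp _)).
      apply Hdf, Hs, Hy.
  - revert Hloc. apply filter_imp. intros s' Hs'.
    apply (ex_RInt_section a b D f (l s') Hab Hf Hs').
Qed.

(** * Partial derivatives and the chain rule *)

(** Continuity and openness for the product uniform structure, to which the general lemmas apply.
    The Euclidean versions [contST] and [openST] of the statement are converted later. *)
Definition cont4 (F : R -> R3 -> R) (t : R) (x : R3) : Prop :=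
  continuous (fun p : R * (R * R * R) => F (fst p) (snd p)) (t, x).
Definition open4 (U : R -> R3 -> Prop) : Prop :=
  open (fun p : R * (R * R * R) => U (fst p) (snd p)).

(** Parametrised by the value of the coordinate, whereas [line] uses a displacement in space; the
    chain rule becomes plain substitution. [slice_line] links the two. *)
Definition slice (i : nat) (F : R -> R3 -> R) (t : R) (x : R3) : R -> R :=
  match i with
  | 0%nat => fun s => F s x
  | 1%nat => fun s => F t (s, c2 x, c3 x)
  | 2%nat => fun s => F t (c1 x, s, c3 x)
  | _ => fun s => F t (c1 x, c2 x, s)
  end.
Definition coord (i : nat) (t : R) (x : R3) : R :=
  match i with 0%nat => t | 1%nat => c1 x | 2%nat => c2 x | _ => c3 x end.

(** The derivatives are carried as explicit functions [dF] instead of [Derive] terms, so that the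
    conservation laws become algebraic identities for [ring] and [field]. *)
Definition C1_on (U : R -> R3 -> Prop) (F : R -> R3 -> R) (dF : nat -> R -> R3 -> R) : Prop :=
  forall t x, U t x -> cont4 F t x /\
    forall i, (i < 4)%nat ->
      is_derive (slice i F t x) (coord i t x) (dF i t x) /\ cont4 (dF i) t x.

(** One summand of the chain rule. Only the first argument is incremented, with [y] already moved to
    [y s]. The mean value theorem in that argument gives [df] at a nearby point, so joint continuity
    of [df] suffices and [y] need only be continuous. *)
Lemma is_derive_step {Y : UniformSpace} (f df : R -> Y -> R) (al : R -> R) (y : R -> Y)
  (s0 al' : R) :
  locally (al s0, y s0)
    (fun p => is_derive (fun z => f z (snd p)) (fst p) (df (fst p) (snd p))) ->
  continuous (fun p : R * Y => df (fst p) (snd p)) (al s0, y s0) ->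
  is_derive al s0 al' -> continuous y s0 ->
  is_derive (fun s => f (al s) (y s) - f (al s0) (y s)) s0 (df (al s0) (y s0) * al').
Proof.
  intros Hder Hc Hal Hy. apply is_derive_Reals. intros eps Heps.
  set (k0 := df (al s0) (y s0)).
  assert (Hden : 0 < Rabs al' + Rabs k0 + 2).
  { assert (Ha1 := Rabs_pos al'). assert (Ha2 := Rabs_pos k0). lra. }
  (* The cap 1 bounds the product of errors [(k - k0) * (Q - al')] by [eta], so that all three error
     terms below are linear in [eta]. *)
  set (eta := Rmin 1 (eps / (Rabs al' + Rabs k0 + 2))).
  assert (Heta : 0 < eta).
  { apply Rmin_pos; [lra | apply Rdiv_lt_0_compat; lra]. }
  assert (Hc2 : locally (al s0, y s0) (fun p : R * Y => Rabs (df (fst p) (snd p) - k0) < eta)).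
  { apply (Hc (fun v => Rabs (v - k0) < eta)). exists (mkposreal _ Heta). intros v Hv; exact Hv. }
  destruct (filter_and _ _ Hder Hc2) as [d Hd].
  assert (Hac : continuous al s0).
  { apply (ex_derive_continuous (K := R_AbsRing) (V := R_NormedModule)). exists al'; exact Hal. }
  assert (L1 := Hac _ (locally_ball (al s0) d)).
  assert (L2 := Hy _ (locally_ball (y s0) d)).
  unfold filtermap in L1, L2. destruct (filter_and (F := locally s0) _ _ L1 L2) as [d1 Hd1].
  apply is_derive_Reals in Hal. destruct (Hal eta Heta) as [d2 Hd2].
  exists (mkposreal _ (Rmin_pos _ _ (cond_pos d1) (cond_pos d2))). simpl.
  intros h Hh0 Hh.
  assert (Hh1 : Rabs h < d1) by (eapply Rlt_le_trans; [exact Hh | apply Rmin_l]).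
  assert (Hh2 : Rabs h < d2) by (eapply Rlt_le_trans; [exact Hh | apply Rmin_r]).
  destruct (Hd1 (s0 + h)) as [B1 B2].
  { change (Rabs (s0 + h - s0) < d1). replace (s0 + h - s0) with h by ring. exact Hh1. }
  assert (HB : forall z : R, Rmin (al s0) (al (s0 + h)) <= z <= Rmax (al s0) (al (s0 + h)) ->
     ball (al s0) d z).
  { intros z Hz. change (Rabs (al (s0 + h) - al s0) < d) in B1. change (Rabs (z - al s0) < d).
    apply Rabs_def2 in B1. apply Rabs_def1; revert Hz; unfold Rmin, Rmax;
      destruct (Rle_dec (al s0) (al (s0 + h))); intros; lra. }
  destruct (MVT_gen (fun z => f z (y (s0 + h))) (al s0) (al (s0 + h))
              (fun z => df z (y (s0 + h)))) as [z [Hz Ez]].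
  { intros z Hz. apply (Hd (z, y (s0 + h))). split; [apply HB; split; apply Rlt_le, Hz | exact B2]. }
  { intros z Hz. apply continuity_pt_filterlim.
    apply (ex_derive_continuous (K := R_AbsRing) (V := R_NormedModule)).
    exists (df z (y (s0 + h))). apply (Hd (z, y (s0 + h))). split; [apply HB, Hz | exact B2]. }
  assert (Hk := proj2 (Hd (z, y (s0 + h)) (conj (HB z Hz) B2))). simpl in Hk.
  specialize (Hd2 h Hh0 Hh2).
  set (k := df z (y (s0 + h))) in *. set (Q := (al (s0 + h) - al s0) / h) in *.
  replace ((f (al (s0 + h)) (y (s0 + h)) - f (al s0) (y (s0 + h)) -
      (f (al s0) (y s0) - f (al s0) (y s0))) / h - k0 * al')
    with ((k - k0) * (Q - al') + (k - k0) * al' + k0 * (Q - al')).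
  2:{ rewrite Ez. unfold Q. field. exact Hh0. }
  assert (eta <= 1) by apply Rmin_l.
  assert (He2 : eta * (Rabs al' + Rabs k0 + 2) <= eps).
  { replace eps with (eps / (Rabs al' + Rabs k0 + 2) * (Rabs al' + Rabs k0 + 2)) by (field; lra).
    apply Rmult_le_compat_r; [lra | apply Rmin_r]. }
  eapply Rle_lt_trans; [apply Rabs_triang|].
  eapply Rle_lt_trans; [apply Rplus_le_compat_r, Rabs_triang|].
  rewrite !Rabs_mult.
  assert (P1 := Rabs_pos al'). assert (P2 := Rabs_pos k0).
  assert (P3 := Rabs_pos (k - k0)). assert (P4 := Rabs_pos (Q - al')).
  assert (Rabs (k - k0) * Rabs (Q - al') <= eta * 1) by (apply Rmult_le_compat; lra).
  assert (Rabs (k - k0) * Rabs al' <= eta * Rabs al') by (apply Rmult_le_compat_r; lra).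
  assert (Rabs k0 * Rabs (Q - al') <= Rabs k0 * eta) by (apply Rmult_le_compat_l; lra).
  nra.
Qed.

(** Telescoping: [T], [X1], [X2] are frozen at [s0] one after the other. Each change is a case of
    [is_derive_step], and the last one, in [X3] alone, is an ordinary composition. *)
Lemma C1_chain U F dF (T X1 X2 X3 : R -> R) (s0 T' X1' X2' X3' : R) :
  open4 U -> C1_on U F dF -> U (T s0) (X1 s0, X2 s0, X3 s0) ->
  is_derive T s0 T' -> is_derive X1 s0 X1' -> is_derive X2 s0 X2' -> is_derive X3 s0 X3' ->
  let x0 := (X1 s0, X2 s0, X3 s0) in
  is_derive (fun s => F (T s) (X1 s, X2 s, X3 s)) s0
    (dF 0%nat (T s0) x0 * T' + dF 1%nat (T s0) x0 * X1' + dF 2%nat (T s0) x0 * X2'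
     + dF 3%nat (T s0) x0 * X3').
Proof.
  intros HU HF Hp HT H1 H2 H3 x0.
  assert (cd : forall (g : R -> R) l, is_derive g s0 l -> continuous g s0).
  { intros g l Hg. apply (ex_derive_continuous (K := R_AbsRing) (V := R_NormedModule)).
    exists l; exact Hg. }
  assert (S1 := is_derive_step (Y := prod_UniformSpace (prod_UniformSpace R_UniformSpace R_UniformSpace) R_UniformSpace)
    (fun z x => F z x) (fun z x => dF 0%nat z x) T (fun s => (X1 s, X2 s, X3 s)) s0 T').
  assert (S2 := is_derive_step (Y := prod_UniformSpace R_UniformSpace R_UniformSpace)
    (fun z x => F (T s0) (z, fst x, snd x)) (fun z x => dF 1%nat (T s0) (z, fst x, snd x))
    X1 (fun s => (X2 s, X3 s)) s0 X1').
  assert (S3 := is_derive_step (Y := R_UniformSpace)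
    (fun z x => F (T s0) (X1 s0, z, x)) (fun z x => dF 2%nat (T s0) (X1 s0, z, x))
    X2 X3 s0 X2').
  assert (S4 : is_derive (fun s => F (T s0) (X1 s0, X2 s0, X3 s)) s0 (X3' * dF 3%nat (T s0) x0)).
  { apply (is_derive_comp (K := R_AbsRing) (V := R_NormedModule)
      (fun z => F (T s0) (X1 s0, X2 s0, z)) X3).
    - destruct (HF _ _ Hp) as [_ Hd]. apply (Hd 3%nat). lia.
    - exact H3. }
  assert (C3 := cd _ _ H3). assert (C2 := cd _ _ H2). assert (C1 := cd _ _ H1).
  assert (J1 : forall (Y : UniformSpace) (h : Y -> R * (R * R * R)) y0, continuous h y0 ->
            h y0 = (T s0, x0) -> locally y0 (fun y => U (fst (h y)) (snd (h y)))).
  { intros Y h y0 Hh E. apply (Hh (fun p => U (fst p) (snd p))). rewrite E. apply (HU (T s0, x0)). exact Hp. }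
  assert (J2 : forall (Y : UniformSpace) (h : Y -> R * (R * R * R)) y0 i, (i < 4)%nat -> continuous h y0 ->
            h y0 = (T s0, x0) -> continuous (fun y => dF i (fst (h y)) (snd (h y))) y0).
  { intros Y h y0 i Hi Hh E. apply (continuous_comp h (fun p => dF i (fst p) (snd p))); [exact Hh|].
    rewrite E. apply (HF _ _ Hp). exact Hi. }
  assert (E1 : continuous (fun s => (X1 s, X2 s, X3 s)) s0).
  { apply continuous_pair; [apply continuous_pair|]; assumption. }
  assert (h2c : continuous (fun p : R * (R * R) => (T s0, (fst p, fst (snd p), snd (snd p))))
                 (X1 s0, (X2 s0, X3 s0))).
  { apply continuous_pair; [apply continuous_const|].
    apply continuous_pair; [apply continuous_pair|].
    - apply continuous_fst.
    - apply (continuous_comp snd fst); [apply continuous_snd | apply continuous_fst].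
    - apply (continuous_comp snd snd); apply continuous_snd. }
  assert (h3c : continuous (fun p : R * R => (T s0, (X1 s0, fst p, snd p))) (X2 s0, X3 s0)).
  { apply continuous_pair; [apply continuous_const|].
    apply continuous_pair; [apply continuous_pair; [apply continuous_const|]|].
    - apply continuous_fst.
    - apply continuous_snd. }
  specialize (S1 ltac:(
    generalize (HU (T s0, x0) Hp); apply filter_imp; intros [z x] Hz;
    apply (proj2 (HF _ _ Hz) 0%nat); lia)
    (proj2 (proj2 (HF _ _ Hp) 0%nat ltac:(lia))) HT E1).
  specialize (S2 ltac:(
    generalize (J1 _ _ _ h2c eq_refl); apply filter_imp; intros [z [y1 y2]] Hz;
    apply (proj2 (HF _ _ Hz) 1%nat); lia)
    (J2 _ _ _ 1%nat ltac:(lia) h2c eq_refl) H1 (continuous_pair _ _ _ C2 C3)).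
  specialize (S3 ltac:(
    generalize (J1 _ _ _ h3c eq_refl); apply filter_imp; intros [z y1] Hz;
    apply (proj2 (HF _ _ Hz) 2%nat); lia)
    (J2 _ _ _ 2%nat ltac:(lia) h3c eq_refl) H2 C3).
  simpl in S1, S2, S3. fold x0 in S1, S2, S3.
  assert (S := is_derive_plus (K := R_AbsRing) (V := R_NormedModule) _ _ _ _ _ S1
    (is_derive_plus _ _ _ _ _ S2 (is_derive_plus _ _ _ _ _ S3 S4))).
  eapply is_derive_ext.
  2:{ evar_last. exact S. unfold plus; simpl. fold x0. ring. }
  intros s. unfold plus; simpl. ring.
Qed.

Lemma open4_inter U V : open4 U -> open4 V -> open4 (fun t x => U t x /\ V t x).
Proof. intros HU HV p [H1 H2]. apply filter_and; [apply HU, H1 | apply HV, H2]. Qed.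

Lemma C1_subset (U V : R -> R3 -> Prop) F dF :
  (forall t x, V t x -> U t x) -> C1_on U F dF -> C1_on V F dF.
Proof. intros H HF t x Hx. apply HF, H, Hx. Qed.

Lemma slice_coord i F t x : slice i F t x (coord i t x) = F t x.
Proof. destruct x as [[x1 x2] x3]. destruct i as [|[|[|i]]]; reflexivity. Qed.

Lemma C1_const U k : C1_on U (fun _ _ => k) (fun _ _ _ => 0).
Proof.
  intros t x _. split; [apply continuous_const|]. intros i _. split; [|apply continuous_const].
  destruct i as [|[|[|i]]]; apply (is_derive_const (K := R_AbsRing) (V := R_NormedModule)).
Qed.

Lemma C1_plus U F dF G dG : C1_on U F dF -> C1_on U G dG ->
  C1_on U (fun t x => F t x + G t x) (fun i t x => dF i t x + dG i t x).
Proof.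
  intros HF HG t x Hx. destruct (HF t x Hx) as [CF DF]. destruct (HG t x Hx) as [CG DG].
  split; [apply (continuous_plus (V := R_NormedModule) _ _ _ CF CG)|].
  intros i Hi. destruct (DF i Hi) as [D1 K1]. destruct (DG i Hi) as [D2 K2].
  split; [|apply (continuous_plus (V := R_NormedModule) _ _ _ K1 K2)].
  generalize (is_derive_plus (K := R_AbsRing) (V := R_NormedModule) _ _ _ _ _ D1 D2).
  apply is_derive_ext. intros s. destruct i as [|[|[|i]]]; reflexivity.
Qed.

Lemma C1_mult U F dF G dG : C1_on U F dF -> C1_on U G dG ->
  C1_on U (fun t x => F t x * G t x) (fun i t x => dF i t x * G t x + F t x * dG i t x).
Proof.
  intros HF HG t x Hx. destruct (HF t x Hx) as [CF DF]. destruct (HG t x Hx) as [CG DG].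
  split; [apply (continuous_mult (K := R_AbsRing) _ _ _ CF CG)|].
  intros i Hi. destruct (DF i Hi) as [D1 K1]. destruct (DG i Hi) as [D2 K2].
  split.
  - generalize (is_derive_mult (K := R_AbsRing) _ _ _ _ _ D1 D2 Rmult_comm).
    rewrite !slice_coord. apply is_derive_ext.
    intros s. destruct i as [|[|[|i]]]; reflexivity.
  - apply (continuous_plus (V := R_NormedModule)); apply (continuous_mult (K := R_AbsRing)); assumption.
Qed.

Lemma C1_ext U F dF G dG : open4 U -> (forall t x, U t x -> F t x = G t x) ->
  (forall i t x, (i < 4)%nat -> U t x -> dF i t x = dG i t x) ->
  C1_on U F dF -> C1_on U G dG.
Proof.
  intros HU EF ED HF t x Hx. destruct (HF t x Hx) as [CF DF].
  assert (L : locally (t, x) (fun p : R * (R * R * R) => U (fst p) (snd p))) by apply (HU (t, x) Hx).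
  split.
  - apply continuous_ext_loc with (g := fun p : R * (R * R * R) => F (fst p) (snd p)); [|exact CF].
    revert L. apply filter_imp. intros [u v] Huv. apply EF, Huv.
  - intros i Hi. destruct (DF i Hi) as [D1 K1]. split.
    + rewrite <- ED by assumption. revert D1. apply is_derive_ext_loc.
      destruct L as [d Hd]. exists d. intros s Hs. destruct x as [[x1 x2] x3].
      destruct i as [|[|[|i]]]; simpl in *; apply EF; apply (Hd (_, _));
      repeat split; simpl; try apply ball_center; exact Hs.
    + apply continuous_ext_loc with (g := fun p : R * (R * R * R) => dF i (fst p) (snd p)); [|exact K1].
      revert L. apply filter_imp. intros [u v] Huv. apply ED; [exact Hi | exact Huv].
Qed.

Lemma schwarz_explicit (D : R * R -> Prop) (f f1 f2 f12 f21 : R -> R -> R) a b :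
  open D -> D (a, b) ->
  (forall u v, D (u, v) -> is_derive (fun z => f z v) u (f1 u v)) ->
  (forall u v, D (u, v) -> is_derive (fun z => f u z) v (f2 u v)) ->
  (forall u v, D (u, v) -> is_derive (fun z => f1 u z) v (f12 u v)) ->
  (forall u v, D (u, v) -> is_derive (fun z => f2 z v) u (f21 u v)) ->
  continuous (fun p : R * R => f12 (fst p) (snd p)) (a, b) ->
  continuous (fun p : R * R => f21 (fst p) (snd p)) (a, b) ->
  f12 a b = f21 a b.
Proof.
  intros HD Hab H1 H2 H12 H21 C12 C21.
  assert (L1 : forall u v, D (u, v) -> locally u (fun z => D (z, v))).
  { intros u v Huv. destruct (HD _ Huv) as [d Hd]. exists d. intros z Hz. apply Hd.
    split; [exact Hz | apply ball_center]. }
  assert (L2 : forall u v, D (u, v) -> locally v (fun z => D (u, z))).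
  { intros u v Huv. destruct (HD _ Huv) as [d Hd]. exists d. intros z Hz. apply Hd.
    split; [apply ball_center | exact Hz]. }
  assert (E21 : forall u v, D (u, v) ->
    is_derive (fun z => Derive (fun t => f z t) v) u (f21 u v)).
  { intros u v Huv. eapply is_derive_ext_loc; [|apply H21, Huv].
    generalize (L1 u v Huv). apply filter_imp. intros z Hz. symmetry.
    apply is_derive_unique, H2, Hz. }
  assert (E12 : forall u v, D (u, v) ->
    is_derive (fun z => Derive (fun t => f t z) u) v (f12 u v)).
  { intros u v Huv. eapply is_derive_ext_loc; [|apply H12, Huv].
    generalize (L2 u v Huv). apply filter_imp. intros z Hz. symmetry.
    apply is_derive_unique, H1, Hz. }
  rewrite <- (is_derive_unique _ _ _ (E12 a b Hab)), <- (is_derive_unique _ _ _ (E21 a b Hab)).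
  symmetry. apply Schwarz.
  - apply locally_2d_locally. generalize (HD _ Hab). apply filter_imp. intros [u v] Huv; simpl.
    repeat split; eexists; [apply H1|apply H2|apply E21|apply E12]; exact Huv.
  - apply continuity_2d_pt_ext_loc with (f := f21).
    + apply locally_2d_locally. generalize (HD _ Hab). apply filter_imp. intros [u v] Huv; simpl.
      symmetry. apply is_derive_unique, E21, Huv.
    + apply continuity_2d_pt_filterlim. exact C21.
  - apply continuity_2d_pt_ext_loc with (f := f12).
    + apply locally_2d_locally. generalize (HD _ Hab). apply filter_imp. intros [u v] Huv; simpl.
      symmetry. apply is_derive_unique, E12, Huv.
    + apply continuity_2d_pt_filterlim. exact C12.
Qed.

(** Only time-space pairs matter: the energy density produces d_t d_k psi, its flux d_k d_t psi.
    Fixing the two other space coordinates, through [xk], reduces the claim to a plane. *)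
Lemma C2_mixed U F dF ddF t x k : open4 U -> U t x -> (0 < k < 4)%nat ->
  C1_on U F dF -> (forall i, (i < 4)%nat -> C1_on U (dF i) (ddF i)) ->
  ddF 0%nat k t x = ddF k 0%nat t x.
Proof.
  intros HU Hx Hk HF HdF. destruct x as [[x1 x2] x3].
  set (xk := fun z => match k with 1%nat => (z, x2, x3) | 2%nat => (x1, z, x3) | _ => (x1, x2, z) end).
  set (z0 := coord k t (x1, x2, x3)).
  assert (E : (x1, x2, x3) = xk z0) by (unfold xk, z0; destruct k as [|[|[|k]]]; [lia| | |]; reflexivity).
  assert (Cx : forall p : R * R, continuous (fun p : R * R => (fst p, xk (snd p) : R * R * R)) p).
  { intros [u v]. apply continuous_pair; [apply continuous_fst|].
    unfold xk. destruct k as [|[|[|k]]]; repeat apply continuous_pair;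
      first [apply continuous_const | apply continuous_snd]. }
  assert (HD := open_preimage _ _ Cx HU). simpl in HD.
  rewrite E in Hx |- *.
  apply (schwarz_explicit _ (fun u v => F u (xk v)) (fun u v => dF 0%nat u (xk v))
    (fun u v => dF k u (xk v)) (fun u v => ddF 0%nat k u (xk v)) (fun u v => ddF k 0%nat u (xk v)) t z0 HD).
  - exact Hx.
  - intros u v Huv. apply (proj2 (HF u (xk v) Huv) 0%nat). lia.
  - intros u v Huv. assert (H := proj1 (proj2 (HF u (xk v) Huv) k ltac:(lia))).
    revert H. unfold xk. destruct k as [|[|[|k]]]; [lia| | |]; exact (fun H => H).
  - intros u v Huv. assert (H := proj1 (proj2 (HdF 0%nat ltac:(lia) u (xk v) Huv) k ltac:(lia))).
    revert H. unfold xk. destruct k as [|[|[|k]]]; [lia| | |]; exact (fun H => H).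
  - intros u v Huv. apply (proj2 (HdF k ltac:(lia) u (xk v) Huv) 0%nat). lia.
  - apply (continuous_comp (fun p : R * R => (fst p, xk (snd p) : R * R * R))
      (fun p => ddF 0%nat k (fst p) (snd p)) (t, z0) (Cx _)).
    apply (proj2 (HdF 0%nat ltac:(lia) t (xk z0) Hx) k). lia.
  - apply (continuous_comp (fun p : R * R => (fst p, xk (snd p) : R * R * R))
      (fun p => ddF k 0%nat (fst p) (snd p)) (t, z0) (Cx _)).
    apply (proj2 (HdF k ltac:(lia) t (xk z0) Hx) 0%nat). lia.
Qed.

(** * Integration in moving spherical coordinates *)

Lemma cont_plus {X : UniformSpace} (f g : X -> R) x :
  continuous f x -> continuous g x -> continuous (fun u => f u + g u) x.
Proof. apply (continuous_plus (V := R_NormedModule)). Qed.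
Lemma cont_mult {X : UniformSpace} (f g : X -> R) x :
  continuous f x -> continuous g x -> continuous (fun u => f u * g u) x.
Proof. apply (continuous_mult (K := R_AbsRing)). Qed.
Lemma cont_opp {X : UniformSpace} (f : X -> R) x :
  continuous f x -> continuous (fun u => - f u) x.
Proof. apply (continuous_opp (V := R_NormedModule)). Qed.
Lemma cont_sin {X : UniformSpace} (f : X -> R) x :
  continuous f x -> continuous (fun u => sin (f u)) x.
Proof. intros H. apply (continuous_comp f sin); [exact H | apply continuous_sin]. Qed.
Lemma cont_cos {X : UniformSpace} (f : X -> R) x :
  continuous f x -> continuous (fun u => cos (f u)) x.
Proof. intros H. apply (continuous_comp f cos); [exact H | apply continuous_cos]. Qed.
Lemma cont_fst {X Y Z : UniformSpace} (f : X -> Y * Z) x :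
  continuous f x -> continuous (fun u => fst (f u)) x.
Proof. intros H. apply (continuous_comp f fst); [exact H | destruct (f x); apply continuous_fst]. Qed.
Lemma cont_snd {X Y Z : UniformSpace} (f : X -> Y * Z) x :
  continuous f x -> continuous (fun u => snd (f u)) x.
Proof. intros H. apply (continuous_comp f snd); [exact H | destruct (f x); apply continuous_snd]. Qed.

Ltac cont_step :=
  match goal with
  | H : ?P |- ?P => exact H
  | |- continuous (fun _ => ?k) _ => apply continuous_const
  | |- continuous (fun u => @?f u + @?g u) _ => apply (cont_plus f g)
  | |- continuous (fun u => @?f u * @?g u) _ => apply (cont_mult f g)
  | |- continuous (fun u => - @?f u) _ => apply (cont_opp f)
  | |- continuous (fun u => sin (@?f u)) _ => apply (cont_sin f)
  | |- continuous (fun u => cos (@?f u)) _ => apply (cont_cos f)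
  | |- continuous (fun u => fst (@?f u)) _ => apply (cont_fst f)
  | |- continuous (fun u => snd (@?f u)) _ => apply (cont_snd f)
  | |- continuous (fun u => u) _ => apply continuous_id
  end.
Ltac cont_auto := unfold Rminus; simpl pow; cbv beta; repeat (cont_step; cbv beta).

Lemma pint_ext {X : Type} a b (f g : X * R -> R) x : a <= b ->
  (forall y, a <= y <= b -> f (x, y) = g (x, y)) -> pint a b f x = pint a b g x.
Proof.
  intros Hab H. apply RInt_ext. rewrite Rmin_left, Rmax_right by lra. intros y Hy. apply H. lra.
Qed.

Lemma pint_lin {X : UniformSpace} a b (D : X * R -> Prop) (f g : X * R -> R) al be x : a <= b ->
  cont_on D f -> cont_on D g -> pall a b D x ->
  pint a b (fun p => al * f p + be * g p) x = al * pint a b f x + be * pint a b g x.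
Proof.
  intros Hab Hf Hg Hx. unfold pint.
  assert (I1 := ex_RInt_section a b D f x Hab Hf Hx).
  assert (I2 := ex_RInt_section a b D g x Hab Hg Hx).
  transitivity (plus (RInt (fun y => scal al (f (x, y))) a b) (RInt (fun y => scal be (g (x, y))) a b)).
  - rewrite <- (RInt_plus (V := R_CompleteNormedModule)); [reflexivity| |];
      apply (ex_RInt_scal (V := R_NormedModule)); assumption.
  - rewrite !(RInt_scal (V := R_CompleteNormedModule)) by assumption. reflexivity.
Qed.

Lemma pint_le {X : UniformSpace} a b (D : X * R -> Prop) (f g : X * R -> R) x : a <= b ->
  cont_on D f -> cont_on D g -> pall a b D x ->
  (forall y, a <= y <= b -> f (x, y) <= g (x, y)) -> pint a b f x <= pint a b g x.
Proof.
  intros Hab Hf Hg Hx H. unfold pint. apply RInt_le; [exact Hab| | |].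
  - apply (ex_RInt_section a b D f x Hab Hf Hx).
  - apply (ex_RInt_section a b D g x Hab Hg Hx).
  - intros y Hy. apply H. lra.
Qed.

Lemma cont_on_lin {X : UniformSpace} (D : X -> Prop) (f g : X -> R) al be :
  cont_on D f -> cont_on D g -> cont_on D (fun p => al * f p + be * g p).
Proof. intros Hf Hg p Hp. specialize (Hf p Hp). specialize (Hg p Hp). cont_auto. Qed.

Definition C0_on (U : R -> R3 -> Prop) (G : R -> R3 -> R) : Prop :=
  forall t x, U t x -> cont4 G t x.

Lemma C1_C0 U F dF : C1_on U F dF -> C0_on U F.
Proof. intros H t x Hx. apply (H t x Hx). Qed.

Lemma C1_C0_partial U F dF i : (i < 4)%nat -> C1_on U F dF -> C0_on U (dF i).
Proof. intros Hi H t x Hx. apply (proj2 (H t x Hx) i Hi). Qed.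

Lemma two_PI_pos : 0 <= 2 * PI.
Proof. assert (H := PI_RGT_0). lra. Qed.
Lemma PI_nonneg : 0 <= PI.
Proof. assert (H := PI_RGT_0). lra. Qed.

(* A point of the parameter space is (((t, r), theta), phi). *)
Definition pt (p : R * R * R * R) : R := fst (fst (fst p)).
Definition pr (p : R * R * R * R) : R := snd (fst (fst p)).
Definition pth (p : R * R * R * R) : R := snd (fst p).
Definition pph (p : R * R * R * R) : R := snd p.

Lemma continuous_coords p :
  continuous pt p /\ continuous pr p /\ continuous pth p /\ continuous pph p.
Proof.
  destruct p as [[[t r] th] ph]. unfold pt, pr, pth, pph.
  assert (F1 := continuous_fst (U := prod_UniformSpace (prod_UniformSpace R_UniformSpace
    R_UniformSpace) R_UniformSpace) (V := R_UniformSpace) (t, r, th) ph).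
  assert (F2 := cont_fst (Y := prod_UniformSpace R_UniformSpace R_UniformSpace)
    (Z := R_UniformSpace) _ _ F1).
  repeat split.
  - apply (cont_fst (Y := R_UniformSpace) (Z := R_UniformSpace) _ _ F2).
  - apply (cont_snd (Y := R_UniformSpace) (Z := R_UniformSpace) _ _ F2).
  - apply (cont_snd (Y := prod_UniformSpace R_UniformSpace R_UniformSpace)
      (Z := R_UniformSpace) _ _ F1).
  - apply (continuous_snd (U := prod_UniformSpace (prod_UniformSpace R_UniformSpace
      R_UniformSpace) R_UniformSpace) (V := R_UniformSpace)).
Qed.

(** The centre [rh] is put inside the parametrisation, so that the moving ball corresponds to a
    constant box of radii and angles. The order t, r, theta, phi is that of the nested integrals in
    [ball_int], whence [ball_int_pint] holds by unfolding. *)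
Definition sphpt (rh : R -> R3) (p : R * R * R * R) : R3 :=
  add3 (rh (pt p)) (scal3 (pr p) (sph (pth p) (pph p))).
Definition sphdom (rh : R -> R3) (U : R -> R3 -> Prop) (p : R * R * R * R) : Prop :=
  U (pt p) (sphpt rh p).
Definition pull (rh : R -> R3) (G : R -> R3 -> R) (p : R * R * R * R) : R :=
  G (pt p) (sphpt rh p).
Definition ang {X : Type} (F : X * R * R -> R) : X -> R := pint 0 PI (pint 0 (2 * PI) F).
Definition angdom {X : Type} (D : X * R * R -> Prop) : X -> Prop := pall 0 PI (pall 0 (2 * PI) D).
Definition volw (F : R * R * R * R -> R) (p : R * R * R * R) : R := F p * (pr p ^ 2 * sin (pth p)).

Definition diff_traj (rh v : R -> R3) : Prop :=
  forall t, is_derive (fun s => c1 (rh s)) t (c1 (v t)) /\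
            is_derive (fun s => c2 (rh s)) t (c2 (v t)) /\
            is_derive (fun s => c3 (rh s)) t (c3 (v t)).
Definition cont_curve (v : R -> R3) : Prop :=
  forall t, continuous (fun s => c1 (v s)) t /\ continuous (fun s => c2 (v s)) t /\
            continuous (fun s => c3 (v s)) t.

Lemma diff_traj_cont rh v : diff_traj rh v -> cont_curve rh.
Proof.
  intros H t. destruct (H t) as [H1 [H2 H3]].
  repeat split; apply (ex_derive_continuous (K := R_AbsRing) (V := R_NormedModule));
    eexists; eassumption.
Qed.

Definition ball_in (rh : R -> R3) (U : R -> R3 -> Prop) (t rad : R) : Prop :=
  forall x, norm3 (sub3 x (rh t)) <= rad -> U t x.

Lemma norm3_sph r th ph : 0 <= r -> norm3 (scal3 r (sph th ph)) = r.
Proof.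
  intros Hr. unfold norm3. replace (dot3 _ _) with (r * r).
  - apply sqrt_square, Hr.
  - unfold dot3, scal3, sph, c1, c2, c3; simpl.
    assert (H1 := sin2_cos2 th). assert (H2 := sin2_cos2 ph). unfold Rsqr in *.
    replace (r * (sin th * cos ph) * (r * (sin th * cos ph))
        + r * (sin th * sin ph) * (r * (sin th * sin ph)) + r * cos th * (r * cos th))
      with (r * r * (sin th * sin th * (sin ph * sin ph + cos ph * cos ph) + cos th * cos th)) by ring.
    rewrite H2. replace (sin th * sin th * 1 + cos th * cos th) with 1 by lra. ring.
Qed.

Lemma sub3_add3 x y : sub3 (add3 x y) x = y.
Proof.
  destruct x as [[x1 x2] x3], y as [[y1 y2] y3].
  unfold sub3, add3, c1, c2, c3; simpl. repeat f_equal; ring.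
Qed.

Lemma sphdom_ball rh U t rad r th ph : ball_in rh U t rad -> 0 <= r <= rad ->
  sphdom rh U (t, r, th, ph).
Proof.
  intros H Hr. apply H. unfold sphpt. rewrite sub3_add3, norm3_sph; simpl; unfold pr; simpl; lra.
Qed.

Lemma angdom_ball rh U t rad r : ball_in rh U t rad -> 0 <= r <= rad ->
  angdom (sphdom rh U) (t, r).
Proof. intros H Hr th _ ph _. apply (sphdom_ball rh U t rad); assumption. Qed.

Lemma continuous_sphpt rh : cont_curve rh ->
  forall p, continuous (fun p => (pt p, sphpt rh p) : R * (R * R * R)) p.
Proof.
  intros H p. destruct (H (pt p)) as [H1 [H2 H3]].
  destruct (continuous_coords p) as [K [Kr [Kt Kp]]].
  assert (K1 := continuous_comp _ (fun s => c1 (rh s)) p K H1).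
  assert (K2 := continuous_comp _ (fun s => c2 (rh s)) p K H2).
  assert (K3 := continuous_comp _ (fun s => c3 (rh s)) p K H3).
  apply (continuous_pair (Y := R_UniformSpace) (Z := prod_UniformSpace (prod_UniformSpace
    R_UniformSpace R_UniformSpace) R_UniformSpace) pt (sphpt rh)); [exact K|].
  apply (continuous_pair (Y := prod_UniformSpace R_UniformSpace R_UniformSpace)
    (Z := R_UniformSpace) (fun p => (c1 (rh (pt p)) + pr p * (sin (pth p) * cos (pph p)),
                                     c2 (rh (pt p)) + pr p * (sin (pth p) * sin (pph p))))
      (fun p => c3 (rh (pt p)) + pr p * cos (pth p))); [apply continuous_pair|]; cont_auto.
Qed.

Lemma open_sphdom rh U : cont_curve rh -> open4 U -> open (sphdom rh U).
Proof.
  intros H HU. apply (open_preimage _ (fun q : R * (R * R * R) => U (fst q) (snd q)) (continuous_sphpt rh H) HU).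
Qed.

Lemma cont_on_pull rh U G : cont_curve rh -> C0_on U G -> cont_on (sphdom rh U) (pull rh G).
Proof.
  intros H HG p Hp.
  apply (continuous_comp (fun p => (pt p, sphpt rh p) : R * (R * R * R))
     (fun q => G (fst q) (snd q)) p (continuous_sphpt rh H p)). apply HG, Hp.
Qed.

Lemma cont_on_volw D F : cont_on D F -> cont_on D (volw F).
Proof.
  intros H p Hp. specialize (H p Hp). destruct (continuous_coords p) as [_ [Kr [Kt _]]].
  unfold volw. cont_auto.
Qed.

Lemma ball_int_pint rh G t rad :
  ball_int (G t) (rh t) rad = pint 0 rad (ang (volw (pull rh G))) t.
Proof. reflexivity. Qed.

Lemma open_angdom {X : UniformSpace} (D : X * R * R -> Prop) : open D -> open (angdom D).
Proof. intros H. apply open_pall, open_pall, H. Qed.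

Lemma cont_on_ang {X : UniformSpace} (D : X * R * R -> Prop) F :
  open D -> cont_on D F -> cont_on (angdom D) (ang F).
Proof.
  intros HD HF. apply cont_on_pint; [apply PI_nonneg | apply open_pall, HD |].
  apply cont_on_pint; [apply two_PI_pos | exact HD | exact HF].
Qed.

Lemma ang_lin {X : UniformSpace} (D : X * R * R -> Prop) F G al be x :
  open D -> cont_on D F -> cont_on D G -> angdom D x ->
  ang (fun p => al * F p + be * G p) x = al * ang F x + be * ang G x.
Proof.
  intros HD HF HG Hx. unfold ang. rewrite <- (pint_lin 0 PI (pall 0 (2 * PI) D)).
  - apply pint_ext; [apply PI_nonneg|]. intros y Hy.
    apply (pint_lin 0 (2 * PI) D); auto using two_PI_pos.
  - apply PI_nonneg.
  - apply cont_on_pint; auto using two_PI_pos.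
  - apply cont_on_pint; auto using two_PI_pos.
  - exact Hx.
Qed.

Lemma ang_le {X : UniformSpace} (D : X * R * R -> Prop) F G x :
  open D -> cont_on D F -> cont_on D G -> angdom D x ->
  (forall th ph : R, 0 <= th <= PI -> F (x, th, ph) <= G (x, th, ph)) -> ang F x <= ang G x.
Proof.
  intros HD HF HG Hx H. apply (pint_le 0 PI (pall 0 (2 * PI) D)).
  - apply PI_nonneg.
  - apply cont_on_pint; auto using two_PI_pos.
  - apply cont_on_pint; auto using two_PI_pos.
  - exact Hx.
  - intros th Hth. apply (pint_le 0 (2 * PI) D); auto using two_PI_pos.
Qed.

Section MovingBall.
Context (rh : R -> R3) (U : R -> R3 -> Prop) (t rad : R).
Context (Hrh : cont_curve rh) (HU : open4 U) (Hrad : 0 <= rad) (Hball : ball_in rh U t rad).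

Let HD : open (sphdom rh U) := open_sphdom rh U Hrh HU.

Lemma sphpt_in_ball r th ph : 0 <= r <= rad ->
  norm3 (sub3 (sphpt rh (t, r, th, ph)) (rh t)) <= rad.
Proof. intros Hr. unfold sphpt. rewrite sub3_add3, norm3_sph; simpl; unfold pr; simpl; lra. Qed.

Let cov F : C0_on U F -> cont_on (sphdom rh U) (volw (pull rh F)).
Proof. intros H. apply cont_on_volw, cont_on_pull; assumption. Qed.

Lemma ball_int_ext F G :
  (forall x, norm3 (sub3 x (rh t)) <= rad -> F t x = G t x) ->
  ball_int (F t) (rh t) rad = ball_int (G t) (rh t) rad.
Proof.
  intros H. rewrite !ball_int_pint. apply pint_ext; [exact Hrad|]. intros r Hr.
  apply pint_ext; [apply PI_nonneg|]. intros th Hth.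
  apply pint_ext; [apply two_PI_pos|]. intros ph Hph.
  unfold volw, pull. f_equal. apply H, sphpt_in_ball, Hr.
Qed.

Lemma ball_int_lin F G al be : C0_on U F -> C0_on U G ->
  ball_int (fun x => al * F t x + be * G t x) (rh t) rad
  = al * ball_int (F t) (rh t) rad + be * ball_int (G t) (rh t) rad.
Proof.
  intros HF HG.
  change (ball_int ((fun t x => al * F t x + be * G t x) t) (rh t) rad
    = al * ball_int (F t) (rh t) rad + be * ball_int (G t) (rh t) rad).
  rewrite !ball_int_pint. rewrite <- (pint_lin 0 rad (angdom (sphdom rh U))).
  - apply pint_ext; [exact Hrad|]. intros r Hr.
    rewrite <- (ang_lin (sphdom rh U)); auto.
    2: apply (angdom_ball rh U t rad); assumption.
    apply pint_ext; [apply PI_nonneg|]. intros th Hth.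
    apply pint_ext; [apply two_PI_pos|]. intros ph Hph.
    unfold volw, pull. ring.
  - exact Hrad.
  - apply cont_on_ang; auto.
  - apply cont_on_ang; auto.
  - intros r Hr. apply (angdom_ball rh U t rad); assumption.
Qed.

Lemma ball_int_le F G : C0_on U F -> C0_on U G ->
  (forall x, norm3 (sub3 x (rh t)) <= rad -> F t x <= G t x) ->
  ball_int (F t) (rh t) rad <= ball_int (G t) (rh t) rad.
Proof.
  intros HF HG H. rewrite !ball_int_pint. apply (pint_le 0 rad (angdom (sphdom rh U))).
  - exact Hrad.
  - apply cont_on_ang; auto.
  - apply cont_on_ang; auto.
  - intros r Hr. apply (angdom_ball rh U t rad); assumption.
  - intros r Hr. apply (ang_le (sphdom rh U)); auto.
    + apply (angdom_ball rh U t rad); assumption.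
    + intros th ph Hth. unfold volw, pull. apply Rmult_le_compat_r.
      * apply Rmult_le_pos; [apply pow2_ge_0 | apply sin_ge_0; apply Hth].
      * apply H, sphpt_in_ball, Hr.
Qed.

Lemma ball_int_abs F G K : C0_on U F -> C0_on U G ->
  (forall x, norm3 (sub3 x (rh t)) <= rad -> Rabs (F t x) <= K * G t x) ->
  Rabs (ball_int (F t) (rh t) rad) <= K * ball_int (G t) (rh t) rad.
Proof.
  intros HF HG H.
  (* Linearity is stated for two summands; a multiple of [G] enters it with a second coefficient
     0. *)
  assert (L1 := ball_int_lin G G K 0 HG HG). assert (L2 := ball_int_lin G G (- K) 0 HG HG).
  assert (CG : forall k, C0_on U (fun t x => k * G t x + 0 * G t x)).
  { intros k s x Hx. assert (Hc := HG s x Hx). unfold cont4 in *. cont_auto. }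
  apply Rabs_le. split.
  - replace (- (K * ball_int (G t) (rh t) rad)) with
      (- K * ball_int (G t) (rh t) rad + 0 * ball_int (G t) (rh t) rad) by ring.
    rewrite <- L2. apply (ball_int_le (fun t x => - K * G t x + 0 * G t x) F (CG _) HF).
    intros x Hx. assert (Hh := H x Hx). apply Rabs_le_between in Hh. lra.
  - replace (K * ball_int (G t) (rh t) rad) with
      (K * ball_int (G t) (rh t) rad + 0 * ball_int (G t) (rh t) rad) by ring.
    rewrite <- L1. apply (ball_int_le F (fun t x => K * G t x + 0 * G t x) HF (CG _)).
    intros x Hx. assert (Hh := H x Hx). apply Rabs_le_between in Hh. lra.
Qed.

End MovingBall.

(** * The divergence theorem and balance laws on moving balls *)

Lemma is_derive_eq (f : R -> R) x l l' : is_derive f x l -> l = l' -> is_derive f x l'.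
Proof. intros H <-. exact H. Qed.

(** The right-hand sides are the gradient components along the orthonormal frame e_r, e_theta,
    e_phi, times the scale factors 1, r and r sin(theta). *)
Lemma sph_chain rh U G dG t r th ph : open4 U -> C1_on U G dG -> sphdom rh U (t, r, th, ph) ->
  let x := sphpt rh (t, r, th, ph) in
  is_derive (fun r => pull rh G (t, r, th, ph)) r
    (dG 1%nat t x * (sin th * cos ph) + dG 2%nat t x * (sin th * sin ph) + dG 3%nat t x * cos th) /\
  is_derive (fun th => pull rh G (t, r, th, ph)) th
    (r * (dG 1%nat t x * (cos th * cos ph) + dG 2%nat t x * (cos th * sin ph) - dG 3%nat t x * sin th)) /\
  is_derive (fun ph => pull rh G (t, r, th, ph)) ph
    (r * sin th * (- dG 1%nat t x * sin ph + dG 2%nat t x * cos ph)).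
Proof.
  intros HU HG Hp x.
  split; [|split]; unfold pull.
  - eapply is_derive_eq.
    + apply (C1_chain U G dG (fun _ => t) (fun r => c1 (rh t) + r * (sin th * cos ph))
        (fun r => c2 (rh t) + r * (sin th * sin ph)) (fun r => c3 (rh t) + r * cos th) r
        0 (sin th * cos ph) (sin th * sin ph) (cos th) HU HG Hp).
      * apply (is_derive_const (K := R_AbsRing) (V := R_NormedModule)).
      * auto_derive; [exact I | ring].
      * auto_derive; [exact I | ring].
      * auto_derive; [exact I | ring].
    + simpl.
      change (c1 (rh t) + r * (sin th * cos ph), c2 (rh t) + r * (sin th * sin ph),
        c3 (rh t) + r * cos th) with x. ring.
  - eapply is_derive_eq.
    + apply (C1_chain U G dG (fun _ => t) (fun th => c1 (rh t) + r * (sin th * cos ph))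
        (fun th => c2 (rh t) + r * (sin th * sin ph)) (fun th => c3 (rh t) + r * cos th) th
        0 (r * (cos th * cos ph)) (r * (cos th * sin ph)) (- r * sin th) HU HG Hp).
      * apply (is_derive_const (K := R_AbsRing) (V := R_NormedModule)).
      * auto_derive; [exact I | ring].
      * auto_derive; [exact I | ring].
      * auto_derive; [exact I | ring].
    + simpl.
      change (c1 (rh t) + r * (sin th * cos ph), c2 (rh t) + r * (sin th * sin ph),
        c3 (rh t) + r * cos th) with x. ring.
  - eapply is_derive_eq.
    + apply (C1_chain U G dG (fun _ => t) (fun ph => c1 (rh t) + r * (sin th * cos ph))
        (fun ph => c2 (rh t) + r * (sin th * sin ph)) (fun ph => c3 (rh t) + r * cos th) ph
        0 (- r * (sin th * sin ph)) (r * (sin th * cos ph)) 0 HU HG Hp).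
      * apply (is_derive_const (K := R_AbsRing) (V := R_NormedModule)).
      * auto_derive; [exact I | ring].
      * auto_derive; [exact I | ring].
      * apply (is_derive_const (K := R_AbsRing) (V := R_NormedModule)).
    + simpl.
      change (c1 (rh t) + r * (sin th * cos ph), c2 (rh t) + r * (sin th * sin ph),
        c3 (rh t) + r * cos th) with x. ring.
Qed.

(** V . e_r times the surface element of the sphere of radius r: the integrand of the outward
    flux. *)
Definition radial_flux (rh : R -> R3) (V1 V2 V3 : R -> R3 -> R) (p : R * R * R * R) : R :=
  (pull rh V1 p * (sin (pth p) * cos (pph p)) + pull rh V2 p * (sin (pth p) * sin (pph p))
   + pull rh V3 p * cos (pth p)) * (pr p ^ 2 * sin (pth p)).

Definition flux (rh : R -> R3) (V1 V2 V3 : R -> R3 -> R) (t rad : R) : R :=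
  ang (radial_flux rh V1 V2 V3) (t, rad).

Lemma cont_on_radial_flux rh U V1 V2 V3 : cont_curve rh ->
  C0_on U V1 -> C0_on U V2 -> C0_on U V3 ->
  cont_on (sphdom rh U) (radial_flux rh V1 V2 V3).
Proof.
  intros H H1 H2 H3 p Hp. destruct (continuous_coords p) as [Kt [Kr [Kth Kph]]].
  assert (E1 := cont_on_pull rh U V1 H H1 p Hp). assert (E2 := cont_on_pull rh U V2 H H2 p Hp).
  assert (E3 := cont_on_pull rh U V3 H H3 p Hp). unfold radial_flux. cont_auto.
Qed.

(** The entries of the unit normal are at most 1 in modulus, so |V . e_r| is bounded by the sum of
    the moduli of the three components. *)
Lemma flux_abs rh U V1 V2 V3 G K t rad : cont_curve rh -> open4 U -> 0 <= rad ->
  ball_in rh U t rad -> C0_on U V1 -> C0_on U V2 -> C0_on U V3 -> C0_on U G ->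
  (forall x, norm3 (sub3 x (rh t)) <= rad ->
     Rabs (V1 t x) + Rabs (V2 t x) + Rabs (V3 t x) <= K * G t x) ->
  Rabs (flux rh V1 V2 V3 t rad) <= K * sphere_int (G t) (rh t) rad.
Proof.
  intros Hrh HU Hrad Hball H1 H2 H3 HG H.
  assert (HD := open_sphdom rh U Hrh HU).
  assert (CF := cont_on_radial_flux rh U V1 V2 V3 Hrh H1 H2 H3).
  assert (CG := cont_on_volw _ _ (cont_on_pull rh U G Hrh HG)).
  assert (Ha := angdom_ball rh U t rad rad Hball (conj Hrad (Rle_refl rad))).
  change (sphere_int (G t) (rh t) rad) with (ang (volw (pull rh G)) (t, rad)).
  assert (Hpt : forall th ph, 0 <= th <= PI ->
    Rabs (radial_flux rh V1 V2 V3 (t, rad, th, ph)) <= K * volw (pull rh G) (t, rad, th, ph)).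
  { intros th ph Hth. unfold radial_flux, volw, pth, pph, pr; simpl fst; simpl snd.
    assert (Hw : 0 <= rad ^ 2 * sin th).
    { apply Rmult_le_pos; [apply pow2_ge_0 | apply sin_ge_0; apply Hth]. }
    rewrite Rabs_mult, (Rabs_right (rad ^ 2 * sin th)) by lra. rewrite <- (Rmult_assoc K).
    apply Rmult_le_compat_r; [exact Hw|].
    eapply Rle_trans; [|apply H, (sphpt_in_ball rh t rad rad th ph); lra].
    assert (B : forall u v, Rabs v <= 1 -> Rabs (u * v) <= Rabs u).
    { intros u v Hv. rewrite Rabs_mult. assert (Hu := Rabs_pos u). nra. }
    assert (Bs : forall y, Rabs (sin y) <= 1) by (intros y; apply Rabs_le, SIN_bound).
    assert (Bc : forall y, Rabs (cos y) <= 1) by (intros y; apply Rabs_le, COS_bound).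
    assert (Bm : forall u v, Rabs u <= 1 -> Rabs v <= 1 -> Rabs (u * v) <= 1).
    { intros u v Hu Hv. eapply Rle_trans; [apply B, Hv | exact Hu]. }
    eapply Rle_trans; [apply Rabs_triang|]. apply Rplus_le_compat; [|apply B, Bc].
    eapply Rle_trans; [apply Rabs_triang|]. apply Rplus_le_compat; apply B, Bm; auto. }
  set (g := volw (pull rh G)) in *. set (f := radial_flux rh V1 V2 V3) in *.
  assert (Hl : forall th ph, 0 <= th <= PI ->
    (fun p => - K * g p + 0 * g p) (t, rad, th, ph) <= f (t, rad, th, ph)).
  { intros th ph Hth. assert (Hh := Hpt th ph Hth). apply Rabs_le_between in Hh. lra. }
  assert (Hu : forall th ph, 0 <= th <= PI ->
    f (t, rad, th, ph) <= (fun p => K * g p + 0 * g p) (t, rad, th, ph)).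
  { intros th ph Hth. assert (Hh := Hpt th ph Hth). apply Rabs_le_between in Hh. lra. }
  apply Rabs_le. split.
  - replace (- (K * _)) with (- K * ang g (t, rad) + 0 * ang g (t, rad)) by ring.
    rewrite <- (ang_lin (sphdom rh U)) by auto.
    apply (ang_le (sphdom rh U)); auto using cont_on_lin.
  - replace (K * _) with (K * ang g (t, rad) + 0 * ang g (t, rad)) by ring.
    rewrite <- (ang_lin (sphdom rh U)) by auto.
    apply (ang_le (sphdom rh U)); auto using cont_on_lin.
Qed.

Lemma pint_derive (f df : R -> R) (a b : R) : a <= b ->
  (forall x, a <= x <= b -> is_derive f x (df x)) -> (forall x, a <= x <= b -> continuous df x) ->
  RInt df a b = f b - f a.
Proof.
  intros Hab H1 H2. apply is_RInt_unique.
  apply (is_RInt_derive (V := R_CompleteNormedModule) f df a b);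
    rewrite Rmin_left, Rmax_right by lra; assumption.
Qed.

(** Product rule in the shape common to the three spherical components below: [V] against a frame
    vector, times a weight. *)
Lemma is_derive_dot_mult (f1 f2 f3 g1 g2 g3 h : R -> R) (x d1 d2 d3 k1 k2 k3 k : R) :
  is_derive f1 x d1 -> is_derive f2 x d2 -> is_derive f3 x d3 ->
  is_derive g1 x k1 -> is_derive g2 x k2 -> is_derive g3 x k3 -> is_derive h x k ->
  is_derive (fun s => (f1 s * g1 s + f2 s * g2 s + f3 s * g3 s) * h s) x
    ((d1 * g1 x + f1 x * k1 + (d2 * g2 x + f2 x * k2) + (d3 * g3 x + f3 x * k3)) * h x
     + (f1 x * g1 x + f2 x * g2 x + f3 x * g3 x) * k).
Proof.
  intros D1 D2 D3 K1 K2 K3 K. auto_derive.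
  - repeat split; trivial; eexists; eassumption.
  - assert (E : forall (f : R -> R) l, is_derive f x l -> Derive (fun y : R => f y) x = l).
    { intros f l H. exact (is_derive_unique _ _ _ H). }
    rewrite (E _ _ D1), (E _ _ D2), (E _ _ D3), (E _ _ K1), (E _ _ K2), (E _ _ K3), (E _ _ K). ring.
Qed.

Section Divergence.
Context (rh : R -> R3) (U : R -> R3 -> Prop) (t rad : R).
Context (V1 V2 V3 : R -> R3 -> R) (dV1 dV2 dV3 : nat -> R -> R3 -> R).
Context (Hrh : cont_curve rh) (HU : open4 U) (Hrad : 0 <= rad) (Hball : ball_in rh U t rad).
Context (HV1 : C1_on U V1 dV1) (HV2 : C1_on U V2 dV2) (HV3 : C1_on U V3 dV3).

Let divV (s : R) (x : R3) : R := dV1 1%nat s x + dV2 2%nat s x + dV3 3%nat s x.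

Let n1 p := sin (pth p) * cos (pph p).
Let n2 p := sin (pth p) * sin (pph p).
Let n3 p := cos (pth p).
Let e1 p := cos (pth p) * cos (pph p).
Let e2 p := cos (pth p) * sin (pph p).
Let e3 p := - sin (pth p).
Let jac (dG : nat -> R -> R3 -> R) (m1 m2 m3 p : _) : R :=
  pull rh (dG 1%nat) p * m1 + pull rh (dG 2%nat) p * m2 + pull rh (dG 3%nat) p * m3.

(** [dW], [dA], [dB] are the r, theta, phi derivatives of the weighted components of V along e_r,
    e_theta, e_phi. Terms without [jac] come from the weight or the frame: d_theta e_theta = - e_r
    and d_phi e_phi = - (cos phi, sin phi, 0). The weight of [B] is r alone, sin(theta) having
    cancelled against the scale factor, so nothing is singular at the poles. *)
Let dW p :=
  (jac dV1 (n1 p) (n2 p) (n3 p) p * n1 p + jac dV2 (n1 p) (n2 p) (n3 p) p * n2 p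
   + jac dV3 (n1 p) (n2 p) (n3 p) p * n3 p) * (pr p ^ 2 * sin (pth p))
  + (pull rh V1 p * n1 p + pull rh V2 p * n2 p + pull rh V3 p * n3 p) * (2 * pr p * sin (pth p)).
Let A p := (pull rh V1 p * e1 p + pull rh V2 p * e2 p + pull rh V3 p * e3 p) * (pr p * sin (pth p)).
Let dA p :=
  (pr p * (jac dV1 (e1 p) (e2 p) (e3 p) p * e1 p + jac dV2 (e1 p) (e2 p) (e3 p) p * e2 p
           + jac dV3 (e1 p) (e2 p) (e3 p) p * e3 p)
   - (pull rh V1 p * n1 p + pull rh V2 p * n2 p + pull rh V3 p * n3 p)) * (pr p * sin (pth p))
  + (pull rh V1 p * e1 p + pull rh V2 p * e2 p + pull rh V3 p * e3 p) * (pr p * cos (pth p)).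
Let B p := (pull rh V1 p * - sin (pph p) + pull rh V2 p * cos (pph p)) * pr p.
Let dB p :=
  (pr p * sin (pth p) * (jac dV1 (- sin (pph p)) (cos (pph p)) 0 p * - sin (pph p)
           + jac dV2 (- sin (pph p)) (cos (pph p)) 0 p * cos (pph p))
   - (pull rh V1 p * cos (pph p) + pull rh V2 p * sin (pph p))) * pr p.

(* [r^2 sin(theta) div V
    = d_r (r^2 sin(theta) V.e_r) + d_theta (r sin(theta) V.e_theta) + d_phi (r V.e_phi)] *)
Let div_spherical p : volw (pull rh divV) p = dW p + dA p + dB p.
Proof.
  unfold volw, dW, dA, dB, jac, divV, n1, n2, n3, e1, e2, e3, pull.
  assert (H1 := sin2_cos2 (pth p)). assert (H2 := sin2_cos2 (pph p)). unfold Rsqr in *.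
  set (s := sin (pth p)) in *. set (c := cos (pth p)) in *.
  set (S := sin (pph p)) in *. set (C := cos (pph p)) in *.
  set (x := sphpt rh p). set (u := pt p). set (r := pr p).
  (* Eliminating the squared cosine of both angles leaves a polynomial identity. *)
  assert (Hc : c * c = 1 - s * s) by lra. assert (HC : C * C = 1 - S * S) by lra.
  clear - Hc HC.
  ring [Hc HC].
Qed.

Let contp : forall p, sphdom rh U p ->
  continuous dW p /\ continuous A p /\ continuous dA p /\ continuous B p /\ continuous dB p.
Proof.
  intros p Hp. destruct (continuous_coords p) as [Kt [Kr [Kth Kph]]].
  assert (E : forall G, C0_on U G -> continuous (pull rh G) p).
  { intros G HG. apply (cont_on_pull rh U G Hrh HG p Hp). }
  assert (F1 := E _ (C1_C0 _ _ _ HV1)). assert (F2 := E _ (C1_C0 _ _ _ HV2)).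
  assert (F3 := E _ (C1_C0 _ _ _ HV3)).
  assert (G1 : forall i, (i < 4)%nat -> continuous (pull rh (dV1 i)) p)
    by (intros; eapply E, C1_C0_partial; eassumption).
  assert (G2 : forall i, (i < 4)%nat -> continuous (pull rh (dV2 i)) p)
    by (intros; eapply E, C1_C0_partial; eassumption).
  assert (G3 : forall i, (i < 4)%nat -> continuous (pull rh (dV3 i)) p)
    by (intros; eapply E, C1_C0_partial; eassumption).
  assert (G11 := G1 1%nat ltac:(lia)). assert (G12 := G1 2%nat ltac:(lia)).
  assert (G13 := G1 3%nat ltac:(lia)). assert (G21 := G2 1%nat ltac:(lia)).
  assert (G22 := G2 2%nat ltac:(lia)). assert (G23 := G2 3%nat ltac:(lia)).
  assert (G31 := G3 1%nat ltac:(lia)). assert (G32 := G3 2%nat ltac:(lia)).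
  assert (G33 := G3 3%nat ltac:(lia)). clear G1 G2 G3.
  unfold dW, A, dA, B, dB, jac, n1, n2, n3, e1, e2, e3.
  repeat split; cont_auto.
Qed.

Ltac use_chain Hp :=
  match type of Hp with
  | sphdom _ _ (?t, ?r, ?th, ?ph) =>
    destruct (sph_chain rh U V1 dV1 t r th ph HU HV1 Hp) as [X1 [Y1 Z1]];
    destruct (sph_chain rh U V2 dV2 t r th ph HU HV2 Hp) as [X2 [Y2 Z2]];
    destruct (sph_chain rh U V3 dV3 t r th ph HU HV3 Hp) as [X3 [Y3 Z3]]
  end.

Let derW s r th ph : sphdom rh U (s, r, th, ph) ->
  is_derive (fun r => radial_flux rh V1 V2 V3 (s, r, th, ph)) r (dW (s, r, th, ph)).
Proof.
  intros Hp. use_chain Hp. eapply is_derive_eq.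
  - apply (is_derive_dot_mult _ _ _ (fun _ => sin th * cos ph) (fun _ => sin th * sin ph)
      (fun _ => cos th) (fun r => r ^ 2 * sin th) r _ _ _ 0 0 0 (2 * r * sin th) X1 X2 X3);
      auto_derive; trivial; ring.
  - unfold dW, jac, n1, n2, n3, pull, pth, pph, pr, pt; simpl. ring.
Qed.

Let derA s r th ph : sphdom rh U (s, r, th, ph) ->
  is_derive (fun th => A (s, r, th, ph)) th (dA (s, r, th, ph)).
Proof.
  intros Hp. use_chain Hp. eapply is_derive_eq.
  - apply (is_derive_dot_mult _ _ _ (fun th => cos th * cos ph) (fun th => cos th * sin ph)
      (fun th => - sin th) (fun th => r * sin th) th _ _ _ (- sin th * cos ph) (- sin th * sin ph)
      (- cos th) (r * cos th) Y1 Y2 Y3);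
      auto_derive; trivial; ring.
  - unfold dA, jac, e1, e2, e3, n1, n2, n3, pull, pth, pph, pr, pt; simpl. ring.
Qed.

Let derB s r th ph : sphdom rh U (s, r, th, ph) ->
  is_derive (fun ph => B (s, r, th, ph)) ph (dB (s, r, th, ph)).
Proof.
  intros Hp. use_chain Hp.
  apply is_derive_ext with (f := fun ph => (pull rh V1 (s, r, th, ph) * - sin ph
    + pull rh V2 (s, r, th, ph) * cos ph + pull rh V3 (s, r, th, ph) * 0) * r).
  { intros y. unfold B, pph, pr; simpl. ring. }
  eapply is_derive_eq.
  - apply (is_derive_dot_mult _ _ _ (fun ph => - sin ph) (fun ph => cos ph) (fun _ => 0)
      (fun _ => r) ph _ _ _ (- cos ph) (- sin ph) 0 0 Z1 Z2 Z3); auto_derive; trivial; ring.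
  - unfold dB, jac, pull, pth, pph, pr, pt; simpl. ring.
Qed.

(** Each exact derivative is integrated in its own variable. The phi term vanishes by periodicity,
    the theta term because [A] carries sin(theta), zero at both poles, and the radial term leaves
    the flux at [rad], as the weight r^2 is zero at the centre. The theta and r derivatives are
    first taken out of the inner integrals by [is_derive_pint]. *)
Theorem divergence_ball :
  ball_int (divV t) (rh t) rad = flux rh V1 V2 V3 t rad.
Proof.
  assert (HD := open_sphdom rh U Hrh HU).
  assert (CW : cont_on (sphdom rh U) dW) by (intros p Hp; apply (contp p Hp)).
  assert (CA : cont_on (sphdom rh U) A) by (intros p Hp; apply (contp p Hp)).
  assert (CdA : cont_on (sphdom rh U) dA) by (intros p Hp; apply (contp p Hp)).
  assert (CdB : cont_on (sphdom rh U) dB) by (intros p Hp; apply (contp p Hp)).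
  assert (CF := cont_on_radial_flux rh U V1 V2 V3 Hrh (C1_C0 _ _ _ HV1) (C1_C0 _ _ _ HV2) (C1_C0 _ _ _ HV3)).
  assert (Z2 := two_PI_pos). assert (Z1 := PI_nonneg).
  set (D2 := pall 0 (2 * PI) (sphdom rh U)).
  assert (HD2 : open D2) by (apply open_pall, HD).
  assert (inD2 : forall r th, 0 <= r <= rad -> D2 (t, r, th)).
  { intros r th Hr ph _. apply (sphdom_ball rh U t rad); assumption. }
  assert (IB : forall r th, 0 <= r <= rad -> pint 0 (2 * PI) dB (t, r, th) = 0).
  { intros r th Hr. unfold pint.
    rewrite (pint_derive (fun ph => B (t, r, th, ph)) (fun ph => dB (t, r, th, ph)) 0 (2 * PI)).
    - unfold B, pull, sphpt, sph, pt, pr, pth, pph; simpl.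
      rewrite sin_2PI, cos_2PI, sin_0, cos_0. ring.
    - exact Z2.
    - intros ph Hph. apply derB, (inD2 r th Hr ph Hph).
    - intros ph Hph. apply (continuous_section dB (t, r, th) ph). apply CdB, (inD2 r th Hr ph Hph). }
  assert (Idiv : forall r th, 0 <= r <= rad ->
    pint 0 (2 * PI) (volw (pull rh divV)) (t, r, th)
    = 1 * pint 0 (2 * PI) dW (t, r, th) + 1 * pint 0 (2 * PI) dA (t, r, th)).
  { intros r th Hr.
    rewrite (pint_ext 0 (2 * PI) _ (fun p => 1 * (1 * dW p + 1 * dA p) + 1 * dB p) (t, r, th) Z2).
    - rewrite (pint_lin 0 (2 * PI) (sphdom rh U)); auto using cont_on_lin.
      rewrite (pint_lin 0 (2 * PI) (sphdom rh U)); auto.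
      rewrite IB by exact Hr. rewrite Rmult_0_r, Rplus_0_r, (Rmult_1_l (_ + _)). reflexivity.
      apply inD2, Hr. apply inD2, Hr.
    - intros ph Hph. rewrite div_spherical. ring. }
  assert (IA : forall r, 0 <= r <= rad -> ang dA (t, r) = 0).
  { intros r Hr. unfold ang at 1. unfold pint at 1.
    rewrite (pint_derive (fun th => pint 0 (2 * PI) A (t, r, th))
       (fun th => pint 0 (2 * PI) dA (t, r, th)) 0 PI).
    - assert (H0 : forall th, sin th = 0 -> pint 0 (2 * PI) A (t, r, th) = 0).
      { intros th Hth. rewrite (pint_ext 0 (2 * PI) A (fun _ => 0) (t, r, th) Z2).
        - unfold pint. rewrite RInt_const. apply (scal_zero_r (K := R_AbsRing) (V := R_NormedModule)).
        - intros ph _. unfold A, pth; simpl. rewrite Hth. ring. }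
      rewrite !H0 by auto using sin_PI, sin_0. ring.
    - exact Z1.
    - intros th Hth. apply (is_derive_pint 0 (2 * PI) (sphdom rh U) A dA (fun th => (t, r, th)) Z2 HD CA CdA).
      + intros s. apply continuous_pair; [apply continuous_const | apply continuous_id].
      + intros s y Hy. apply derA, Hy.
      + apply inD2, Hr.
    - intros th Hth. apply (continuous_section (pint 0 (2 * PI) dA) (t, r) th).
      apply (cont_on_pint 0 (2 * PI) (sphdom rh U)); auto. apply inD2, Hr. }
  assert (Iang : forall r, 0 <= r <= rad -> ang (volw (pull rh divV)) (t, r) = ang dW (t, r)).
  { intros r Hr. unfold ang at 1.
    rewrite (pint_ext 0 PI _ (fun p => 1 * pint 0 (2 * PI) dW p + 1 * pint 0 (2 * PI) dA p) (t, r) Z1).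
    - rewrite (pint_lin 0 PI D2); auto.
      + change (1 * ang dW (t, r) + 1 * ang dA (t, r) = ang dW (t, r)). rewrite IA by exact Hr. ring.
      + apply cont_on_pint; auto.
      + apply cont_on_pint; auto.
      + intros th _. apply inD2, Hr.
    - intros th _. apply Idiv, Hr. }
  rewrite ball_int_pint.
  rewrite (pint_ext 0 rad _ (ang dW) t Hrad) by (intros r Hr; apply Iang, Hr).
  unfold pint.
  rewrite (pint_derive (fun r => ang (radial_flux rh V1 V2 V3) (t, r)) (fun r => ang dW (t, r)) 0 rad).
  - unfold flux. replace (ang (radial_flux rh V1 V2 V3) (t, 0)) with 0; [ring|].
    symmetry. unfold ang.
    assert (H0 : forall th, pint 0 (2 * PI) (radial_flux rh V1 V2 V3) (t, 0, th) = 0).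
    { intros th. rewrite (pint_ext 0 (2 * PI) _ (fun _ => 0) (t, 0, th) Z2).
      - unfold pint. rewrite RInt_const. apply (scal_zero_r (K := R_AbsRing) (V := R_NormedModule)).
      - intros ph _. unfold radial_flux, pr; simpl. ring. }
    rewrite (pint_ext 0 PI _ (fun _ => 0) (t, 0) Z1) by (intros th _; apply H0).
    unfold pint. rewrite RInt_const. apply (scal_zero_r (K := R_AbsRing) (V := R_NormedModule)).
  - exact Hrad.
  - intros r Hr. unfold ang.
    apply (is_derive_pint 0 PI D2 (pint 0 (2 * PI) (radial_flux rh V1 V2 V3)) (pint 0 (2 * PI) dW)
       (fun r => (t, r)) Z1 HD2).
    + apply cont_on_pint; auto.
    + apply cont_on_pint; auto.
    + intros s. apply continuous_pair; [apply continuous_const | apply continuous_id].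
    + intros s th Hs.
      apply (is_derive_pint 0 (2 * PI) (sphdom rh U) (radial_flux rh V1 V2 V3) dW
         (fun r => (t, r, th)) Z2 HD CF CW).
      * intros u. apply continuous_pair; [|apply continuous_const].
        apply continuous_pair; [apply continuous_const | apply continuous_id].
      * intros u y Hy. apply derW, Hy.
      * exact Hs.
    + intros th _. apply inD2, Hr.
  - intros r Hr. apply (continuous_section (ang dW) t r).
    apply (cont_on_ang (sphdom rh U)); auto. apply (angdom_ball rh U t rad); assumption.
Qed.

End Divergence.

(** * Time derivative of an integral over a moving ball *)

Section Balance.
Context (rh v : R -> R3) (U : R -> R3 -> Prop) (rad : R).
Context (f : R -> R3 -> R) (df : nat -> R -> R3 -> R).
Context (Hrh : diff_traj rh v) (Hv : cont_curve v) (HU : open4 U) (Hrad : 0 <= rad).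
Context (Hf : C1_on U f df).

(** Material derivative: the rate of change of [f] seen from a point with fixed spherical
    coordinates, which moves with velocity [v]. *)
Let G (s : R) (x : R3) : R :=
  df 0%nat s x + (df 1%nat s x * c1 (v s) + df 2%nat s x * c2 (v s) + df 3%nat s x * c3 (v s)).

Let HG : C0_on U G.
Proof.
  intros s x Hx. destruct (Hv s) as [H1 [H2 H3]].
  assert (Kt : continuous (fun p : R * (R * R * R) => fst p) (s, x)).
  { apply (continuous_fst (U := R_UniformSpace) (V := prod_UniformSpace (prod_UniformSpace
      R_UniformSpace R_UniformSpace) R_UniformSpace)). }
  assert (K1 := continuous_comp _ (fun s => c1 (v s)) (s, x) Kt H1).
  assert (K2 := continuous_comp _ (fun s => c2 (v s)) (s, x) Kt H2).
  assert (K3 := continuous_comp _ (fun s => c3 (v s)) (s, x) Kt H3).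
  assert (F0 := C1_C0_partial U f df 0%nat ltac:(lia) Hf s x Hx).
  assert (F1 := C1_C0_partial U f df 1%nat ltac:(lia) Hf s x Hx).
  assert (F2 := C1_C0_partial U f df 2%nat ltac:(lia) Hf s x Hx).
  assert (F3 := C1_C0_partial U f df 3%nat ltac:(lia) Hf s x Hx).
  unfold cont4 in *. unfold G. cont_auto.
Qed.

Lemma is_derive_ball_int t : ball_in rh U t rad ->
  is_derive (fun s => ball_int (f s) (rh s) rad) t (ball_int (G t) (rh t) rad).
Proof.
  intros Hball. assert (Hc := diff_traj_cont rh v Hrh).
  assert (HD := open_sphdom rh U Hc HU).
  assert (CF := cont_on_volw _ _ (cont_on_pull rh U f Hc (C1_C0 _ _ _ Hf))).
  assert (CG := cont_on_volw _ _ (cont_on_pull rh U G Hc HG)).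
  assert (Z2 := two_PI_pos). assert (Z1 := PI_nonneg).
  change (is_derive (fun s => pint 0 rad (ang (volw (pull rh f))) s) t
    (pint 0 rad (ang (volw (pull rh G))) t)).
  apply (is_derive_pint 0 rad (angdom (sphdom rh U)) (ang (volw (pull rh f)))
    (ang (volw (pull rh G))) (fun s => s) Hrad).
  - apply open_angdom, HD.
  - apply cont_on_ang; assumption.
  - apply cont_on_ang; assumption.
  - intros s. apply continuous_id.
  - intros s r Hr. unfold ang.
    apply (is_derive_pint 0 PI (pall 0 (2 * PI) (sphdom rh U)) (pint 0 (2 * PI) (volw (pull rh f)))
      (pint 0 (2 * PI) (volw (pull rh G))) (fun s => (s, r)) Z1).
    + apply open_pall, HD.
    + apply cont_on_pint; assumption.
    + apply cont_on_pint; assumption.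
    + intros u. apply continuous_pair; [apply continuous_id | apply continuous_const].
    + intros u th Hth.
      apply (is_derive_pint 0 (2 * PI) (sphdom rh U) (volw (pull rh f)) (volw (pull rh G))
        (fun s => (s, r, th)) Z2 HD CF CG).
      * intros w. apply continuous_pair; [|apply continuous_const].
        apply continuous_pair; [apply continuous_id | apply continuous_const].
      * intros w ph Hp. destruct (Hrh w) as [D1 [D2 D3]].
        assert (Hch : is_derive (fun s => pull rh f (s, r, th, ph)) w (pull rh G (w, r, th, ph))).
        { unfold pull. eapply is_derive_eq.
          - apply (C1_chain U f df (fun s => s) (fun s => c1 (rh s) + r * (sin th * cos ph))
              (fun s => c2 (rh s) + r * (sin th * sin ph)) (fun s => c3 (rh s) + r * cos th) w
              1 (c1 (v w)) (c2 (v w)) (c3 (v w)) HU Hf Hp).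
            + apply (is_derive_id (K := R_AbsRing)).
            + rewrite <- (Rplus_0_r (c1 (v w))).
              apply (is_derive_plus (K := R_AbsRing) (V := R_NormedModule) _ _ _ _ _ D1).
              apply (is_derive_const (K := R_AbsRing) (V := R_NormedModule)).
            + rewrite <- (Rplus_0_r (c2 (v w))).
              apply (is_derive_plus (K := R_AbsRing) (V := R_NormedModule) _ _ _ _ _ D2).
              apply (is_derive_const (K := R_AbsRing) (V := R_NormedModule)).
            + rewrite <- (Rplus_0_r (c3 (v w))).
              apply (is_derive_plus (K := R_AbsRing) (V := R_NormedModule) _ _ _ _ _ D3).
              apply (is_derive_const (K := R_AbsRing) (V := R_NormedModule)).
          - unfold G, pt; simpl.
            change (c1 (rh w) + r * (sin th * cos ph), c2 (rh w) + r * (sin th * sin ph),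
              c3 (rh w) + r * cos th) with (sphpt rh (w, r, th, ph)). ring. }
        unfold volw, pr, pth; simpl fst; simpl snd.
        eapply is_derive_eq.
        -- apply (is_derive_mult (K := R_AbsRing) _ (fun _ => r ^ 2 * sin th) w _ 0 Hch).
           ++ apply (is_derive_const (K := R_AbsRing) (V := R_NormedModule)).
           ++ apply Rmult_comm.
        -- unfold plus, mult; simpl. ring.
      * exact Hth.
    + exact Hr.
  - intros r Hr. apply (angdom_ball rh U t rad); assumption.
Qed.

Context (V1 V2 V3 : R -> R3 -> R) (dV1 dV2 dV3 : nat -> R -> R3 -> R) (src : R -> R3 -> R).
Context (HV1 : C1_on U V1 dV1) (HV2 : C1_on U V2 dV2) (HV3 : C1_on U V3 dV3) (Hs : C0_on U src).

(** Reynolds transport: v . grad f equals div(f v), because [v] does not depend on [x], and so it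
    joins V in a single boundary flux through [divergence_ball]. *)
Theorem balance_law t : ball_in rh U t rad ->
  (forall x, norm3 (sub3 x (rh t)) <= rad ->
     df 0%nat t x = dV1 1%nat t x + dV2 2%nat t x + dV3 3%nat t x + src t x) ->
  is_derive (fun s => ball_int (f s) (rh s) rad) t
    (flux rh (fun s x => V1 s x + c1 (v t) * f s x) (fun s x => V2 s x + c2 (v t) * f s x)
       (fun s x => V3 s x + c3 (v t) * f s x) t rad + ball_int (src t) (rh t) rad).
Proof.
  intros Hball Heq. assert (Hc := diff_traj_cont rh v Hrh).
  (* The velocity is frozen at the time [t] of interest: with a constant coefficient [k] the field
     is C^1 although [v] is only continuous in time. *)
  assert (W : forall V dV k, C1_on U V dV ->
    C1_on U (fun s x => V s x + k * f s x) (fun i s x => dV i s x + (0 * f s x + k * df i s x))).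
  { intros V dV k HV. apply C1_plus; [exact HV|].
    apply (C1_mult U (fun _ _ => k) (fun _ _ _ => 0) f df (C1_const U k) Hf). }
  assert (W1 := W _ _ (c1 (v t)) HV1). assert (W2 := W _ _ (c2 (v t)) HV2).
  assert (W3 := W _ _ (c3 (v t)) HV3).
  eapply is_derive_eq; [apply is_derive_ball_int, Hball|].
  rewrite <- (divergence_ball rh U t rad _ _ _ _ _ _ Hc HU Hrad Hball W1 W2 W3).
  set (divF := fun s x => dV1 1%nat s x + (0 * f s x + c1 (v t) * df 1%nat s x)
    + (dV2 2%nat s x + (0 * f s x + c2 (v t) * df 2%nat s x))
    + (dV3 3%nat s x + (0 * f s x + c3 (v t) * df 3%nat s x))).
  change (ball_int (G t) (rh t) rad
    = ball_int (divF t) (rh t) rad + ball_int (src t) (rh t) rad).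
  rewrite <- (Rmult_1_l (ball_int (divF t) (rh t) rad)), <- (Rmult_1_l (ball_int (src t) (rh t) rad)).
  rewrite <- (ball_int_lin rh U t rad Hc HU Hrad Hball divF src 1 1).
  - apply (ball_int_ext rh t rad Hrad G (fun t x => 1 * divF t x + 1 * src t x)).
    intros x Hx. unfold G, divF. rewrite Heq by exact Hx. ring.
  - intros s x Hx.
    assert (F1 := C1_C0_partial _ _ _ 1%nat ltac:(lia) W1 s x Hx).
    assert (F2 := C1_C0_partial _ _ _ 2%nat ltac:(lia) W2 s x Hx).
    assert (F3 := C1_C0_partial _ _ _ 3%nat ltac:(lia) W3 s x Hx).
    unfold cont4 in *. unfold divF.
    apply cont_plus; [apply cont_plus|]; assumption.
  - exact Hs.
Qed.

End Balance.

(** * The nonlinearity *)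

Lemma rpow_half y : 0 < y -> rpow y (1 / 2) = sqrt y.
Proof.
  intros Hy. unfold rpow. destruct (Rle_dec y 0); [lra|].
  rewrite <- Rpower_sqrt by exact Hy. f_equal. lra.
Qed.

Lemma rpow_three_halves y : 0 < y -> rpow y (1 + 1 / 2) = y * sqrt y.
Proof.
  intros Hy. unfold rpow. destruct (Rle_dec y 0); [lra|].
  rewrite Rpower_plus, Rpower_1 by exact Hy. f_equal.
  rewrite <- Rpower_sqrt by exact Hy. f_equal. lra.
Qed.

(** At exponent 1/2 and with y = sqrt(s), the hypotheses give |G1 s| <= Cb y sqrt(y) and |G1p s| y
    <= Cb sqrt(y); the spare factor sqrt(y) tends to 0. *)
Lemma G1_hyp_small G1 G1p G1pp : G1_hyp G1 G1p G1pp ->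
  forall eps, 0 < eps -> exists del, 0 < del /\ forall s, 0 < s < del ->
    Rabs (G1 s) <= eps * sqrt s /\ Rabs (G1p s) * sqrt s <= eps.
Proof.
  intros [_ [_ [_ H]]] eps Heps. destruct (H (1 / 2) ltac:(lra)) as [_ [_ HB]].
  destruct (HB 1) as [Cb HC]. clear H HB.
  (* [Cb] may be zero or negative; [K] is a positive bound for it. The threshold e^4 below comes
     from asking sqrt(sqrt s) <= e. *)
  set (K := Rabs Cb + 1). assert (HK : 0 < K) by (assert (Hp := Rabs_pos Cb); unfold K; lra).
  set (e := eps / K). assert (He : 0 < e) by (apply Rdiv_lt_0_compat; assumption).
  assert (He4 : 0 < (e * e) * (e * e)) by (apply Rmult_lt_0_compat; apply Rmult_lt_0_compat; exact He).
  exists (Rmin 1 ((e * e) * (e * e))). split; [apply Rmin_pos; lra|].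
  intros s [Hs Hs']. assert (Hs1 : s < 1) by (eapply Rlt_le_trans; [exact Hs' | apply Rmin_l]).
  assert (Hs2 : s < (e * e) * (e * e)) by (eapply Rlt_le_trans; [exact Hs' | apply Rmin_r]).
  set (y := sqrt s). assert (Hy : 0 < y) by (apply sqrt_lt_R0, Hs).
  assert (Hyy : y * y = s) by (apply sqrt_sqrt; lra).
  assert (Hy1 : y <= 1) by nra.
  assert (Hye : y < e * e).
  { apply Rnot_le_lt. intros Hn. assert (0 < e * e) by nra. nra. }
  assert (Hq : 0 < sqrt y) by (apply sqrt_lt_R0, Hy).
  assert (Hqe : sqrt y <= e).
  { rewrite <- (sqrt_square e) by lra. apply sqrt_le_1; nra. }
  assert (Hz : Cmod (RtoC y) = y) by (rewrite Cmod_R, Rabs_pos_eq; lra).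
  destruct (HC (RtoC y)) as [B1 B2]; [lra|]. rewrite Hz in B1, B2.
  replace (y ^ 2) with s in B1, B2 by (simpl; lra).
  rewrite rpow_three_halves in B1 by exact Hy. rewrite rpow_half in B2 by exact Hy.
  assert (HKe : Cb * sqrt y <= eps).
  { assert (Cb <= K) by (assert (Hp := Rle_abs Cb); unfold K; lra).
    replace eps with (K * e) by (unfold e; field; lra).
    apply Rle_trans with (K * sqrt y); [apply Rmult_le_compat_r; lra | apply Rmult_le_compat_l; lra]. }
  split.
  - eapply Rle_trans; [exact B1|]. replace (Cb * (y * sqrt y)) with (Cb * sqrt y * y) by ring.
    apply Rmult_le_compat_r; lra.
  - eapply Rle_trans; [apply B2 | exact HKe].
    intros E0. apply (f_equal Cmod) in E0. rewrite Hz, Cmod_0 in E0. lra.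
Qed.

Lemma Cmod_sq (u w : R) : Cmod (u, w) ^ 2 = u ^ 2 + w ^ 2.
Proof. unfold Cmod. simpl fst; simpl snd. apply pow2_sqrt. nra. Qed.

Lemma Cmod_eq_0_pair (u w : R) : Cmod (u, w) = 0 -> u = 0 /\ w = 0.
Proof.
  intros H. assert (E := Cmod_sq u w). rewrite H in E.
  split; nra.
Qed.

Section Nonlinearity.
Context (G1 G1p G1pp : R -> R) (a : R) (HG : G1_hyp G1 G1p G1pp) (Ha : 0 < a).

Let Ga_pair (p : R * R) : R := Ga G1 a (Cmod p ^ 2).

Let a3 : 0 < a ^ 3.
Proof. apply pow_lt, Ha. Qed.

Let sqrt_scaled z : sqrt (a ^ 3 * Cmod z ^ 2) = sqrt (a ^ 3) * Cmod z.
Proof.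
  assert (H := Cmod_ge_0 z).
  rewrite sqrt_mult by (try apply pow2_ge_0; lra). rewrite sqrt_pow2 by exact H. reflexivity.
Qed.

Let scaled_pos z : Cmod z <> 0 -> 0 < a ^ 3 * Cmod z ^ 2.
Proof.
  intros H. assert (H' := Cmod_ge_0 z). apply Rmult_lt_0_compat; [exact a3|]. apply pow_lt. lra.
Qed.

Let Ga_pair_zero p : Cmod p = 0 -> Ga_pair p = 0.
Proof.
  intros E. unfold Ga_pair, Ga. rewrite E. replace (a ^ 3 * 0 ^ 2) with 0 by ring.
  rewrite (proj1 HG). ring.
Qed.

(** That [Ga_pair] is o(|p|) makes the origin a point of differentiability with zero gradient, in
    agreement with the value 0 given to [GapPsi] there. *)
Lemma nonlinearity_small eps : 0 < eps -> exists del, 0 < del /\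
  forall p : R * R, Cmod p < del ->
    Rabs (Ga_pair p) <= eps * Cmod p /\ Cmod (GapPsi G1p a p) <= eps.
Proof.
  intros Heps. set (b := sqrt (a ^ 3)). assert (Hb : 0 < b) by (apply sqrt_lt_R0, a3).
  assert (Ha5 : 0 < a ^ 5) by (apply pow_lt, Ha). assert (Ha2 : 0 < a ^ 2) by (apply pow_lt, Ha).
  (* With b |p| = sqrt(a^3 |p|^2), the bound e b |p| / a^5 on [Ga_pair] asks for the first entry,
     and the bound e / (a^2 b) on [GapPsi] for the second. *)
  set (e := Rmin (eps * a ^ 5 / b) (eps * a ^ 2 * b)).
  assert (He : 0 < e).
  { apply Rmin_pos; [apply Rdiv_lt_0_compat; [nra | exact Hb]|].
    apply Rmult_lt_0_compat; [apply Rmult_lt_0_compat|]; assumption. }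
  destruct (G1_hyp_small _ _ _ HG e He) as [d [Hd HB]].
  exists (sqrt d / b). split; [apply Rdiv_lt_0_compat; [apply sqrt_lt_R0, Hd | exact Hb]|].
  intros p Hp. unfold Ga_pair, Ga, GapPsi.
  destruct (Req_EM_T (Cmod p) 0) as [E|E].
  { rewrite E. replace (a ^ 3 * 0 ^ 2) with 0 by ring. rewrite (proj1 HG).
    rewrite Rmult_0_r, Rabs_R0, Cmod_0. lra. }
  assert (Hm := Cmod_ge_0 p). assert (Hm' : 0 < Cmod p) by lra.
  assert (Hs : a ^ 3 * Cmod p ^ 2 < d).
  { assert (H1 : b * Cmod p < sqrt d).
    { apply Rmult_lt_reg_r with (/ b); [apply Rinv_0_lt_compat, Hb|].
      replace (b * Cmod p * / b) with (Cmod p) by (field; lra). exact Hp. }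
    assert (H2 : 0 < b * Cmod p) by nra.
    rewrite <- (sqrt_sqrt d) by lra.
    replace (a ^ 3 * Cmod p ^ 2) with ((b * Cmod p) * (b * Cmod p)); [nra|].
    assert (b * b = a ^ 3) by (apply sqrt_sqrt; lra).
    replace (b * Cmod p * (b * Cmod p)) with ((b * b) * Cmod p ^ 2) by ring. congruence. }
  destruct (HB _ (conj (scaled_pos p E) Hs)) as [B1 B2].
  rewrite sqrt_scaled in B1, B2. fold b in B1, B2.
  split.
  - rewrite Rabs_mult, Rabs_pos_eq by (apply Rlt_le, Rinv_0_lt_compat, Ha5).
    apply Rmult_le_reg_l with (a ^ 5); [exact Ha5|].
    rewrite <- Rmult_assoc, Rinv_r, Rmult_1_l by lra.
    eapply Rle_trans; [exact B1|].
    assert (e * b <= eps * a ^ 5).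
    { replace (eps * a ^ 5) with (eps * a ^ 5 / b * b) by (field; lra).
      apply Rmult_le_compat_r; [lra | apply Rmin_l]. }
    nra.
  - rewrite Cmod_mult, Cmod_R, Rabs_mult, Rabs_pos_eq by (apply Rlt_le, Rinv_0_lt_compat, Ha2).
    apply Rmult_le_reg_l with (a ^ 2 * b); [nra|].
    replace (a ^ 2 * b * (/ a ^ 2 * Rabs (G1p (a ^ 3 * Cmod p ^ 2)) * Cmod p))
      with (Rabs (G1p (a ^ 3 * Cmod p ^ 2)) * (b * Cmod p)) by (field; lra).
    eapply Rle_trans; [exact B2|]. eapply Rle_trans; [apply Rmin_r|]. lra.
Qed.

Lemma continuous_Cmod (p : R * R) : continuous (fun p : R * R => Cmod p) p.
Proof.
  apply (continuous_comp (fun p : R * R => fst p ^ 2 + snd p ^ 2) sqrt).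
  - cont_auto.
  - apply continuous_sqrt.
Qed.

Let continuous_at_zero (f : R * R -> R) : f (0, 0) = 0 ->
  (forall eps, 0 < eps -> exists del, 0 < del /\ forall p, Cmod p < del -> Rabs (f p) <= eps) ->
  continuous f (0, 0).
Proof.
  intros H0 H. unfold continuous. apply filterlim_locally. intros eps.
  destruct (H (eps / 2) ltac:(assert (Hp := cond_pos eps); lra)) as [d [Hd Hf]].
  assert (L := continuous_Cmod (0, 0)).
  assert (L' : locally ((0, 0) : R * R) (fun p : R * R => Cmod p < d)).
  { apply (L (fun y => y < d)). change (Cmod (0, 0)) with (Cmod (RtoC 0)). rewrite Cmod_0.
    apply open_lt. exact Hd. }
  revert L'. apply filter_imp. intros p Hp. rewrite H0.
  change (Rabs (f p - 0) < eps). rewrite Rminus_0_r. specialize (Hf p Hp).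
  assert (Hc := cond_pos eps). lra.
Qed.

Let nonzero_locally (p : R * R) : Cmod p <> 0 -> locally p (fun q : R * R => Cmod q <> 0).
Proof.
  intros H. apply (continuous_Cmod p (fun y => y <> 0)). apply open_neq. exact H.
Qed.

Lemma continuous_Ga_pair p : continuous Ga_pair p.
Proof.
  destruct (Req_EM_T (Cmod p) 0) as [E|E].
  - destruct p as [u w]. destruct (Cmod_eq_0_pair u w E) as [-> ->].
    apply continuous_at_zero.
    + apply Ga_pair_zero, E.
    + intros eps Heps. destruct (nonlinearity_small eps Heps) as [d [Hd H]].
      exists (Rmin 1 d). split; [apply Rmin_pos; lra|]. intros p Hp.
      assert (Cmod p < 1) by (eapply Rlt_le_trans; [exact Hp | apply Rmin_l]).
      assert (Hp2 : Cmod p < d) by (eapply Rlt_le_trans; [exact Hp | apply Rmin_r]).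
      destruct (H p Hp2) as [B _]. nra.
  - unfold Ga_pair, Ga. apply cont_mult; [apply continuous_const|].
    apply (continuous_comp (fun p : R * R => a ^ 3 * Cmod p ^ 2) G1).
    + assert (Hc := continuous_Cmod p). cont_auto.
    + apply (ex_derive_continuous (K := R_AbsRing) (V := R_NormedModule)).
      exists (G1p (a ^ 3 * Cmod p ^ 2)). apply HG, scaled_pos, E.
Qed.

Lemma GapPsi_nonzero p : Cmod p <> 0 ->
  GapPsi G1p a p = (/ a ^ 2 * G1p (a ^ 3 * Cmod p ^ 2) * fst p, / a ^ 2 * G1p (a ^ 3 * Cmod p ^ 2) * snd p).
Proof.
  intros E. unfold GapPsi. destruct (Req_EM_T (Cmod p) 0); [contradiction|].
  unfold Cmult, RtoC; simpl. f_equal; ring.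
Qed.

Lemma continuous_GapPsi (p : R * R) :
  continuous (fun p : R * R => fst (GapPsi G1p a p)) p /\
  continuous (fun p : R * R => snd (GapPsi G1p a p)) p.
Proof.
  destruct (Req_EM_T (Cmod p) 0) as [E|E].
  - destruct p as [u w]. destruct (Cmod_eq_0_pair u w E) as [-> ->].
    assert (E0 : GapPsi G1p a (0, 0) = RtoC 0).
    { unfold GapPsi. destruct (Req_EM_T (Cmod (0, 0)) 0); [reflexivity | contradiction]. }
    assert (B : forall eps, 0 < eps -> exists del, 0 < del /\ forall p : R * R, Cmod p < del ->
      Cmod (GapPsi G1p a p) <= eps).
    { intros eps Heps. destruct (nonlinearity_small eps Heps) as [d [Hd H]].
      exists d. split; [exact Hd|]. intros p Hp. apply H, Hp. }
    split; apply continuous_at_zero; try (rewrite E0; reflexivity);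
      intros eps Heps; destruct (B eps Heps) as [d [Hd H]]; exists d; (split; [exact Hd|]);
      intros p Hp; (eapply Rle_trans; [|apply H, Hp]).
    + eapply Rle_trans; [apply Rmax_l|apply Rmax_Cmod].
    + eapply Rle_trans; [apply Rmax_r|apply Rmax_Cmod].
  - assert (Cg : continuous (fun p : R * R => / a ^ 2 * G1p (a ^ 3 * Cmod p ^ 2)) p).
    { apply cont_mult; [apply continuous_const|].
      apply (continuous_comp (fun p : R * R => a ^ 3 * Cmod p ^ 2) G1p).
      - assert (Hc := continuous_Cmod p). cont_auto.
      - apply (ex_derive_continuous (K := R_AbsRing) (V := R_NormedModule)).
        eexists. apply HG, scaled_pos, E. }
    assert (L := nonzero_locally p E).
    split.
    + apply continuous_ext_loc with (g := fun p : R * R => / a ^ 2 * G1p (a ^ 3 * Cmod p ^ 2) * fst p).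
      * revert L. apply filter_imp. intros q Hq. rewrite GapPsi_nonzero by exact Hq. reflexivity.
      * apply cont_mult; [exact Cg|]. destruct p. apply continuous_fst.
    + apply continuous_ext_loc with (g := fun p : R * R => / a ^ 2 * G1p (a ^ 3 * Cmod p ^ 2) * snd p).
      * revert L. apply filter_imp. intros q Hq. rewrite GapPsi_nonzero by exact Hq. reflexivity.
      * apply cont_mult; [exact Cg|]. destruct p. apply continuous_snd.
Qed.

(** Away from 0 this is the chain rule, with a^3 / a^5 = 1 / a^2. Where the curve passes through 0
    it is O(h) and [Ga_pair] is of smaller order, so the difference quotient tends to 0. *)
Lemma is_derive_Ga_pair (u w : R -> R) (s0 u' w' : R) :
  is_derive u s0 u' -> is_derive w s0 w' ->
  is_derive (fun s => Ga_pair (u s, w s)) s0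
    (2 * (fst (GapPsi G1p a (u s0, w s0)) * u' + snd (GapPsi G1p a (u s0, w s0)) * w')).
Proof.
  intros Hu Hw. destruct (Req_EM_T (Cmod (u s0, w s0)) 0) as [E|E].
  - assert (E0 : GapPsi G1p a (u s0, w s0) = RtoC 0).
    { unfold GapPsi. destruct (Req_EM_T _ _); [reflexivity | contradiction]. }
    rewrite E0. simpl fst; simpl snd. replace (2 * (0 * u' + 0 * w')) with 0 by ring.
    destruct (Cmod_eq_0_pair _ _ E) as [Eu Ew].
    apply is_derive_Reals in Hu. apply is_derive_Reals in Hw. apply is_derive_Reals.
    intros eps Heps.
    (* For small h each coordinate of the curve is at most its |derivative| + 1 times |h|; [K] adds
       the two slopes. *)
    set (K := Rabs u' + Rabs w' + 2).
    assert (HK : 0 < K) by (assert (P1 := Rabs_pos u'); assert (P2 := Rabs_pos w'); unfold K; lra).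
    assert (He : 0 < eps / (2 * K)) by (apply Rdiv_lt_0_compat; lra).
    destruct (nonlinearity_small _ He) as [d [Hd HB]].
    destruct (Hu 1 Rlt_0_1) as [d1 Hd1]. destruct (Hw 1 Rlt_0_1) as [d2 Hd2].
    assert (HdK : 0 < d / K) by (apply Rdiv_lt_0_compat; assumption).
    exists (mkposreal _ (Rmin_pos _ _ HdK (Rmin_pos _ _ (cond_pos d1) (cond_pos d2)))). simpl.
    intros h Hh0 Hh.
    assert (Hh1 : Rabs h < d / K) by (eapply Rlt_le_trans; [exact Hh | apply Rmin_l]).
    assert (Hh2 : Rabs h < d1).
    { eapply Rlt_le_trans; [exact Hh |]. eapply Rle_trans; [apply Rmin_r | apply Rmin_l]. }
    assert (Hh3 : Rabs h < d2).
    { eapply Rlt_le_trans; [exact Hh |]. eapply Rle_trans; [apply Rmin_r | apply Rmin_r]. }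
    specialize (Hd1 h Hh0 Hh2). specialize (Hd2 h Hh0 Hh3).
    rewrite Eu, Rminus_0_r in Hd1. rewrite Ew, Rminus_0_r in Hd2.
    assert (Hah : 0 < Rabs h) by (apply Rabs_pos_lt, Hh0).
    assert (lin : forall y y', Rabs (y / h - y') < 1 -> Rabs y <= (Rabs y' + 1) * Rabs h).
    { intros y y' Hy. replace y with ((y / h - y' + y') * h) by (field; exact Hh0).
      rewrite Rabs_mult. apply Rmult_le_compat_r; [lra|].
      eapply Rle_trans; [apply Rabs_triang|]. lra. }
    apply lin in Hd1. apply lin in Hd2.
    assert (Hm : Cmod (u (s0 + h), w (s0 + h)) <= K * Rabs h).
    { replace ((u (s0 + h), w (s0 + h)) : CC)
        with (Cplus (RtoC (u (s0 + h))) (Cmult Ci (RtoC (w (s0 + h))))).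
      2:{ unfold Cplus, Cmult, Ci, RtoC; simpl. f_equal; ring. }
      eapply Rle_trans; [apply Cmod_triangle|]. rewrite Cmod_mult, !Cmod_R.
      replace (Cmod Ci) with 1.
      2:{ unfold Cmod, Ci; simpl. replace (0 * (0 * 1) + 1 * (1 * 1)) with 1 by ring. symmetry; apply sqrt_1. }
      unfold K. lra. }
    assert (Hmd : Cmod (u (s0 + h), w (s0 + h)) < d).
    { eapply Rle_lt_trans; [exact Hm|]. apply Rmult_lt_reg_r with (/ K); [apply Rinv_0_lt_compat, HK|].
      replace (K * Rabs h * / K) with (Rabs h) by (field; lra). exact Hh1. }
    destruct (HB _ Hmd) as [B _].
    replace (Ga_pair (u s0, w s0)) with 0.
    2:{ symmetry. apply Ga_pair_zero, E. }
    rewrite !Rminus_0_r. unfold Rdiv at 1. rewrite Rabs_mult, Rabs_inv.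
    apply Rmult_lt_reg_r with (Rabs h); [exact Hah|].
    rewrite Rmult_assoc, Rinv_l, Rmult_1_r by lra.
    eapply Rle_lt_trans; [exact B|].
    apply Rle_lt_trans with (eps / (2 * K) * (K * Rabs h)).
    + apply Rmult_le_compat_l; lra.
    + replace (eps / (2 * K) * (K * Rabs h)) with (eps * Rabs h / 2) by (field; lra). nra.
  - rewrite GapPsi_nonzero by exact E. cbv [fst snd].
    apply is_derive_ext with (f := fun s => / a ^ 5 * G1 (a ^ 3 * (u s ^ 2 + w s ^ 2))).
    { intros s. unfold Ga_pair, Ga. rewrite Cmod_sq. reflexivity. }
    assert (Hin : is_derive (fun s => a ^ 3 * (u s ^ 2 + w s ^ 2)) s0
      (a ^ 3 * (2 * u s0 * u' + 2 * w s0 * w'))).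
    { auto_derive.
      - repeat split; eexists; eassumption.
      - assert (Ed : forall (f : R -> R) l, is_derive f s0 l -> Derive (fun y : R => f y) s0 = l).
        { intros f l H. exact (is_derive_unique _ _ _ H). }
        rewrite (Ed _ _ Hu), (Ed _ _ Hw). ring. }
    assert (Hpos := scaled_pos _ E). rewrite Cmod_sq in Hpos.
    rewrite Cmod_sq.
    assert (Hout := proj1 (proj2 HG) _ Hpos).
    eapply is_derive_eq.
    + apply is_derive_scal.
      apply (is_derive_comp (K := R_AbsRing) (V := R_NormedModule) G1 _ s0 _ _ Hout Hin).
    + unfold scal; simpl; unfold mult; simpl. field. lra.
Qed.

Lemma C1_on_nonlinearity U (u w : R -> R3 -> R) du dw : C1_on U u du -> C1_on U w dw ->
  C1_on U (fun t x => Ga G1 a (Cmod (u t x, w t x) ^ 2))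
    (fun i t x => 2 * (fst (GapPsi G1p a (u t x, w t x)) * du i t x
                       + snd (GapPsi G1p a (u t x, w t x)) * dw i t x)).
Proof.
  intros Hu Hw t x Hx. destruct (Hu t x Hx) as [Cu Du]. destruct (Hw t x Hx) as [Cw Dw].
  assert (Cp := continuous_pair _ _ _ Cu Cw).
  split.
  - apply (continuous_comp _ Ga_pair (t, x) Cp (continuous_Ga_pair _)).
  - intros i Hi. destruct (Du i Hi) as [D1 K1]. destruct (Dw i Hi) as [D2 K2]. split.
    + assert (D := is_derive_Ga_pair _ _ _ _ _ D1 D2). rewrite !slice_coord in D.
      revert D. apply is_derive_ext. intros s. destruct i as [|[|[|i]]]; reflexivity.
    + destruct (continuous_GapPsi (u t x, w t x)) as [G2 G3].
      assert (L1 := continuous_comp _ (fun p : R * R => fst (GapPsi G1p a p)) (t, x) Cp G2).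
      assert (L2 := continuous_comp _ (fun p : R * R => snd (GapPsi G1p a p)) (t, x) Cp G3).
      apply cont_mult; [apply continuous_const|]. apply cont_plus; apply cont_mult; assumption.
Qed.

End Nonlinearity.

(** * The Klein-Gordon balance laws *)

Definition re (f : R -> R3 -> CC) (t : R) (x : R3) : R := fst (f t x).
Definition im (f : R -> R3 -> CC) (t : R) (x : R3) : R := snd (f t x).

Lemma Cmod_sq_re_im (f : R -> R3 -> CC) t x : Cmod (f t x) ^ 2 = re f t x ^ 2 + im f t x ^ 2.
Proof. unfold re, im. rewrite <- Cmod_sq, <- surjective_pairing. reflexivity. Qed.

(** * From the Euclidean regularity hypotheses to coordinates *)

Lemma norm3_le x : norm3 x <= Rabs (c1 x) + Rabs (c2 x) + Rabs (c3 x).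
Proof.
  unfold norm3, dot3.
  assert (H1 := Rabs_pos (c1 x)). assert (H2 := Rabs_pos (c2 x)). assert (H3 := Rabs_pos (c3 x)).
  rewrite <- (sqrt_square (Rabs (c1 x) + Rabs (c2 x) + Rabs (c3 x))) by lra.
  apply sqrt_le_1_alt.
  assert (E : forall y, y * y = Rabs y * Rabs y).
  { intros y. rewrite <- Rabs_mult. symmetry. apply Rabs_pos_eq. nra. }
  rewrite (E (c1 x)), (E (c2 x)), (E (c3 x)). nra.
Qed.

Lemma coord_le_norm3 x : Rabs (c1 x) <= norm3 x /\ Rabs (c2 x) <= norm3 x /\ Rabs (c3 x) <= norm3 x.
Proof.
  unfold norm3, dot3. rewrite <- !sqrt_Rsqr_abs. unfold Rsqr.
  repeat split; apply sqrt_le_1_alt; nra.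
Qed.

Lemma locally_norm3 (P : R -> R3 -> Prop) t x del : 0 < del ->
  (forall s y, Rabs (s - t) < del -> norm3 (sub3 y x) < del -> P s y) ->
  locally (t, x) (fun p : R * (R * R * R) => P (fst p) (snd p)).
Proof.
  (* Each coordinate gets a third, as [norm3_le] bounds the norm by the sum of the three. *)
  intros Hd H. assert (Hd3 : 0 < del / 3) by lra. exists (mkposreal _ Hd3).
  destruct x as [[x1 x2] x3]. intros [s [[y1 y2] y3]] [B0 [[B1 B2] B3]].
  change (Rabs (s - t) < del / 3) in B0. change (Rabs (y1 - x1) < del / 3) in B1.
  change (Rabs (y2 - x2) < del / 3) in B2. change (Rabs (y3 - x3) < del / 3) in B3.
  apply H; [simpl; lra|]. eapply Rle_lt_trans; [apply norm3_le|].
  unfold sub3, c1, c2, c3; simpl. lra.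
Qed.

Lemma openST_open4 U : openST U -> open4 U.
Proof.
  intros H [t x] Hx. destruct (H t x Hx) as [d [Hd HU]]. apply (locally_norm3 U t x d Hd HU).
Qed.

Lemma contST_cont4 f t x : contST f t x -> cont4 (re f) t x /\ cont4 (im f) t x.
Proof.
  intros H. split; apply filterlim_locally; intros eps;
    destruct (H eps (cond_pos eps)) as [d [Hd HU]].
  - apply (locally_norm3 (fun s y => Rabs (re f s y - re f t x) < eps) t x d Hd).
    intros s y H1 H2. eapply Rle_lt_trans; [|apply (HU s y H1 H2)].
    eapply Rle_trans; [|apply Rmax_Cmod]. apply Rmax_l.
  - apply (locally_norm3 (fun s y => Rabs (im f s y - im f t x) < eps) t x d Hd).
    intros s y H1 H2. eapply Rle_lt_trans; [|apply (HU s y H1 H2)].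
    eapply Rle_trans; [|apply Rmax_Cmod]. apply Rmax_r.
Qed.

(** [line] takes absolute time for index 0 but a displacement for a space index; the shift by
    [coord] and [at_pt] aligns the two conventions. [pi] stands for the real or the imaginary
    part. *)
Lemma slice_line (pi : CC -> R) i f t x s : (i < 4)%nat ->
  slice i (fun t x => pi (f t x)) t x s = pi (line i f t x (s - coord i t x + at_pt i t)).
Proof.
  intros Hi. destruct x as [[x1 x2] x3]. destruct i as [|[|[|[|i]]]]; [| | | |lia];
    unfold line, slice, coord, at_pt, add3, scal3, e3, c1, c2, c3; simpl;
    f_equal; f_equal; repeat f_equal; ring.
Qed.

Lemma is_derive_slice (pi : CC -> R) i f t x l : (i < 4)%nat ->
  is_derive (fun s => pi (line i f t x s)) (at_pt i t) l ->
  is_derive (slice i (fun t x => pi (f t x)) t x) (coord i t x) l.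
Proof.
  intros Hi H. apply is_derive_ext with (f := fun s => pi (line i f t x (s - coord i t x + at_pt i t))).
  { intros s. symmetry. apply slice_line, Hi. }
  rewrite <- (Rmult_1_l l).
  apply (is_derive_comp (K := R_AbsRing) (V := R_NormedModule) (fun s => pi (line i f t x s))).
  - replace (coord i t x - coord i t x + at_pt i t) with (at_pt i t) by ring. exact H.
  - auto_derive; [exact I | ring].
Qed.

Lemma is_derive_line (pi : CC -> R) i f t x l : (i < 4)%nat ->
  is_derive (slice i (fun t x => pi (f t x)) t x) (coord i t x) l ->
  is_derive (fun s => pi (line i f t x s)) (at_pt i t) l.
Proof.
  intros Hi H.
  apply is_derive_ext with
    (f := fun s => slice i (fun t x => pi (f t x)) t x (s - at_pt i t + coord i t x)).
  { intros s. rewrite slice_line by exact Hi. f_equal. f_equal. ring. }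
  rewrite <- (Rmult_1_l l).
  apply (is_derive_comp (K := R_AbsRing) (V := R_NormedModule) (slice i (fun t x => pi (f t x)) t x)).
  - replace (at_pt i t - at_pt i t + coord i t x) with (coord i t x) by ring. exact H.
  - auto_derive; [exact I | ring].
Qed.

Lemma C1_on_re_im U f :
  (forall t x, U t x -> contST f t x /\ forall i, (i < 4)%nat ->
     ex_partial i f t x /\ contST (partial i f) t x) ->
  C1_on U (re f) (fun i => re (partial i f)) /\ C1_on U (im f) (fun i => im (partial i f)).
Proof.
  intros H. split; intros t x Hx; destruct (H t x Hx) as [Hc Hp]; split.
  - exact (proj1 (contST_cont4 _ _ _ Hc)).
  - intros i Hi. destruct (Hp i Hi) as [[E1 E2] Cp]. split.
    + apply (is_derive_slice fst i f t x _ Hi). apply Derive_correct, E1.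
    + exact (proj1 (contST_cont4 _ _ _ Cp)).
  - exact (proj2 (contST_cont4 _ _ _ Hc)).
  - intros i Hi. destruct (Hp i Hi) as [[E1 E2] Cp]. split.
    + apply (is_derive_slice snd i f t x _ Hi). apply Derive_correct, E2.
    + exact (proj2 (contST_cont4 _ _ _ Cp)).
Qed.

Lemma C2_on_C1 S f : C2_on S f -> exists U, open4 U /\ (forall t x, S t x -> U t x) /\
  C1_on U (re f) (fun i => re (partial i f)) /\ C1_on U (im f) (fun i => im (partial i f)) /\
  forall i, (i < 4)%nat ->
    C1_on U (re (partial i f)) (fun j => re (partial j (partial i f))) /\
    C1_on U (im (partial i f)) (fun j => im (partial j (partial i f))).
Proof.
  intros [U [HU [HS H]]]. exists U. split; [apply openST_open4, HU|]. split; [exact HS|].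
  assert (H1 := C1_on_re_im U f). destruct H1 as [H1 H2].
  { intros t x Hx. destruct (H t x Hx) as [Hc Hp]. split; [exact Hc|].
    intros i Hi. destruct (Hp i Hi) as [E1 [E2 _]]. split; assumption. }
  split; [exact H1|]. split; [exact H2|]. intros i Hi.
  apply (C1_on_re_im U (partial i f)). intros t x Hx. destruct (H t x Hx) as [_ Hp].
  destruct (Hp i Hi) as [_ [E2 E3]]. split; assumption.
Qed.

(** Builds the derivative family from the structure of the function, as an unknown; [C1_ext] then
    exchanges it for the hand-written family, equal to it by algebra. *)
Ltac c1_step :=
  match goal with
  | H : C1_on ?U ?F _ |- C1_on ?U ?F _ => exact H
  | H : C1_on ?U ?F _ |- C1_on ?U (fun t x => ?F t x) _ => exact H
  | |- C1_on ?U (fun _ _ => ?k) _ => exact (C1_const U k)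
  | |- C1_on ?U (fun t x => @?F t x + @?G t x) _ => eapply (C1_plus U F _ G _)
  | |- C1_on ?U (fun t x => @?F t x * @?G t x) _ => eapply (C1_mult U F _ G _)
  end.

(** * Local conservation laws in real and imaginary parts *)

Section Fields.
Context (c m q chi a : R) (G1 G1p G1pp : R -> R) (phi : R -> R3 -> R) (psi : R -> R3 -> CC).
Context (U : R -> R3 -> Prop).
Context (Hc : 0 < c) (Hm : 0 < m) (Hchi : 0 < chi) (Ha : 0 < a) (HG : G1_hyp G1 G1p G1pp).

Definition dphi (i : nat) : R -> R3 -> R := re (partial i (realF phi)).
Let u : R -> R3 -> R := re psi.
Let w : R -> R3 -> R := im psi.
Let du (i : nat) : R -> R3 -> R := re (partial i psi).
Let dw (i : nat) : R -> R3 -> R := im (partial i psi).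
Let ddu (i j : nat) : R -> R3 -> R := re (partial j (partial i psi)).
Let ddw (i j : nat) : R -> R3 -> R := im (partial j (partial i psi)).

Context (HU : open4 U) (Hphi : C1_on U phi dphi).
Context (Hu : C1_on U u du) (Hw : C1_on U w dw).
Context (Hdu : forall i, (i < 4)%nat -> C1_on U (du i) (ddu i)).
Context (Hdw : forall i, (i < 4)%nat -> C1_on U (dw i) (ddw i)).

Definition covr (t : R) (x : R3) : R := du 0 t x + - (q / chi) * (phi t x * w t x).
Definition covi (t : R) (x : R3) : R := dw 0 t x + q / chi * (phi t x * u t x).
Let dcovr (i : nat) (t : R) (x : R3) : R :=
  ddu 0 i t x + - (q / chi) * (dphi i t x * w t x + phi t x * dw i t x).
Let dcovi (i : nat) (t : R) (x : R3) : R :=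
  ddw 0 i t x + q / chi * (dphi i t x * u t x + phi t x * du i t x).

Lemma covt_pair t x : covt q chi phi psi t x = (covr t x, covi t x).
Proof.
  unfold covt, covr, covi, u, w, du, dw, re, im, Cplus, Cmult, Ci, RtoC; simpl.
  f_equal; unfold Rdiv; ring.
Qed.

Let Gu (t : R) (x : R3) : R := fst (GapPsi G1p a (u t x, w t x)).
Let Gw (t : R) (x : R3) : R := snd (GapPsi G1p a (u t x, w t x)).
Let h (t : R) (x : R3) : R := Ga G1 a (Cmod (u t x, w t x) ^ 2).

(** The field S of the energy law, chi^2/m times Re(conj(d_k psi) covt psi), which is minus the
    usual energy flux. [current] is J, that is chi q/m times Im(conj(psi) d_k psi). *)
Definition eflux (k : nat) (t : R) (x : R3) : R :=
  chi ^ 2 / m * (du k t x * covr t x + dw k t x * covi t x).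
Definition current (k : nat) (t : R) (x : R3) : R :=
  chi * q / m * (u t x * dw k t x + - 1 * (w t x * du k t x)).

Let deflux (k i : nat) (t : R) (x : R3) : R :=
  chi ^ 2 / m * (ddu k i t x * covr t x + du k t x * dcovr i t x
                 + (ddw k i t x * covi t x + dw k t x * dcovi i t x)).
Let dcurrent (k i : nat) (t : R) (x : R3) : R :=
  chi * q / m * (du i t x * dw k t x + u t x * ddw k i t x
                 - (dw i t x * du k t x + w t x * ddu k i t x)).
Let drho (i : nat) (t : R) (x : R3) : R :=
  - (chi * q / (m * c ^ 2)) * (du i t x * covi t x + u t x * dcovi i t x
                 - (dw i t x * covr t x + w t x * dcovr i t x)).
Let denergy (i : nat) (t : R) (x : R3) : R :=
  chi ^ 2 / m * ((covr t x * dcovr i t x + covi t x * dcovi i t x) / c ^ 2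
    + (du 1 t x * ddu 1 i t x + dw 1 t x * ddw 1 i t x
       + (du 2 t x * ddu 2 i t x + dw 2 t x * ddw 2 i t x)
       + (du 3 t x * ddu 3 i t x + dw 3 t x * ddw 3 i t x))
    + (Gu t x * du i t x + Gw t x * dw i t x)
    + (m * c / chi) ^ 2 * (u t x * du i t x + w t x * dw i t x)).

Lemma C1_covr : C1_on U covr dcovr.
Proof.
  assert (H0 := Hdu 0 ltac:(lia)).
  eapply C1_ext with (F := covr); [exact HU | reflexivity | | unfold covr; repeat c1_step].
  intros i t x Hi Hx. unfold dcovr. ring.
Qed.

Lemma C1_covi : C1_on U covi dcovi.
Proof.
  assert (H0 := Hdw 0 ltac:(lia)).
  eapply C1_ext with (F := covi); [exact HU | reflexivity | | unfold covi; repeat c1_step].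
  intros i t x Hi Hx. unfold dcovi. ring.
Qed.

Lemma C1_eflux k : (k < 4)%nat -> C1_on U (eflux k) (deflux k).
Proof.
  intros Hk. assert (H1 := Hdu k Hk). assert (H2 := Hdw k Hk).
  assert (H3 := C1_covr). assert (H4 := C1_covi).
  eapply C1_ext with (F := eflux k); [exact HU | reflexivity | | unfold eflux; repeat c1_step].
  intros i t x Hi Hx. unfold deflux. ring.
Qed.

Lemma C1_current k : (k < 4)%nat -> C1_on U (current k) (dcurrent k).
Proof.
  intros Hk. assert (H1 := Hdu k Hk). assert (H2 := Hdw k Hk).
  eapply C1_ext with (F := current k); [exact HU | reflexivity | | unfold current; repeat c1_step].
  intros i t x Hi Hx. unfold dcurrent. ring.
Qed.

Lemma rho_real t x : rho c m q chi phi psi t x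
  = - (chi * q / (m * c ^ 2)) * (u t x * covi t x + - 1 * (w t x * covr t x)).
Proof.
  unfold rho. rewrite covt_pair. unfold Im, Cmult, Cconj, u, w, re, im; simpl. ring.
Qed.

Lemma energy_real t x : energy c m q G1 chi a phi psi t x
  = chi ^ 2 / (2 * m) * ((covr t x * covr t x + covi t x * covi t x) * / c ^ 2
    + (du 1 t x * du 1 t x + dw 1 t x * dw 1 t x + (du 2 t x * du 2 t x + dw 2 t x * dw 2 t x)
       + (du 3 t x * du 3 t x + dw 3 t x * dw 3 t x))
    + h t x + (m * c / chi) ^ 2 * (u t x * u t x + w t x * w t x)).
Proof.
  unfold energy, gradx_sq, h. rewrite covt_pair, !Cmod_sq.
  rewrite (Cmod_sq_re_im psi), !(Cmod_sq_re_im (partial _ psi)).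
  fold u w. unfold du, dw. unfold Rdiv. ring.
Qed.

Lemma C1_rho : C1_on U (rho c m q chi phi psi) drho.
Proof.
  assert (H3 := C1_covr). assert (H4 := C1_covi).
  eapply C1_ext with (F := fun t x => - (chi * q / (m * c ^ 2))
    * (u t x * covi t x + - 1 * (w t x * covr t x))); [exact HU | | | repeat c1_step].
  - intros t x _. symmetry. apply rho_real.
  - intros i t x Hi Hx. unfold drho. ring.
Qed.

Lemma C1_energy : C1_on U (energy c m q G1 chi a phi psi) denergy.
Proof.
  assert (H3 := C1_covr). assert (H4 := C1_covi).
  assert (H1u := Hdu 1 ltac:(lia)). assert (H2u := Hdu 2 ltac:(lia)). assert (H3u := Hdu 3 ltac:(lia)).
  assert (H1w := Hdw 1 ltac:(lia)). assert (H2w := Hdw 2 ltac:(lia)). assert (H3w := Hdw 3 ltac:(lia)).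
  assert (Hh := C1_on_nonlinearity G1 G1p G1pp a HG Ha U u w du dw Hu Hw). fold h in Hh.
  eapply C1_ext; [exact HU | intros t x _; symmetry; apply energy_real | | repeat c1_step].
  intros i t x Hi Hx. unfold denergy, Gu, Gw, Rdiv. field. split; lra.
Qed.

(** Gauge invariance: the nonlinear term is a real multiple of [psi]. It therefore drops out of the
    charge balance and of the terms with [phi] in the energy balance. *)
Lemma GapPsi_parallel t x : Gu t x * w t x = Gw t x * u t x.
Proof.
  unfold Gu, Gw, GapPsi. destruct (Req_EM_T _ 0); unfold RtoC, Cmult; simpl; ring.
Qed.

(** The left-hand sides are the real and imaginary parts of the second covariant time derivative. In
    this form the equation eliminates [dcovr 0] and [dcovi 0] from the balance laws. *)
Lemma KG_real t x : U t x -> KG_at c m q G1p chi a phi psi t x ->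
  dcovr 0 t x - q / chi * phi t x * covi t x
    = c ^ 2 * (ddu 1 1 t x + ddu 2 2 t x + ddu 3 3 t x - Gu t x - (m * c / chi) ^ 2 * u t x) /\
  dcovi 0 t x + q / chi * phi t x * covr t x
    = c ^ 2 * (ddw 1 1 t x + ddw 2 2 t x + ddw 3 3 t x - Gw t x - (m * c / chi) ^ 2 * w t x).
Proof.
  intros Hx HK. unfold KG_at in HK.
  assert (E0 : covt q chi phi (covt q chi phi psi) t x
    = (dcovr 0 t x - q / chi * phi t x * covi t x, dcovi 0 t x + q / chi * phi t x * covr t x)).
  { unfold covt at 1. rewrite covt_pair.
    assert (P0 : partial 0 (covt q chi phi psi) t x = (dcovr 0 t x, dcovi 0 t x)).
    { unfold partial, DerC, line, at_pt. f_equal; apply is_derive_unique.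
      - apply is_derive_ext with (f := fun s => covr s x).
        + intros s. rewrite covt_pair. reflexivity.
        + apply (proj2 (C1_covr t x Hx) 0%nat). lia.
      - apply is_derive_ext with (f := fun s => covi s x).
        + intros s. rewrite covt_pair. reflexivity.
        + apply (proj2 (C1_covi t x Hx) 0%nat). lia. }
    rewrite P0. unfold Cplus, Cmult, Ci, RtoC; simpl. f_equal; unfold Rdiv; ring. }
  rewrite E0 in HK. clear E0.
  replace (GapPsi G1p a (psi t x)) with (Gu t x, Gw t x) in HK.
  2:{ unfold Gu, Gw, u, w, re, im. rewrite <- !surjective_pairing. reflexivity. }
  unfold Lap, Cplus, Cmult, Copp, RtoC in HK. simpl in HK.
  set (X := dcovr 0 t x - q / chi * phi t x * covi t x) in *.
  set (Y := dcovi 0 t x + q / chi * phi t x * covr t x) in *.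
  injection HK as H1 H2.
  assert (Hc2 : c * (c * 1) <> 0) by nra.
  assert (F : forall Z V, / (c * (c * 1)) * Z = V -> Z = c ^ 2 * V).
  { intros Z V <-. simpl. field. lra. }
  split; apply F; unfold ddu, ddw, u, w, re, im, Rdiv in *; simpl; lra.
Qed.

Lemma mixed_partials t x k : U t x -> (0 < k < 4)%nat ->
  ddu k 0 t x = ddu 0 k t x /\ ddw k 0 t x = ddw 0 k t x.
Proof.
  intros Hx Hk. split; symmetry.
  - apply (C2_mixed U u du ddu t x k HU Hx Hk Hu Hdu).
  - apply (C2_mixed U w dw ddw t x k HU Hx Hk Hw Hdw).
Qed.

(** The force term comes from the commutator of d_k with the covariant time derivative, (i q / chi)
    (d_k phi) psi, paired with d_k psi. After the equation and the mixed partials are substituted, a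
    multiple of [phi] times [Gu w - Gw u] remains: [denergy] pairs the nonlinearity with d_t psi,
    the equation pairs it with covt psi. *)
Lemma energy_law t x : U t x -> KG_at c m q G1p chi a phi psi t x ->
  denergy 0 t x = deflux 1 1 t x + deflux 2 2 t x + deflux 3 3 t x
    + - (dphi 1 t x * current 1 t x + dphi 2 t x * current 2 t x + dphi 3 t x * current 3 t x).
Proof.
  intros Hx HK. destruct (KG_real t x Hx HK) as [K1 K2].
  destruct (mixed_partials t x 1 Hx ltac:(lia)) as [M1 N1].
  destruct (mixed_partials t x 2 Hx ltac:(lia)) as [M2 N2].
  destruct (mixed_partials t x 3 Hx ltac:(lia)) as [M3 N3].
  assert (HP := GapPsi_parallel t x).
  unfold denergy. rewrite M1, M2, M3, N1, N2, N3.
  set (X := dcovr 0 t x) in *. set (Y := dcovi 0 t x) in *.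
  assert (EX : X = q / chi * phi t x * covi t x
    + c ^ 2 * (ddu 1 1 t x + ddu 2 2 t x + ddu 3 3 t x - Gu t x - (m * c / chi) ^ 2 * u t x)) by lra.
  assert (EY : Y = - (q / chi * phi t x * covr t x)
    + c ^ 2 * (ddw 1 1 t x + ddw 2 2 t x + ddw 3 3 t x - Gw t x - (m * c / chi) ^ 2 * w t x)) by lra.
  rewrite EX, EY. unfold deflux, current, dcovr, dcovi, covr, covi.
  apply Rminus_diag_uniq.
  transitivity (chi ^ 2 / m * (q / chi) * phi t x * (Gu t x * w t x - Gw t x * u t x)).
  - field. repeat split; lra.
  - rewrite HP. ring.
Qed.

(** The imaginary part of conj(psi) times the equation: the mass term and the nonlinear term are in
    phase with [psi] and leave only the Laplacian, whose contribution is a divergence. *)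
Lemma charge_law t x : U t x -> KG_at c m q G1p chi a phi psi t x ->
  drho 0 t x = - (dcurrent 1 1 t x + dcurrent 2 2 t x + dcurrent 3 3 t x).
Proof.
  intros Hx HK. destruct (KG_real t x Hx HK) as [K1 K2].
  assert (HP := GapPsi_parallel t x).
  unfold drho.
  set (X := dcovr 0 t x) in *. set (Y := dcovi 0 t x) in *.
  assert (EX : X = q / chi * phi t x * covi t x
    + c ^ 2 * (ddu 1 1 t x + ddu 2 2 t x + ddu 3 3 t x - Gu t x - (m * c / chi) ^ 2 * u t x)) by lra.
  assert (EY : Y = - (q / chi * phi t x * covr t x)
    + c ^ 2 * (ddw 1 1 t x + ddw 2 2 t x + ddw 3 3 t x - Gw t x - (m * c / chi) ^ 2 * w t x)) by lra.
  rewrite EX, EY. unfold dcurrent, covr, covi.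
  apply Rminus_diag_uniq.
  transitivity (chi * q / m * (u t x * Gw t x - w t x * Gu t x)).
  - field. repeat split; lra.
  - replace (u t x * Gw t x - w t x * Gu t x) with (- (Gu t x * w t x - Gw t x * u t x)) by ring.
    rewrite HP. ring.
Qed.

Lemma C0_dens : C0_on U (dens c m G1 chi a psi).
Proof.
  intros t x Hx.
  assert (D : forall i, (i < 4)%nat -> cont4 (fun t x => Cmod (partial i psi t x) ^ 2) t x).
  { intros i Hi. destruct (Hdu i Hi t x Hx) as [C1 _]. destruct (Hdw i Hi t x Hx) as [C2 _].
    unfold cont4 in *.
    apply continuous_ext with (f := fun p : R * (R * R * R) =>
      du i (fst p) (snd p) * du i (fst p) (snd p) + dw i (fst p) (snd p) * dw i (fst p) (snd p)).
    - intros [s y]. simpl fst; simpl snd. unfold du, dw, re, im.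
      match goal with |- ?l = ?r => change (@eq R l r) end.
      rewrite Cmod_sq_re_im. unfold re, im. ring.
    - cont_auto. }
  assert (D0 := D 0%nat ltac:(lia)). assert (D1 := D 1%nat ltac:(lia)).
  assert (D2 := D 2%nat ltac:(lia)). assert (D3 := D 3%nat ltac:(lia)). clear D.
  assert (Hh := C1_on_nonlinearity G1 G1p G1pp a HG Ha U u w du dw Hu Hw t x Hx).
  destruct Hh as [Ch _]. destruct (Hu t x Hx) as [Cu _]. destruct (Hw t x Hx) as [Cw _].
  unfold cont4 in *.
  apply continuous_ext with (f := fun p : R * (R * R * R) =>
    (chi / (m * c)) * (chi / (m * c)) * (Cmod (partial 0 psi (fst p) (snd p)) ^ 2 * / c ^ 2
      + Cmod (partial 1 psi (fst p) (snd p)) ^ 2 + Cmod (partial 2 psi (fst p) (snd p)) ^ 2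
      + Cmod (partial 3 psi (fst p) (snd p)) ^ 2)
    + (chi / (m * c)) * (chi / (m * c)) * Rabs (Ga G1 a (Cmod (u (fst p) (snd p), w (fst p) (snd p)) ^ 2))
    + (u (fst p) (snd p) * u (fst p) (snd p) + w (fst p) (snd p) * w (fst p) (snd p))).
  - intros [s y]. simpl fst; simpl snd. unfold dens, grad0_sq, u, w, re, im.
    rewrite <- surjective_pairing.
    match goal with |- ?l = ?r => change (@eq R l r) end.
    set (N := Ga G1 a _). rewrite (Cmod_sq_re_im psi). unfold re, im, Rdiv. ring.
  - assert (CA := continuous_comp _ Rabs (t, x) Ch (continuous_Rabs _)).
    apply cont_plus; [apply cont_plus|];
      repeat first [exact CA | apply continuous_const | assumption | apply cont_plus | apply cont_mult].
Qed.

(** * Domination by the concentration density, uniformly in [chi] and [a] *)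

Context (C : R) (HC : 0 <= C).

(* [K1 * dens] dominates [chi^2 |covt psi|^2]. *)
Let K1 : R := 2 * (m ^ 2 * c ^ 4) + 2 * (q ^ 2 * C ^ 2).

(** The bounds for the energy, [eflux], [current] and [rho], in this order, added so that one
    constant serves all four. It involves only [c], [m], [q], [C], hence not [n]. *)
Definition dens_const : R :=
  (K1 / c ^ 2 + m ^ 2 * c ^ 2) / (2 * m) + (m ^ 2 * c ^ 2 + K1) / (2 * m)
  + Rabs q * (1 + m ^ 2 * c ^ 2) / (2 * m) + Rabs q * (1 + K1) / (2 * m * c ^ 2).

Let K1_nonneg : 0 <= K1.
Proof.
  unfold K1. assert (H1 : 0 <= m ^ 2 * c ^ 4) by (apply Rmult_le_pos; apply pow_le; lra).
  assert (H2 : 0 <= q ^ 2 * C ^ 2) by (apply Rmult_le_pos; apply pow2_ge_0). lra.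
Qed.

Lemma dens_real t x : m ^ 2 * c ^ 2 * dens c m G1 chi a psi t x
  = chi ^ 2 * (du 0 t x ^ 2 + dw 0 t x ^ 2) / c ^ 2 + chi ^ 2 * (du 1 t x ^ 2 + dw 1 t x ^ 2)
    + chi ^ 2 * (du 2 t x ^ 2 + dw 2 t x ^ 2) + chi ^ 2 * (du 3 t x ^ 2 + dw 3 t x ^ 2)
    + chi ^ 2 * Rabs (h t x) + m ^ 2 * c ^ 2 * (u t x ^ 2 + w t x ^ 2).
Proof.
  unfold dens, grad0_sq, h. rewrite !(Cmod_sq_re_im (partial _ psi)).
  replace (psi t x) with (u t x, w t x) by (symmetry; apply surjective_pairing).
  set (N := Ga G1 a _). rewrite Cmod_sq. unfold du, dw. field. lra.
Qed.

(** The factor chi^2 cancels the 1/chi of the gauge term: chi covt psi = chi d_t psi + i q phi psi.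
    The first part is controlled by the gradient term of the density, the second by |psi|^2 and the
    bound on [phi]. *)
Lemma dens_dominates t x : Rabs (phi t x) <= C ->
  let d := dens c m G1 chi a psi t x in
  0 <= d /\ u t x ^ 2 + w t x ^ 2 <= d /\
  chi ^ 2 * (covr t x ^ 2 + covi t x ^ 2) <= K1 * d /\
  chi ^ 2 * (du 1 t x ^ 2 + dw 1 t x ^ 2) + chi ^ 2 * (du 2 t x ^ 2 + dw 2 t x ^ 2)
   + chi ^ 2 * (du 3 t x ^ 2 + dw 3 t x ^ 2) + chi ^ 2 * Rabs (h t x)
   + m ^ 2 * c ^ 2 * (u t x ^ 2 + w t x ^ 2) <= m ^ 2 * c ^ 2 * d /\
  (forall k, (1 <= k < 4)%nat -> chi ^ 2 * (du k t x ^ 2 + dw k t x ^ 2) <= m ^ 2 * c ^ 2 * d).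
Proof.
  intros Hp d. assert (E := dens_real t x). fold d in E.
  assert (S : forall y z, 0 <= y ^ 2 + z ^ 2) by (intros; nra).
  assert (X : forall y z, 0 <= chi ^ 2 * (y ^ 2 + z ^ 2)).
  { intros. apply Rmult_le_pos; [apply pow2_ge_0 | apply S]. }
  assert (X0 := X (du 0 t x) (dw 0 t x)). assert (X1 := X (du 1 t x) (dw 1 t x)).
  assert (X2 := X (du 2 t x) (dw 2 t x)). assert (X3 := X (du 3 t x) (dw 3 t x)).
  assert (Hc2 : 0 < c ^ 2) by (apply pow_lt, Hc). assert (Hm2 : 0 < m ^ 2) by (apply pow_lt, Hm).
  assert (Hmc : 0 < m ^ 2 * c ^ 2) by (apply Rmult_lt_0_compat; assumption).
  assert (XN : 0 <= chi ^ 2 * Rabs (h t x)).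
  { apply Rmult_le_pos; [apply pow2_ge_0 | apply Rabs_pos]. }
  assert (XZ := S (u t x) (w t x)).
  assert (XZm : 0 <= m ^ 2 * c ^ 2 * (u t x ^ 2 + w t x ^ 2)) by (apply Rmult_le_pos; lra).
  assert (X0c : 0 <= chi ^ 2 * (du 0 t x ^ 2 + dw 0 t x ^ 2) / c ^ 2).
  { apply Rmult_le_pos; [exact X0 | apply Rlt_le, Rinv_0_lt_compat, Hc2]. }
  assert (Hd : 0 <= d).
  { apply Rmult_le_reg_l with (m ^ 2 * c ^ 2); [exact Hmc|]. rewrite Rmult_0_r, E. lra. }
  assert (HZ : u t x ^ 2 + w t x ^ 2 <= d).
  { apply Rmult_le_reg_l with (m ^ 2 * c ^ 2); [exact Hmc|]. rewrite E. lra. }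
  split; [exact Hd|]. split; [exact HZ|]. split; [|split].
  - assert (HX0 : chi ^ 2 * (du 0 t x ^ 2 + dw 0 t x ^ 2) <= m ^ 2 * c ^ 4 * d).
    { replace (m ^ 2 * c ^ 4 * d) with (m ^ 2 * c ^ 2 * d * c ^ 2) by ring.
      apply Rle_trans with (chi ^ 2 * (du 0 t x ^ 2 + dw 0 t x ^ 2) / c ^ 2 * c ^ 2).
      - right. field. lra.
      - apply Rmult_le_compat_r; lra. }
    assert (Hf : phi t x ^ 2 <= C ^ 2) by (apply pow_maj_Rabs, Hp).
    assert (HQ : q ^ 2 * (phi t x ^ 2 * (u t x ^ 2 + w t x ^ 2)) <= q ^ 2 * (C ^ 2 * d)).
    { apply Rmult_le_compat_l; [apply pow2_ge_0|].
      apply Rmult_le_compat; try lra. apply pow2_ge_0. }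
    assert (EP : chi ^ 2 * (covr t x ^ 2 + covi t x ^ 2)
      = (chi * du 0 t x - q * phi t x * w t x) ^ 2 + (chi * dw 0 t x + q * phi t x * u t x) ^ 2).
    { unfold covr, covi. field. lra. }
    rewrite EP. unfold K1.
    (* The squares with the opposite sign, for (x - y)^2 <= 2 x^2 + 2 y^2. *)
    assert (Y1 := pow2_ge_0 (chi * du 0 t x + q * phi t x * w t x)).
    assert (Y2 := pow2_ge_0 (chi * dw 0 t x - q * phi t x * u t x)).
    replace ((2 * (m ^ 2 * c ^ 4) + 2 * (q ^ 2 * C ^ 2)) * d)
      with (2 * (m ^ 2 * c ^ 4 * d) + 2 * (q ^ 2 * (C ^ 2 * d))) by ring.
    apply Rle_trans with (2 * (chi ^ 2 * (du 0 t x ^ 2 + dw 0 t x ^ 2))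
      + 2 * (q ^ 2 * (phi t x ^ 2 * (u t x ^ 2 + w t x ^ 2)))); [|lra].
    nra.
  - rewrite E. lra.
  - intros k Hk. assert (Ek : k = 1%nat \/ k = 2%nat \/ k = 3%nat) by lia.
    rewrite E. destruct Ek as [->|[->| ->]]; lra.
Qed.

(** Young's inequality. In [rho] and [current] the single factor chi goes, as [s], to the
    differentiated field; the other factor is [psi] itself. *)
Let product_bound p1 p2 p3 p4 s A B d : 0 <= s -> (p1 ^ 2 + p2 ^ 2) <= A * d ->
  s ^ 2 * (p3 ^ 2 + p4 ^ 2) <= B * d -> Rabs (s * (p1 * p3 + p2 * p4)) <= (A + B) / 2 * d.
Proof.
  intros Hs HA HB. apply Rabs_le.
  assert (Y1 := pow2_ge_0 (p1 + s * p3)). assert (Y2 := pow2_ge_0 (p2 + s * p4)).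
  assert (Y3 := pow2_ge_0 (p1 - s * p3)). assert (Y4 := pow2_ge_0 (p2 - s * p4)).
  split; nra.
Qed.

Lemma density_bounds t x : Rabs (phi t x) <= C ->
  let d := dens c m G1 chi a psi t x in
  Rabs (energy c m q G1 chi a phi psi t x) <= dens_const * d /\
  Rabs (rho c m q chi phi psi t x) <= dens_const * d /\
  forall k, (1 <= k < 4)%nat ->
    Rabs (eflux k t x) <= dens_const * d /\ Rabs (current k t x) <= dens_const * d.
Proof.
  intros Hp d. assert (HD := dens_dominates t x Hp). cbv zeta in HD. fold d in HD.
  destruct HD as [Hd [HZ [HP [HS Hk]]]].
  assert (Hc2 : 0 < c ^ 2) by (apply pow_lt, Hc). assert (Hm2 : 0 < m ^ 2) by (apply pow_lt, Hm).
  assert (Hmc : 0 < m ^ 2 * c ^ 2) by (apply Rmult_lt_0_compat; assumption).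
  assert (Hq := Rabs_pos q).
  set (B1 := (K1 / c ^ 2 + m ^ 2 * c ^ 2) / (2 * m)). set (B2 := (m ^ 2 * c ^ 2 + K1) / (2 * m)).
  set (B3 := Rabs q * (1 + m ^ 2 * c ^ 2) / (2 * m)). set (B4 := Rabs q * (1 + K1) / (2 * m * c ^ 2)).
  assert (I2m : 0 < / (2 * m)) by (apply Rinv_0_lt_compat; lra).
  assert (I2mc : 0 < / (2 * m * c ^ 2)) by (apply Rinv_0_lt_compat; nra).
  assert (Ic2 : 0 < / c ^ 2) by (apply Rinv_0_lt_compat, Hc2).
  assert (P1 : 0 <= B1).
  { apply Rmult_le_pos; [|lra]. assert (0 <= K1 / c ^ 2) by (apply Rmult_le_pos; lra). lra. }
  assert (P2 : 0 <= B2) by (apply Rmult_le_pos; lra).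
  assert (P3 : 0 <= B3) by (apply Rmult_le_pos; [apply Rmult_le_pos|]; lra).
  assert (P4 : 0 <= B4) by (apply Rmult_le_pos; [apply Rmult_le_pos|]; lra).
  change dens_const with (B1 + B2 + B3 + B4).
  assert (Q1 := Rmult_le_pos _ _ P1 Hd). assert (Q2 := Rmult_le_pos _ _ P2 Hd).
  assert (Q3 := Rmult_le_pos _ _ P3 Hd). assert (Q4 := Rmult_le_pos _ _ P4 Hd).
  split; [|split].
  - apply Rle_trans with (B1 * d); [|lra].
    rewrite energy_real.
    replace (chi ^ 2 / (2 * m) * _) with (/ (2 * m) * (chi ^ 2 * (covr t x ^ 2 + covi t x ^ 2) * / c ^ 2
      + (chi ^ 2 * (du 1 t x ^ 2 + dw 1 t x ^ 2) + chi ^ 2 * (du 2 t x ^ 2 + dw 2 t x ^ 2)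
         + chi ^ 2 * (du 3 t x ^ 2 + dw 3 t x ^ 2) + chi ^ 2 * h t x
         + m ^ 2 * c ^ 2 * (u t x ^ 2 + w t x ^ 2)))) by (field; lra).
    replace (B1 * d) with (/ (2 * m) * (K1 * d * / c ^ 2 + m ^ 2 * c ^ 2 * d)) by (unfold B1; field; lra).
    rewrite Rabs_mult, (Rabs_pos_eq (/ (2 * m))) by lra. apply Rmult_le_compat_l; [lra|].
    assert (S : forall y z, 0 <= y ^ 2 + z ^ 2) by (intros; nra).
    assert (X : forall y z, 0 <= chi ^ 2 * (y ^ 2 + z ^ 2)).
    { intros. apply Rmult_le_pos; [apply pow2_ge_0 | apply S]. }
    assert (X0 := X (covr t x) (covi t x)). assert (X1 := X (du 1 t x) (dw 1 t x)).
    assert (X2 := X (du 2 t x) (dw 2 t x)). assert (X3 := X (du 3 t x) (dw 3 t x)).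
    assert (XZ : 0 <= m ^ 2 * c ^ 2 * (u t x ^ 2 + w t x ^ 2)).
    { apply Rmult_le_pos; [lra | apply S]. }
    assert (XP : 0 <= chi ^ 2 * (covr t x ^ 2 + covi t x ^ 2) * / c ^ 2) by (apply Rmult_le_pos; lra).
    assert (XP' : chi ^ 2 * (covr t x ^ 2 + covi t x ^ 2) * / c ^ 2 <= K1 * d * / c ^ 2)
      by (apply Rmult_le_compat_r; lra).
    assert (Xh : - (chi ^ 2 * Rabs (h t x)) <= chi ^ 2 * h t x <= chi ^ 2 * Rabs (h t x)).
    { assert (Y := pow2_ge_0 chi). assert (Y1 := Rle_abs (h t x)).
      assert (Y2 := Rle_abs (- h t x)). rewrite Rabs_Ropp in Y2. split; nra. }
    apply Rabs_le. lra.
  - apply Rle_trans with (B4 * d); [|lra].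
    rewrite rho_real.
    replace (- (chi * q / (m * c ^ 2)) * _) with (- (q / (m * c ^ 2))
      * (chi * (u t x * covi t x + - w t x * covr t x))) by (field; lra).
    rewrite Rabs_mult, Rabs_Ropp.
    replace (B4 * d) with (Rabs q / (m * c ^ 2) * ((1 + K1) / 2 * d)) by (unfold B4; field; lra).
    unfold Rdiv at 1. rewrite Rabs_mult, (Rabs_pos_eq (/ (m * c ^ 2))).
    2:{ apply Rlt_le, Rinv_0_lt_compat, Rmult_lt_0_compat; assumption. }
    apply Rmult_le_compat_l.
    { apply Rmult_le_pos; [exact Hq|]. apply Rlt_le, Rinv_0_lt_compat, Rmult_lt_0_compat; assumption. }
    apply product_bound; [lra | |].
    + replace ((- w t x) ^ 2) with (w t x ^ 2) by ring. lra.
    + rewrite (Rplus_comm (covi t x ^ 2)). exact HP.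
  - intros k Hk'. specialize (Hk k Hk'). split.
    + apply Rle_trans with (B2 * d); [|lra]. unfold eflux.
      (* One factor chi for each of the two derivatives, hence [s] = 1 in [product_bound]. *)
      replace (chi ^ 2 / m * _) with (/ m * (1 * (chi * du k t x * (chi * covr t x)
        + chi * dw k t x * (chi * covi t x)))) by (field; lra).
      assert (Im : 0 < / m) by (apply Rinv_0_lt_compat, Hm).
      rewrite Rabs_mult, (Rabs_pos_eq (/ m)) by lra.
      replace (B2 * d) with (/ m * ((m ^ 2 * c ^ 2 + K1) / 2 * d)) by (unfold B2; field; lra).
      apply Rmult_le_compat_l; [lra|]. apply product_bound; [lra | |].
      * replace ((chi * du k t x) ^ 2 + (chi * dw k t x) ^ 2)
          with (chi ^ 2 * (du k t x ^ 2 + dw k t x ^ 2)) by ring. exact Hk.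
      * replace (1 ^ 2 * ((chi * covr t x) ^ 2 + (chi * covi t x) ^ 2))
          with (chi ^ 2 * (covr t x ^ 2 + covi t x ^ 2)) by ring. exact HP.
    + apply Rle_trans with (B3 * d); [|lra]. unfold current.
      replace (chi * q / m * _) with (q * / m * (chi * (u t x * dw k t x + - w t x * du k t x)))
        by (field; lra).
      assert (Im : 0 < / m) by (apply Rinv_0_lt_compat, Hm).
      rewrite Rabs_mult, Rabs_mult, (Rabs_pos_eq (/ m)) by lra.
      replace (B3 * d) with (Rabs q * / m * ((1 + m ^ 2 * c ^ 2) / 2 * d)) by (unfold B3; field; lra).
      apply Rmult_le_compat_l; [apply Rmult_le_pos; lra|]. apply product_bound; [lra | |].
      * replace ((- w t x) ^ 2) with (w t x ^ 2) by ring. lra.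
      * rewrite (Rplus_comm (dw k t x ^ 2)). exact Hk.
Qed.

Lemma dens_const_nonneg : 0 <= dens_const.
Proof.
  assert (Hc2 : 0 < c ^ 2) by (apply pow_lt, Hc).
  assert (Hmc : 0 <= m ^ 2 * c ^ 2) by (apply Rmult_le_pos; apply pow2_ge_0).
  assert (Hq := Rabs_pos q). assert (HK := K1_nonneg).
  assert (I2m : 0 < / (2 * m)) by (apply Rinv_0_lt_compat; lra).
  assert (I2mc : 0 < / (2 * m * c ^ 2)) by (apply Rinv_0_lt_compat; nra).
  assert (Ic2 : 0 < / c ^ 2) by (apply Rinv_0_lt_compat, Hc2).
  assert (0 <= K1 / c ^ 2) by (apply Rmult_le_pos; lra).
  unfold dens_const, Rdiv in *. repeat apply Rplus_le_le_0_compat;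
    repeat apply Rmult_le_pos; lra.
Qed.

(** * Energy, charge and dipole moment of the moving ball *)

Context (rh v : R -> R3) (rad : R).
Context (Hrh : diff_traj rh v) (Hv : cont_curve v) (Hrad : 0 <= rad).

Definition comp (k : nat) (x : R3) : R :=
  match k with 1%nat => c1 x | 2%nat => c2 x | _ => c3 x end.
Definition shift (k : nat) (t : R) (x : R3) : R := comp k x + - comp k (rh t).
Let dshift (k i : nat) (t : R) (_ : R3) : R :=
  match i with 0%nat => - comp k (v t) | S _ => if Nat.eqb i k then 1 else 0 end.

Definition dipole (k : nat) (t : R) : R :=
  ball_int (fun x => shift k t x * rho c m q chi phi psi t x) (rh t) rad.

Lemma C1_shift k : (1 <= k < 4)%nat -> C1_on U (shift k) (dshift k).
Proof.
  intros Hk t x _. assert (Ek : k = 1%nat \/ k = 2%nat \/ k = 3%nat) by lia.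
  destruct (diff_traj_cont rh v Hrh t) as [R1 [R2 R3']]. destruct (Hv t) as [V1 [V2 V3]].
  destruct (Hrh t) as [D1 [D2 D3]].
  assert (Kt : continuous (fun p : R * (R * R * R) => fst p) (t, x)).
  { apply (continuous_fst (U := R_UniformSpace) (V := prod_UniformSpace (prod_UniformSpace
      R_UniformSpace R_UniformSpace) R_UniformSpace)). }
  assert (Kx : continuous (fun p : R * (R * R * R) => snd p) (t, x)).
  { apply (continuous_snd (U := R_UniformSpace) (V := prod_UniformSpace (prod_UniformSpace
      R_UniformSpace R_UniformSpace) R_UniformSpace)). }
  assert (Cr : continuous (fun s => comp k (rh s)) t) by (destruct Ek as [->|[->| ->]]; assumption).
  assert (Cv : continuous (fun s => comp k (v s)) t) by (destruct Ek as [->|[->| ->]]; assumption).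
  assert (Cr' := continuous_comp _ (fun s => comp k (rh s)) (t, x) Kt Cr).
  assert (Cv' := continuous_comp _ (fun s => comp k (v s)) (t, x) Kt Cv).
  assert (Cx : continuous (fun p : R * (R * R * R) => comp k (snd p)) (t, x)).
  { destruct Ek as [->|[->| ->]]; unfold comp, c1, c2, c3.
    - apply (cont_fst (fun p : R * (R * R * R) => fst (snd p))).
      apply (cont_fst (fun p : R * (R * R * R) => snd p) (t, x) Kx).
    - apply (cont_snd (fun p : R * (R * R * R) => fst (snd p))).
      apply (cont_fst (fun p : R * (R * R * R) => snd p) (t, x) Kx).
    - apply (cont_snd (fun p : R * (R * R * R) => snd p) (t, x) Kx). }
  split.
  - unfold cont4, shift. apply cont_plus; [exact Cx | apply cont_opp, Cr'].
  - intros i Hi. split.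
    + destruct x as [[x1 x2] x3]. unfold dshift.
      destruct i as [|[|[|[|i]]]]; [| | | |lia].
      * apply is_derive_ext with (f := fun s => comp k (x1, x2, x3) + - comp k (rh s)); [reflexivity|].
        rewrite <- (Rplus_0_l (- comp k (v t))).
        apply (is_derive_plus (K := R_AbsRing) (V := R_NormedModule)).
        -- apply (is_derive_const (K := R_AbsRing) (V := R_NormedModule)).
        -- apply (is_derive_opp (K := R_AbsRing) (V := R_NormedModule)).
           destruct Ek as [->|[->| ->]]; assumption.
      * destruct Ek as [->|[->| ->]]; unfold slice, coord, shift, comp, c1, c2, c3; simpl;
          auto_derive; trivial; ring.
      * destruct Ek as [->|[->| ->]]; unfold slice, coord, shift, comp, c1, c2, c3; simpl;
          auto_derive; trivial; ring.
      * destruct Ek as [->|[->| ->]]; unfold slice, coord, shift, comp, c1, c2, c3; simpl;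
          auto_derive; trivial; ring.
    + unfold dshift. destruct i as [|i]; [apply cont_opp, Cv' | apply continuous_const].
Qed.

Let dens_at (t : R) : R3 -> R := dens c m G1 chi a psi t.
Let energy_at (t : R) (x : R3) : R := energy c m q G1 chi a phi psi t x.
Let rho_at (t : R) (x : R3) : R := rho c m q chi phi psi t x.

Section AtTime.
Context (t del : R) (Hball : ball_in rh U t rad) (Hdel : 0 <= del) (Hrad1 : rad <= 1).
Context (HKG : forall x, norm3 (sub3 x (rh t)) <= rad -> KG_at c m q G1p chi a phi psi t x).
Context (HphiC : forall x, norm3 (sub3 x (rh t)) <= rad -> Rabs (phi t x) <= C).
Context (HvC : forall k, (1 <= k < 4)%nat -> Rabs (comp k (v t)) <= C).
Context (Hsphere : sphere_int (dens_at t) (rh t) rad <= del).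
Context (Hdens : ball_int (dens_at t) (rh t) rad <= C).

Let Hrc := diff_traj_cont rh v Hrh.
Let HCd : C0_on U (dens c m G1 chi a psi) := C0_dens.

(** Each of the three flux components is at most [B * (1 + C)] times the density, the [C] coming
    from the velocity; the integral of the density over the sphere supplies [del]. *)
Let flux_bound (V1 V2 V3 f : R -> R3 -> R) (B : R) : 0 <= B ->
  C0_on U V1 -> C0_on U V2 -> C0_on U V3 -> C0_on U f ->
  (forall x, norm3 (sub3 x (rh t)) <= rad ->
     Rabs (V1 t x) <= B * dens_at t x /\ Rabs (V2 t x) <= B * dens_at t x /\
     Rabs (V3 t x) <= B * dens_at t x /\ Rabs (f t x) <= B * dens_at t x) ->
  Rabs (flux rh (fun s x => V1 s x + c1 (v t) * f s x) (fun s x => V2 s x + c2 (v t) * f s x)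
       (fun s x => V3 s x + c3 (v t) * f s x) t rad) <= 3 * B * (1 + C) * del.
Proof.
  intros HB C1 C2 C3 Cf H.
  assert (CV : forall V k, C0_on U V -> C0_on U (fun s x => V s x + k * f s x)).
  { intros V k CV s x Hx. specialize (CV s x Hx). specialize (Cf s x Hx).
    unfold cont4 in *. cont_auto. }
  apply Rle_trans with (3 * B * (1 + C) * sphere_int (dens_at t) (rh t) rad).
  2:{ apply Rmult_le_compat_l; [|exact Hsphere].
      repeat apply Rmult_le_pos; lra. }
  apply (flux_abs rh U _ _ _ (dens c m G1 chi a psi)); auto.
  intros x Hx. destruct (H x Hx) as [B1 [B2 [B3 Bf]]].
  assert (E : forall y k, Rabs y <= B * dens_at t x -> Rabs k <= C ->
    Rabs (y + k * f t x) <= B * (1 + C) * dens_at t x).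
  { intros y k Hy Hk. eapply Rle_trans; [apply Rabs_triang|]. rewrite Rabs_mult.
    assert (Pk := Rabs_pos k). assert (Pf := Rabs_pos (f t x)).
    assert (Rabs k * Rabs (f t x) <= C * (B * dens_at t x)) by (apply Rmult_le_compat; lra).
    lra. }
  assert (E1 := E _ (c1 (v t)) B1 (HvC 1%nat ltac:(lia))).
  assert (E2 := E _ (c2 (v t)) B2 (HvC 2%nat ltac:(lia))).
  assert (E3 := E _ (c3 (v t)) B3 (HvC 3%nat ltac:(lia))).
  change (dens c m G1 chi a psi t x) with (dens_at t x). lra.
Qed.

Let HK := dens_const_nonneg.
Let Ccur k (Hk : (1 <= k < 4)%nat) : C0_on U (current k) :=
  C1_C0 _ _ _ (C1_current k ltac:(lia)).
Let Cphi k (Hk : (1 <= k < 4)%nat) : C0_on U (dphi k) := C1_C0_partial _ _ _ k ltac:(lia) Hphi.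
Let Crho : C0_on U rho_at := C1_C0 _ _ _ C1_rho.

Let power (s : R) (x : R3) : R :=
  - (dphi 1 s x * current 1 s x + dphi 2 s x * current 2 s x + dphi 3 s x * current 3 s x).

Let Cpower : C0_on U power.
Proof.
  intros s x Hx.
  assert (J1 := Ccur 1 ltac:(lia) s x Hx). assert (J2 := Ccur 2 ltac:(lia) s x Hx).
  assert (J3 := Ccur 3 ltac:(lia) s x Hx). assert (P1 := Cphi 1 ltac:(lia) s x Hx).
  assert (P2 := Cphi 2 ltac:(lia) s x Hx). assert (P3 := Cphi 3 ltac:(lia) s x Hx).
  unfold cont4 in *. unfold power. cont_auto.
Qed.

(** Here [l] is the flux of S + E v through the sphere; the source term is kept exact, to be
    combined with the dipole identity. *)
Lemma energy_derivative : exists l,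
  is_derive (fun s => ball_int (energy_at s) (rh s) rad) t (l + ball_int (power t) (rh t) rad) /\
  Rabs l <= 3 * dens_const * (1 + C) * del.
Proof.
  eexists. split.
  - apply (balance_law rh v U rad energy_at denergy Hrh Hv HU Hrad C1_energy
      (eflux 1) (eflux 2) (eflux 3) (deflux 1) (deflux 2) (deflux 3) power
      (C1_eflux 1 ltac:(lia)) (C1_eflux 2 ltac:(lia)) (C1_eflux 3 ltac:(lia)) Cpower t Hball).
    intros x Hx. apply (energy_law t x (Hball x Hx) (HKG x Hx)).
  - apply flux_bound; [exact HK | | | | |].
    + apply (C1_C0 _ _ _ (C1_eflux 1 ltac:(lia))).
    + apply (C1_C0 _ _ _ (C1_eflux 2 ltac:(lia))).
    + apply (C1_C0 _ _ _ (C1_eflux 3 ltac:(lia))).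
    + apply (C1_C0 _ _ _ C1_energy).
    + intros x Hx. destruct (density_bounds t x (HphiC x Hx)) as [BE [_ BJ]].
      split; [apply (BJ 1%nat); lia|]. split; [apply (BJ 2%nat); lia|].
      split; [apply (BJ 3%nat); lia | exact BE].
Qed.

Let negJ (k : nat) (s : R) (x : R3) : R := - 1 * current k s x.
Let dnegJ (k i : nat) (s : R) (x : R3) : R := 0 * current k s x + - 1 * dcurrent k i s x.
Let C1_negJ k (Hk : (1 <= k < 4)%nat) : C1_on U (negJ k) (dnegJ k) :=
  C1_mult U _ _ _ _ (C1_const U (- 1)) (C1_current k ltac:(lia)).

Let Rabs_negJ k s x : Rabs (negJ k s x) = Rabs (current k s x).
Proof. unfold negJ. replace (- 1 * current k s x) with (- current k s x) by ring. apply Rabs_Ropp. Qed.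

Lemma charge_derivative : exists l,
  is_derive (fun s => ball_int (rho_at s) (rh s) rad) t l /\
  Rabs l <= 3 * dens_const * (1 + C) * del.
Proof.
  eexists. split.
  - eapply is_derive_eq.
    + apply (balance_law rh v U rad rho_at drho Hrh Hv HU Hrad C1_rho
        (negJ 1) (negJ 2) (negJ 3) (dnegJ 1) (dnegJ 2) (dnegJ 3) (fun _ _ => 0)
        (C1_negJ 1 ltac:(lia)) (C1_negJ 2 ltac:(lia)) (C1_negJ 3 ltac:(lia))
        (C1_C0 _ _ _ (C1_const U 0)) t Hball).
      intros x Hx. rewrite (charge_law t x (Hball x Hx) (HKG x Hx)). unfold dnegJ. ring.
    (* The source is zero; its integral vanishes by linearity with both coefficients 0. *)
    + assert (E := ball_int_lin rh U t rad Hrc HU Hrad Hball (fun _ _ => 0) (fun _ _ => 0) 0 0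
        (C1_C0 _ _ _ (C1_const U 0)) (C1_C0 _ _ _ (C1_const U 0))).
      rewrite (ball_int_ext rh t rad Hrad (fun _ _ => 0) (fun _ _ => 0 * 0 + 0 * 0)) by (intros; ring).
      rewrite E, !Rmult_0_l, !Rplus_0_r. reflexivity.
  - apply flux_bound; [exact HK | | | | exact Crho |].
    + apply (C1_C0 _ _ _ (C1_negJ 1 ltac:(lia))).
    + apply (C1_C0 _ _ _ (C1_negJ 2 ltac:(lia))).
    + apply (C1_C0 _ _ _ (C1_negJ 3 ltac:(lia))).
    + intros x Hx. destruct (density_bounds t x (HphiC x Hx)) as [_ [BR BJ]].
      rewrite !Rabs_negJ.
      split; [apply (BJ 1%nat); lia|]. split; [apply (BJ 2%nat); lia|].
      split; [apply (BJ 3%nat); lia | exact BR].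
Qed.

Let shift_bound k x : (1 <= k < 4)%nat -> norm3 (sub3 x (rh t)) <= rad -> Rabs (shift k t x) <= rad.
Proof.
  intros Hk Hx. destruct (coord_le_norm3 (sub3 x (rh t))) as [B1 [B2 B3]].
  assert (Ek : k = 1%nat \/ k = 2%nat \/ k = 3%nat) by lia.
  eapply Rle_trans; [|exact Hx].
  destruct Ek as [->|[->| ->]]; [exact B1 | exact B2 | exact B3].
Qed.

Let dipole_source (k : nat) (s : R) (x : R3) : R := current k s x + - comp k (v s) * rho_at s x.

Let Cdipole_source k : (1 <= k < 4)%nat -> C0_on U (dipole_source k).
Proof.
  intros Hk s x Hx. assert (J := Ccur k Hk s x Hx). assert (Rr := Crho s x Hx).
  assert (V := C1_C0_partial _ _ _ 0%nat ltac:(lia) (C1_shift k Hk) s x Hx).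
  unfold cont4 in *. unfold dshift in V. unfold dipole_source. apply cont_plus; [exact J|].
  apply cont_mult; assumption.
Qed.

(** d_t of (x - rh)_k rho equals - v_k rho - (x - rh)_k div J, that is - div((x - rh)_k J) + J_k -
    v_k rho: the last two terms are [dipole_source]. *)
Lemma dipole_derivative k : (1 <= k < 4)%nat -> exists l,
  is_derive (dipole k) t (l + ball_int (dipole_source k t) (rh t) rad) /\
  Rabs l <= 3 * dens_const * (1 + C) * del.
Proof.
  intros Hk. assert (CS := C1_shift k Hk).
  assert (CV : forall j, (1 <= j < 4)%nat -> C1_on U (fun s x => shift k s x * negJ j s x)
    (fun i s x => dshift k i s x * negJ j s x + shift k s x * dnegJ j i s x)).
  { intros j Hj. apply (C1_mult U _ _ _ _ CS (C1_negJ j Hj)). }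
  assert (Cf := C1_mult U _ _ _ _ CS C1_rho).
  assert (V1 := CV 1%nat ltac:(lia)). assert (V2 := CV 2%nat ltac:(lia)).
  assert (V3 := CV 3%nat ltac:(lia)).
  eexists. split.
  - apply (balance_law rh v U rad (fun s x => shift k s x * rho_at s x) _ Hrh Hv HU Hrad Cf
      _ _ _ _ _ _ (dipole_source k) V1 V2 V3 (Cdipole_source k Hk) t Hball).
    intros x Hx. rewrite (charge_law t x (Hball x Hx) (HKG x Hx)).
    unfold dipole_source, dshift, negJ, dnegJ, rho_at.
    assert (Ek : k = 1%nat \/ k = 2%nat \/ k = 3%nat) by lia.
    destruct Ek as [->|[->| ->]]; simpl; ring.
  - apply flux_bound; [exact HK | | | | |].
    + apply (C1_C0 _ _ _ V1).
    + apply (C1_C0 _ _ _ V2).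
    + apply (C1_C0 _ _ _ V3).
    + apply (C1_C0 _ _ _ Cf).
    + intros x Hx. destruct (density_bounds t x (HphiC x Hx)) as [_ [BR BJ]].
      assert (BS := shift_bound k x Hk Hx).
      (* As [rad <= 1], the factor (x - rh)_k costs nothing and the constant is the one of the
         charge law. *)
      assert (M : forall y, Rabs y <= dens_const * dens_at t x ->
        Rabs (shift k t x * y) <= dens_const * dens_at t x).
      { intros y Hy. rewrite Rabs_mult. assert (Py := Rabs_pos y).
        assert (Ps := Rabs_pos (shift k t x)). nra. }
      assert (N : forall j, (1 <= j < 4)%nat -> Rabs (negJ j t x) <= dens_const * dens_at t x).
      { intros j Hj. rewrite Rabs_negJ.
        apply (BJ j Hj). }
      split; [apply M, N; lia|]. split; [apply M, N; lia|].
      split; [apply M, N; lia | apply M, BR].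
Qed.

Lemma dipole_bound k : (1 <= k < 4)%nat -> Rabs (dipole k t) <= rad * dens_const * C.
Proof.
  intros Hk. apply Rle_trans with (rad * dens_const * ball_int (dens_at t) (rh t) rad).
  - apply (ball_int_abs rh U t rad Hrc HU Hrad Hball (fun s x => shift k s x * rho_at s x)
      (dens c m G1 chi a psi)).
    + apply (C1_C0 _ _ _ (C1_mult U _ _ _ _ (C1_shift k Hk) C1_rho)).
    + exact HCd.
    + intros x Hx. destruct (density_bounds t x (HphiC x Hx)) as [_ [BR _]].
      rewrite Rabs_mult, Rmult_assoc. apply Rmult_le_compat; try apply Rabs_pos.
      * apply shift_bound; assumption.
      * exact BR.
  - apply Rmult_le_compat_l; [apply Rmult_le_pos|]; assumption.
Qed.

(* Adding the dipole term [g . D] trades the power [grad phi . J] for [g . v rho], up to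
   boundary terms and the small field difference [grad phi - g]. *)
Lemma corrected_energy_derivative (g : R -> R3) (g' : R3) :
  (forall k, (1 <= k < 4)%nat -> is_derive (fun s => comp k (g s)) t (comp k g')) ->
  (forall k, (1 <= k < 4)%nat -> Rabs (comp k (g t)) <= C /\ Rabs (comp k g') <= C) ->
  (forall k x, (1 <= k < 4)%nat -> norm3 (sub3 x (rh t)) <= rad ->
     Rabs (dphi k t x - comp k (g t)) <= del) ->
  rad <= del ->
  exists l,
    is_derive (fun s => ball_int (energy_at s) (rh s) rad
      + (comp 1 (g s) * dipole 1 s + comp 2 (g s) * dipole 2 s + comp 3 (g s) * dipole 3 s)) t
      (l - dot3 (v t) (g t) * ball_int (rho_at t) (rh t) rad) /\
    Rabs l <= (3 * dens_const * (1 + C) + 3 * C * (3 * dens_const * (1 + C))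
               + 3 * dens_const * C + 3 * C * dens_const * C) * del.
Proof.
  intros Hg Hgb Hgd Hrd.
  destruct energy_derivative as [lE [DE BE]].
  destruct (dipole_derivative 1 ltac:(lia)) as [l1 [D1 B1]].
  destruct (dipole_derivative 2 ltac:(lia)) as [l2 [D2 B2]].
  destruct (dipole_derivative 3 ltac:(lia)) as [l3 [D3 B3]].
  assert (Db1 := dipole_bound 1 ltac:(lia)). assert (Db2 := dipole_bound 2 ltac:(lia)).
  assert (Db3 := dipole_bound 3 ltac:(lia)).
  destruct (Hgb 1%nat ltac:(lia)) as [Gb1 Gb1']. destruct (Hgb 2%nat ltac:(lia)) as [Gb2 Gb2'].
  destruct (Hgb 3%nat ltac:(lia)) as [Gb3 Gb3'].
  set (y1 := comp 1 (g t)) in *. set (y2 := comp 2 (g t)) in *. set (y3 := comp 3 (g t)) in *.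
  (* The field error (g - grad phi) . J, small because [dphi] is within [del] of [g] on the ball. *)
  set (rem := fun s x => (y1 + - dphi 1 s x) * current 1 s x + (y2 + - dphi 2 s x) * current 2 s x
    + (y3 + - dphi 3 s x) * current 3 s x).
  assert (Crem : C0_on U rem).
  { intros s x Hx.
    assert (J1 := Ccur 1 ltac:(lia) s x Hx). assert (J2 := Ccur 2 ltac:(lia) s x Hx).
    assert (J3 := Ccur 3 ltac:(lia) s x Hx). assert (P1 := Cphi 1 ltac:(lia) s x Hx).
    assert (P2 := Cphi 2 ltac:(lia) s x Hx). assert (P3 := Cphi 3 ltac:(lia) s x Hx).
    unfold cont4 in *. unfold rem. cont_auto. }
  assert (Brem : Rabs (ball_int (rem t) (rh t) rad) <= 3 * dens_const * C * del).
  { apply Rle_trans with (3 * del * dens_const * ball_int (dens_at t) (rh t) rad).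
    - apply (ball_int_abs rh U t rad Hrc HU Hrad Hball rem (dens c m G1 chi a psi) _ Crem HCd).
      intros x Hx. destruct (density_bounds t x (HphiC x Hx)) as [_ [_ BJ]].
      assert (M : forall k y, (1 <= k < 4)%nat -> Rabs (dphi k t x - y) <= del ->
        Rabs ((y + - dphi k t x) * current k t x) <= del * (dens_const * dens_at t x)).
      { intros k y Hk Hy. rewrite Rabs_mult. apply Rmult_le_compat; try apply Rabs_pos.
        - rewrite <- Rabs_Ropp. replace (- (y + - dphi k t x)) with (dphi k t x - y) by ring.
          exact Hy.
        - apply (BJ k Hk). }
      assert (M1 := M 1%nat y1 ltac:(lia) (Hgd 1%nat x ltac:(lia) Hx)).
      assert (M2 := M 2%nat y2 ltac:(lia) (Hgd 2%nat x ltac:(lia) Hx)).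
      assert (M3 := M 3%nat y3 ltac:(lia) (Hgd 3%nat x ltac:(lia) Hx)).
      unfold rem. eapply Rle_trans; [apply Rabs_triang|].
      eapply Rle_trans; [apply Rplus_le_compat_r, Rabs_triang|].
      change (dens c m G1 chi a psi t x) with (dens_at t x). lra.
    - replace (3 * dens_const * C * del) with (3 * del * dens_const * C) by ring.
      apply Rmult_le_compat_l; [|exact Hdens]. repeat apply Rmult_le_pos; lra. }
  (* Pointwise, - grad phi . J + g . (J - v rho) = (g - grad phi) . J - (v . g) rho, so the current
     survives only in the field error. *)
  assert (Esum : ball_int (power t) (rh t) rad + (y1 * ball_int (dipole_source 1 t) (rh t) rad
      + y2 * ball_int (dipole_source 2 t) (rh t) rad + y3 * ball_int (dipole_source 3 t) (rh t) rad)
    = ball_int (rem t) (rh t) rad - dot3 (v t) (g t) * ball_int (rho_at t) (rh t) rad).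
  { assert (LL := fun F G al be => ball_int_lin rh U t rad Hrc HU Hrad Hball F G al be).
    assert (Clin : forall F G al be, C0_on U F -> C0_on U G -> C0_on U (fun s x => al * F s x + be * G s x)).
    { intros F G al be CF CG s x Hx. specialize (CF s x Hx). specialize (CG s x Hx).
      unfold cont4 in *. cont_auto. }
    assert (S1 := Cdipole_source 1 ltac:(lia)). assert (S2 := Cdipole_source 2 ltac:(lia)).
    assert (S3 := Cdipole_source 3 ltac:(lia)).
    assert (L1 := LL _ _ 1 y1 Cpower S1). assert (C1 := Clin _ _ 1 y1 Cpower S1).
    assert (L2 := LL _ _ 1 y2 C1 S2). assert (C2 := Clin _ _ 1 y2 C1 S2).
    assert (L3 := LL _ _ 1 y3 C2 S3).
    assert (L4 := LL _ _ 1 (- dot3 (v t) (g t)) Crem Crho).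
    cbv beta in L1, L2, L3, L4.
    rewrite L2, L1 in L3.
    assert (EE := ball_int_ext rh t rad Hrad
      (fun t0 x => 1 * (1 * (1 * power t0 x + y1 * dipole_source 1 t0 x) + y2 * dipole_source 2 t0 x)
        + y3 * dipole_source 3 t0 x)
      (fun t0 x => 1 * rem t0 x + - dot3 (v t) (g t) * rho_at t0 x)).
    cbv beta in EE. rewrite L3, L4 in EE.
    assert (EE' := EE ltac:(intros x Hx; unfold power, dipole_source, rem, dot3, y1, y2, y3, comp; ring)).
    lra. }
  (* The four terms of the bound, in order: boundary flux of the energy, [g] against the boundary
     fluxes of the dipole, field error, and [g'] against the dipole itself, which is small because
     [rad <= del]. *)
  exists (lE + (y1 * l1 + y2 * l2 + y3 * l3) + ball_int (rem t) (rh t) rad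
    + (comp 1 g' * dipole 1 t + comp 2 g' * dipole 2 t + comp 3 g' * dipole 3 t)).
  split.
  - assert (M1 := is_derive_mult (K := R_AbsRing) _ _ _ _ _ (Hg 1%nat ltac:(lia)) D1 Rmult_comm).
    assert (M2 := is_derive_mult (K := R_AbsRing) _ _ _ _ _ (Hg 2%nat ltac:(lia)) D2 Rmult_comm).
    assert (M3 := is_derive_mult (K := R_AbsRing) _ _ _ _ _ (Hg 3%nat ltac:(lia)) D3 Rmult_comm).
    eapply is_derive_eq.
    + exact (is_derive_plus (K := R_AbsRing) (V := R_NormedModule) _ _ _ _ _ DE
        (is_derive_plus _ _ _ _ _ (is_derive_plus _ _ _ _ _ M1 M2) M3)).
    + unfold plus, mult; cbn -[comp dot3 ball_int dipole]. fold y1 y2 y3. lra.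
  - assert (PR : forall x y A B, Rabs x <= A -> Rabs y <= B -> Rabs (x * y) <= A * B).
    { intros x y A B Hx Hy. rewrite Rabs_mult. apply Rmult_le_compat; auto using Rabs_pos. }
    assert (T : forall x y A B, Rabs x <= A -> Rabs y <= B -> Rabs (x + y) <= A + B).
    { intros x y A B Hx Hy. eapply Rle_trans; [apply Rabs_triang|]. lra. }
    assert (Hw0 : rad * dens_const * C <= del * dens_const * C).
    { apply Rmult_le_compat_r; [exact HC|]. apply Rmult_le_compat_r; assumption. }
    assert (HB := T _ _ _ _ (T _ _ _ _ (T _ _ _ _ BE
        (T _ _ _ _ (T _ _ _ _ (PR _ _ _ _ Gb1 B1) (PR _ _ _ _ Gb2 B2)) (PR _ _ _ _ Gb3 B3))) Brem)
      (T _ _ _ _ (T _ _ _ _ (PR _ _ _ _ Gb1' (Rle_trans _ _ _ Db1 Hw0))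
        (PR _ _ _ _ Gb2' (Rle_trans _ _ _ Db2 Hw0))) (PR _ _ _ _ Gb3' (Rle_trans _ _ _ Db3 Hw0)))).
    eapply Rle_trans; [exact HB|]. right. ring.
Qed.

End AtTime.
End Fields.

(** * Passage to the limit *)

(** The derivative is only known pointwise and may be discontinuous, as [g'] may be; the mean value
    theorem asks for no integrability. *)
Lemma derivative_bound (f : R -> R) (a b B s t : R) :
  (forall x, a <= x <= b -> exists l, is_derive f x l /\ Rabs l <= B) ->
  a <= s <= b -> a <= t <= b -> Rabs (f t - f s) <= B * Rabs (t - s).
Proof.
  intros H Hs Ht.
  assert (HI : forall x, Rmin s t <= x <= Rmax s t -> a <= x <= b).
  { intros x. unfold Rmin, Rmax. destruct (Rle_dec s t); intros; lra. }
  assert (HD : forall x, a <= x <= b -> is_derive f x (Derive f x) /\ Rabs (Derive f x) <= B).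
  { intros x Hx. destruct (H x Hx) as [l [Hl Bl]]. rewrite (is_derive_unique _ _ _ Hl).
    split; assumption. }
  destruct (MVT_gen f s t (Derive f)) as [x [Hx E]].
  - intros x Hx. apply HD, HI. split; apply Rlt_le, Hx.
  - intros x Hx. apply continuity_pt_filterlim.
    apply (ex_derive_continuous (K := R_AbsRing) (V := R_NormedModule)).
    eexists. apply HD, HI, Hx.
  - rewrite E, Rabs_mult. apply Rmult_le_compat_r; [apply Rabs_pos|]. apply HD, HI, Hx.
Qed.

(** [grad0_dist] is built from [Derive], so differentiability of [phi] and of the affine [phi_inf]
    is what identifies its k-th entry with d - g_k; one entry is at most the norm. *)
Lemma partial_gap c phi rh p0 g t x k d : (1 <= k < 4)%nat ->
  is_derive (slice k phi t x) (coord k t x) d ->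
  Rabs (d - comp k (g t)) <= grad0_dist c phi (phi_inf rh p0 g) t x.
Proof.
  intros Hk Hd. unfold grad0_dist.
  set (F := fun s y => Cminus (realF phi s y) (realF (phi_inf rh p0 g) s y)).
  assert (E : fst (partial k F t x) = d - comp k (g t)).
  { apply is_derive_unique. apply (is_derive_line fst k F t x); [lia|].
    assert (Hinf : is_derive (slice k (phi_inf rh p0 g) t x) (coord k t x) (comp k (g t))).
    { destruct x as [[x1 x2] x3]. assert (Ek : k = 1%nat \/ k = 2%nat \/ k = 3%nat) by lia.
      destruct Ek as [->|[->| ->]]; unfold slice, phi_inf, dot3, sub3, coord, comp, c1, c2, c3; simpl;
        auto_derive; trivial; ring. }
    generalize (is_derive_minus (K := R_AbsRing) (V := R_NormedModule) _ _ _ _ _ Hd Hinf).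
    apply is_derive_ext. intros s. destruct k as [|[|[|k]]]; reflexivity. }
  rewrite <- E. set (z := partial k F t x).
  apply Rle_trans with (Cmod z); [eapply Rle_trans; [apply Rmax_l | apply Rmax_Cmod]|].
  rewrite <- (sqrt_pow2 (Cmod z)) by apply Cmod_ge_0. apply sqrt_le_1_alt.
  unfold grad0_sq.
  assert (P0 : 0 <= Cmod (partial 0 F t x) ^ 2 / c ^ 2).
  { unfold Rdiv. rewrite <- pow_inv, <- Rpow_mult_distr. apply pow2_ge_0. }
  assert (P1 := pow2_ge_0 (Cmod (partial 1 F t x))). assert (P2 := pow2_ge_0 (Cmod (partial 2 F t x))).
  assert (P3 := pow2_ge_0 (Cmod (partial 3 F t x))).
  assert (Ek : k = 1%nat \/ k = 2%nat \/ k = 3%nat) by lia.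
  unfold z. destruct Ek as [->|[->| ->]]; lra.
Qed.

Lemma comp_le_norm3 k x : Rabs (comp k x) <= norm3 x.
Proof.
  destruct (coord_le_norm3 x) as [H1 [H2 H3]]. destruct k as [|[|[|k]]]; assumption.
Qed.

Lemma dot3_bound x y C : (forall k, (1 <= k < 4)%nat -> Rabs (comp k x) <= C) ->
  (forall k, (1 <= k < 4)%nat -> Rabs (comp k y) <= C) -> Rabs (dot3 x y) <= 3 * C * C.
Proof.
  intros Hx Hy.
  assert (P : forall k, (1 <= k < 4)%nat -> Rabs (comp k x * comp k y) <= C * C).
  { intros k Hk. rewrite Rabs_mult. apply Rmult_le_compat; auto using Rabs_pos. }
  assert (P1 := P 1%nat ltac:(lia)). assert (P2 := P 2%nat ltac:(lia)).
  assert (P3 := P 3%nat ltac:(lia)).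
  unfold dot3. eapply Rle_trans; [apply Rabs_triang|].
  eapply Rle_trans; [apply Rplus_le_compat_r, Rabs_triang|]. simpl in *. lra.
Qed.

Lemma is_lim_seq_near (s : nat -> R) (l eps : R) : is_lim_seq s l -> 0 < eps ->
  exists N, forall n, (N <= n)%nat -> Rabs (s n - l) < eps.
Proof.
  intros H Heps. apply is_lim_seq_spec in H. exact (H (mkposreal eps Heps)).
Qed.

Lemma C2_traj_diff rh : C2_traj rh -> diff_traj rh (vel rh) /\ cont_curve (vel rh).
Proof.
  intros [H1 [H2 H3]]. split; intros t; destruct (H1 t) as [A1 [B1 _]], (H2 t) as [A2 [B2 _]],
    (H3 t) as [A3 [B3 _]].
  - split; [|split]; apply Derive_correct; assumption.
  - split; [|split]; apply (ex_derive_continuous (K := R_AbsRing) (V := R_NormedModule)); assumption.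
Qed.

Theorem theorem2
  (c m q : R) (G1 G1p G1pp : R -> R) (Tm Tp : R) (rh : R -> R3) (Cst : R)
  (a chi Rn : nat -> R) (phi : nat -> R -> R3 -> R) (p0 : R -> R) (g : R -> R3)
  (psi : nat -> R -> R3 -> CC) (t0 E0 rho_inf : R) :
  0 < c -> 0 < m ->
  G1_hyp G1 G1p G1pp ->
  trajectory Tm Tp rh Cst ->
  localized c m Tm Tp rh Cst a chi Rn phi p0 g ->
  concentrating c m q G1 G1p Tm Tp rh Cst a chi Rn phi psi t0 E0 ->
  is_lim_seq (fun n => rhobar c m q rh chi Rn phi psi n t0) rho_inf ->
  forall eps, 0 < eps -> exists N, forall n, (N <= n)%nat -> forall t, Tm <= t <= Tp ->
    Rabs (Ebar c m q G1 rh a chi Rn phi psi n t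
          - (E0 - rho_inf * RInt (fun s => dot3 (vel rh s) (g s)) t0 t)) < eps.
Proof.
  intros Hc Hm HG [Htr Hvel] Hloc Hcon Hrho0 eps Heps.
  destruct Hloc as [Hpos [_ [_ [HR0 [_ [_ [HphiC2 [HphiB [Hdiff [Hgap HgB]]]]]]]]]].
  destruct Hcon as [HpsiC2 [HKG [Hball [Hsph [_ [Ht0 HE0]]]]]].
  destruct (C2_traj_diff rh Htr) as [Hrh Hv]. set (v := vel rh) in *.
  assert (HC : 0 <= Cst).
  { eapply Rle_trans; [apply sqrt_pos|]. apply (proj2 (HgB t0 Ht0)). }
  assert (HM := dens_const_nonneg c m q Hc Hm Cst). set (M := dens_const c m q Cst) in *.
  set (L := Tp - Tm). assert (HL : 0 <= L) by (unfold L; lra).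
  (* [A1 * del] will bound the derivative of the charge, and [K * del] the remainder in the
     derivative of the corrected energy. *)
  set (A1 := 3 * M * (1 + Cst)). assert (HA1 : 0 <= A1) by (repeat apply Rmult_le_pos; lra).
  assert (HMC : 0 <= M * Cst) by (apply Rmult_le_pos; assumption).
  assert (HCC : 0 <= Cst * Cst) by (apply Rmult_le_pos; assumption).
  set (K := A1 + 3 * Cst * A1 + 3 * M * Cst + 3 * Cst * M * Cst).
  assert (HK : 0 <= K).
  { assert (0 <= 3 * Cst * A1) by (repeat apply Rmult_le_pos; lra).
    assert (0 <= 3 * Cst * M * Cst) by (repeat apply Rmult_le_pos; lra). unfold K; lra. }
  (* Deviation of the charge from [rho_inf] in units of [del]: the drift over a time at most [L],
     plus 1 for the error at [t0]. *)
  set (B1 := A1 * L + 1). assert (HB1 : 0 <= B1).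
  { assert (0 <= A1 * L) by (apply Rmult_le_pos; assumption). unfold B1; lra. }
  (* The charge error enters the derivative of [Phi] multiplied by v . g, which is at most 3
     Cst^2. *)
  set (B2 := K + 3 * Cst * Cst * B1). assert (HB2 : 0 <= B2).
  { assert (0 <= 3 * Cst * Cst * B1) by (repeat apply Rmult_le_pos; lra). unfold B2; lra. }
  (* Final error in units of [del]: the variation of [Phi], the dipole correction at both [t] and
     [t0], and 1 for the energy at [t0]. *)
  set (B3 := B2 * L + 2 * (3 * Cst * (M * Cst)) + 1). assert (HB3 : 0 < B3).
  { assert (0 <= B2 * L) by (apply Rmult_le_pos; assumption).
    assert (0 <= 3 * Cst * (M * Cst)) by (repeat apply Rmult_le_pos; lra). unfold B3; lra. }
  (* The cap 1 yields [Rn n <= 1], used by the dipole estimate; [B3 + 1] makes the final inequality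
     strict. *)
  set (del := Rmin 1 (eps / (B3 + 1))).
  assert (Hdel : 0 < del) by (apply Rmin_pos; [lra | apply Rdiv_lt_0_compat; lra]).
  assert (Hdel1 : del <= 1) by apply Rmin_l.
  assert (Hdele : B3 * del < eps).
  { apply Rle_lt_trans with (B3 * (eps / (B3 + 1))); [apply Rmult_le_compat_l; [lra | apply Rmin_r]|].
    apply Rmult_lt_reg_r with (B3 + 1); [lra|]. field_simplify; [nra | lra]. }
  destruct (is_lim_seq_near _ _ _ HR0 Hdel) as [N1 HN1].
  destruct (Hgap del Hdel) as [N2 HN2].
  destruct (Hsph del Hdel) as [N3 HN3].
  destruct (is_lim_seq_near _ _ _ HE0 Hdel) as [N4 HN4].
  destruct (is_lim_seq_near _ _ _ Hrho0 Hdel) as [N5 HN5].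
  exists (N1 + N2 + N3 + N4 + N5)%nat. intros n Hn t Ht.
  specialize (HN1 n ltac:(lia)). specialize (HN2 n ltac:(lia)). specialize (HN3 n ltac:(lia)).
  specialize (HN4 n ltac:(lia)). specialize (HN5 n ltac:(lia)).
  destruct (Hpos n) as [Ha [Hchi HRn]].
  assert (HRdel : Rn n <= del) by (rewrite Rminus_0_r in HN1; apply Rabs_def2 in HN1; lra).
  destruct (C2_on_C1 _ _ (HphiC2 n)) as [U1 [HU1 [HS1 [Hphi1 _]]]].
  destruct (C2_on_C1 _ _ (HpsiC2 n)) as [U2 [HU2 [HS2 [Hu [Hw Hdd]]]]].
  (* A common neighbourhood of the tube for [phi n] and [psi n]. It depends on [n]; the constants
     above do not. *)
  set (U := fun t x => U1 t x /\ U2 t x).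
  assert (HU : open4 U) by (apply open4_inter; assumption).
  assert (S1 : forall t x, U t x -> U1 t x) by (intros s x Hx; apply Hx).
  assert (S2 : forall t x, U t x -> U2 t x) by (intros s x Hx; apply Hx).
  assert (HinU : forall s, Tm <= s <= Tp -> ball_in rh U s (Rn n)).
  { intros s Hs x Hx. split; [apply HS1 | apply HS2]; split; assumption. }
  assert (Hphi : C1_on U (phi n) (dphi (phi n))) by exact (C1_subset _ _ _ _ S1 Hphi1).
  apply (C1_subset _ _ _ _ S2) in Hu. apply (C1_subset _ _ _ _ S2) in Hw.
  assert (Hddu := fun i Hi => C1_subset _ _ _ _ S2 (proj1 (Hdd i Hi))).
  assert (Hddw := fun i Hi => C1_subset _ _ _ _ S2 (proj2 (Hdd i Hi))).
  assert (HKGs : forall s, Tm <= s <= Tp -> forall x, norm3 (sub3 x (rh s)) <= Rn n ->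
    KG_at c m q G1p (chi n) (a n) (phi n) (psi n) s x).
  { intros s Hs x Hx. apply HKG. split; assumption. }
  assert (HphiC : forall s, Tm <= s <= Tp -> forall x, norm3 (sub3 x (rh s)) <= Rn n ->
    Rabs (phi n s x) <= Cst).
  { intros s Hs x Hx. assert (B := HphiB n s x (conj Hs Hx)).
    assert (P : 0 <= grad0_norm c (phi n) s x) by apply sqrt_pos. lra. }
  assert (HvC : forall s, Tm <= s <= Tp -> forall k, (1 <= k < 4)%nat -> Rabs (comp k (v s)) <= Cst).
  { intros s Hs k _. eapply Rle_trans; [apply comp_le_norm3|]. apply (Hvel s Hs). }
  assert (HgC : forall s, Tm <= s <= Tp -> forall k, (1 <= k < 4)%nat ->
    Rabs (comp k (g s)) <= Cst /\ Rabs (comp k (dg g s)) <= Cst).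
  { intros s Hs k _. destruct (HgB s Hs) as [_ [Q1 Q2]].
    split; (eapply Rle_trans; [apply comp_le_norm3|]; assumption). }
  assert (Hgd : forall s k, (1 <= k < 4)%nat -> is_derive (fun r => comp k (g r)) s (comp k (dg g s))).
  { intros s k Hk. destruct (Hdiff s) as [_ [D1 [D2 D3]]].
    assert (Ek : k = 1%nat \/ k = 2%nat \/ k = 3%nat) by lia.
    destruct Ek as [->|[->| ->]]; apply Derive_correct; assumption. }
  assert (Hgap' : forall s, Tm <= s <= Tp -> forall k x, (1 <= k < 4)%nat ->
    norm3 (sub3 x (rh s)) <= Rn n -> Rabs (dphi (phi n) k s x - comp k (g s)) <= del).
  { intros s Hs k x Hk Hx. assert (G := HN2 s x (conj Hs Hx)).
    assert (P := Rabs_pos (phi n s x - phi_inf rh p0 g s x)).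
    eapply Rle_trans; [apply (partial_gap c (phi n) rh p0 g s x k); [exact Hk|]|].
    - apply (proj2 (Hphi s x (HinU s Hs x Hx)) k). lia.
    - lra. }
  set (D := fun k => dipole c m q (chi n) (phi n) (psi n) rh (Rn n) k).
  set (Eb := fun s => Ebar c m q G1 rh a chi Rn phi psi n s).
  set (rb := fun s => rhobar c m q rh chi Rn phi psi n s).
  assert (Hcharge : forall s, Tm <= s <= Tp -> Rabs (rb s - rho_inf) <= B1 * del).
  { intros s Hs.
    assert (HB : Rabs (rb s - rb t0) <= A1 * del * Rabs (s - t0)).
    { apply (derivative_bound rb Tm Tp); [|exact Ht0|exact Hs]. intros r Hr.
      exact (charge_derivative c m q (chi n) (a n) G1 G1p G1pp (phi n) (psi n) U Hc Hm Hchi Ha HG HU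
        Hphi Hu Hw Hddu Hddw Cst HC rh v (Rn n) Hrh Hv (Rlt_le _ _ HRn) r del (HinU r Hr)
        (HKGs r Hr) (HphiC r Hr) (HvC r Hr) (HN3 r Hr)). }
    assert (HsL : Rabs (s - t0) <= L) by (apply Rabs_le; unfold L; lra).
    assert (A1 * del * Rabs (s - t0) <= A1 * del * L).
    { apply Rmult_le_compat_l; [apply Rmult_le_pos; lra | exact HsL]. }
    replace (rb s - rho_inf) with ((rb s - rb t0) + (rb t0 - rho_inf)) by ring.
    eapply Rle_trans; [apply Rabs_triang|]. change (Rabs (rb t0 - rho_inf) < del) in HN5. unfold B1. lra. }
  assert (HD : forall s, Tm <= s <= Tp -> forall k, (1 <= k < 4)%nat -> Rabs (D k s) <= del * (M * Cst)).
  { intros s Hs k Hk. apply Rle_trans with (Rn n * M * Cst).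
    - exact (dipole_bound c m q (chi n) (a n) G1 G1p G1pp (phi n) (psi n) U Hc Hm Hchi Ha HG HU
        Hphi Hu Hw Hddu Hddw Cst rh v (Rn n) Hrh Hv (Rlt_le _ _ HRn) s (HinU s Hs)
        (HphiC s Hs) (Hball n s Hs) k Hk).
    - rewrite Rmult_assoc. apply Rmult_le_compat_r; assumption. }
  set (gD := fun s => comp 1 (g s) * D 1%nat s + comp 2 (g s) * D 2%nat s + comp 3 (g s) * D 3%nat s).
  assert (HgD : forall s, Tm <= s <= Tp -> Rabs (gD s) <= 3 * Cst * (M * Cst) * del).
  { intros s Hs.
    assert (P : forall k, (1 <= k < 4)%nat -> Rabs (comp k (g s) * D k s) <= Cst * (del * (M * Cst))).
    { intros k Hk. rewrite Rabs_mult. apply Rmult_le_compat; try apply Rabs_pos.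
      - apply (HgC s Hs k Hk).
      - apply (HD s Hs k Hk). }
    assert (P1 := P 1%nat ltac:(lia)). assert (P2 := P 2%nat ltac:(lia)).
    assert (P3 := P 3%nat ltac:(lia)).
    unfold gD. eapply Rle_trans; [apply Rabs_triang|].
    eapply Rle_trans; [apply Rplus_le_compat_r, Rabs_triang|]. lra. }
  set (vg := fun s => dot3 (v s) (g s)).
  assert (Cvg : forall s, continuous vg s).
  { intros s. destruct (Hv s) as [V1 [V2 V3]]. destruct (Hdiff s) as [_ [D1 [D2 D3]]].
    apply (ex_derive_continuous (K := R_AbsRing) (V := R_NormedModule)) in D1.
    apply (ex_derive_continuous (K := R_AbsRing) (V := R_NormedModule)) in D2.
    apply (ex_derive_continuous (K := R_AbsRing) (V := R_NormedModule)) in D3.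
    unfold vg, dot3. cont_auto. }
  (* [v] is continuous and [g] differentiable on the whole line, so [vg] is continuous and [I] has
     derivative [vg] everywhere. *)
  set (I := fun s => RInt vg t0 s).
  assert (HI : forall s, is_derive I s (vg s)).
  { intros s. apply (is_derive_RInt (V := R_NormedModule) vg I t0 s); [|apply Cvg].
    apply filter_forall. intros r. apply (RInt_correct (V := R_CompleteNormedModule)).
    apply (ex_RInt_continuous (V := R_CompleteNormedModule)). intros z _. apply Cvg. }
  (* The term [rho_inf * I] cancels the main part of - (v . g) [rb] in the derivative, leaving only
     the charge error times v . g. *)
  set (Phi := fun s => Eb s + gD s + rho_inf * I s).
  assert (HPhi : Rabs (Phi t - Phi t0) <= B2 * del * Rabs (t - t0)).
  { apply (derivative_bound Phi Tm Tp); [|exact Ht0|exact Ht]. intros s Hs.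
    destruct (corrected_energy_derivative c m q (chi n) (a n) G1 G1p G1pp (phi n) (psi n) U Hc Hm
      Hchi Ha HG HU Hphi Hu Hw Hddu Hddw Cst HC rh v (Rn n) Hrh Hv (Rlt_le _ _ HRn) s del
      (HinU s Hs) (Rlt_le _ _ Hdel) (Rle_trans _ _ _ HRdel Hdel1) (HKGs s Hs) (HphiC s Hs)
      (HvC s Hs) (HN3 s Hs) (Hball n s Hs) g (dg g s) (Hgd s) (HgC s Hs) (Hgap' s Hs) HRdel)
      as [l [Dl Bl]].
    exists (l - vg s * rb s + rho_inf * vg s). split.
    - exact (is_derive_plus (K := R_AbsRing) (V := R_NormedModule) _ _ _ _ _ Dl
        (is_derive_scal _ _ rho_inf _ (HI s))).
    - replace (l - vg s * rb s + rho_inf * vg s) with (l + - (vg s * (rb s - rho_inf))) by ring.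
      eapply Rle_trans; [apply Rabs_triang|]. rewrite Rabs_Ropp, Rabs_mult.
      assert (Bvg : Rabs (vg s) <= 3 * Cst * Cst).
      { apply dot3_bound; [apply (HvC s Hs) | intros k Hk; apply (HgC s Hs k Hk)]. }
      assert (Rabs (vg s) * Rabs (rb s - rho_inf) <= 3 * Cst * Cst * (B1 * del)).
      { apply Rmult_le_compat; try apply Rabs_pos; [exact Bvg | exact (Hcharge s Hs)]. }
      fold M A1 in Bl. fold K in Bl. unfold B2. lra. }
  assert (HtL : Rabs (t - t0) <= L) by (apply Rabs_le; unfold L; lra).
  assert (HPhiL : Rabs (Phi t - Phi t0) <= B2 * L * del).
  { eapply Rle_trans; [exact HPhi|]. replace (B2 * L * del) with (B2 * del * L) by ring.
    apply Rmult_le_compat_l; [apply Rmult_le_pos; lra | exact HtL]. }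
  assert (It0 : I t0 = 0) by exact (RInt_point t0 vg).
  change (Rabs (Eb t0 - E0) < del) in HN4.
  change (Rabs (Eb t - (E0 - rho_inf * I t)) < eps).
  (* Since [I t0 = 0], the function [Phi] differs from [Eb] at [t0] only by the small [gD t0]. *)
  replace (Eb t - (E0 - rho_inf * I t))
    with ((Phi t - Phi t0) + (Eb t0 - E0) + gD t0 + - gD t) by (unfold Phi; rewrite It0; ring).
  eapply Rle_lt_trans; [apply Rabs_triang|]. rewrite Rabs_Ropp.
  eapply Rle_lt_trans; [apply Rplus_le_compat_r, Rabs_triang|].
  eapply Rle_lt_trans; [apply Rplus_le_compat_r, Rplus_le_compat_r, Rabs_triang|].
  assert (Q1 := HgD t0 Ht0). assert (Q2 := HgD t Ht).
  apply Rle_lt_trans with (B3 * del); [|exact Hdele]. unfold B3. lra.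
Qed.
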